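(* There is an absolute constant $C$ such that the following holds. Let $N\ge3$, $n\ge17$, $\epsilon\in(0,1]$, $\delta\in(0,e^{-1})$. The algorithm $\mathrm{PMWG}(X,F,\epsilon,\delta,\alpha,n)$ is $(\epsilon,\delta)$-differentially private, and for any $\kappa\ge1$ and $\beta\in(0,2^{-15/2})$ it is $(\alpha,\beta)$-accurate for every (adaptively chosen) query stream $F$ with $\sum_{\tau=n}^t\ell_\tau\le\kappa\sum_{\tau=n}^t\exp\!\big(\frac{\alpha^2\epsilon\sqrt{n\tau}}{C\log^{1/2}(Nn)\log^{1/2}(1/\delta)}\big)$ for all $t\ge n$, as long as $$\alpha\ge C\left(\frac{\log^{1/2}(Nn)\log(\kappa n/\beta)\log^{1/2}(1/\delta)}{n\epsilon}\right)^{1/2}.$$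
   Context: Data universe $[N]$. A database of size $t$ is a histogram $x\in\Delta([N])\subseteq\mathbb R^N$ with $x^i=n_i/t$, $n_i\in\mathbb N$, $\sum_i n_i=t$; same-size databases are neighboring if they differ in one entry. A linear query is $f\in[0,1]^N$ with $f(x)=\langle f,x\rangle$. A database stream $X=\{x_t\}_{t\ge n}$ has $x_t$ of size $t$, $x_{t+1}$ obtained from $x_t$ by adding one entry; streams $X,X'$ are neighboring if for some $t\ge n$, $x_\tau=x'_\tau$ for $n\le\tau<t$ and $x_\tau,x'_\tau$ neighboring for $\tau\ge t$. A query stream $F=\{\{f_{t,j}\}_{j=1}^{\ell_t}\}_{t\ge n}$ of linear queries, $f_{t,j}$ arriving when the database has size $t$, may be chosen adaptively. An algorithm is $(\epsilon,\delta)$-differentially private if for all neighboring streams and every set $S$ of output transcripts, $\Pr[\mathcal A(X)\in S]\le e^\epsilon\Pr[\mathcal A(X')\in S]+\delta$. It is $(\alpha,\beta)$-accurate for $F$ if for every database stream, with probability at least $1-\beta$, every query $f_{t,j}$ receives an answer $a_{t,j}$ with $|f_{t,j}(x_t)-a_{t,j}|\le\alpha$. $\mathrm{Lap}(b)$ has density $\frac1{2b}e^{-|z|/b}$. Subroutines (threshold $T$, noise function $\xi$, on the database stream). NATG: when started it draws $\eta\sim\mathrm{Lap}(2)$; on each subsequent query $g$ arriving at time $t$ it draws fresh $\nu\sim\mathrm{Lap}(4/\xi_t)$; if $g(x_t)+\nu\ge T+\eta/\xi_t$ it outputs $g(x_t)+Z$, $Z\sim\mathrm{Lap}(8/\xi_t)$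 fresh, and halts; otherwise outputs $\bot$. NSG: processes queries in order; whenever a query arrives and no NATG instance is running, it starts a fresh NATG instance with the same $T,\xi$; it outputs the running instance's answer. $\mathrm{PMWG}(X,F,\epsilon,\delta,\alpha,n)$: set $\xi_t=\frac{\alpha^2n^{1/2}}{162\log(Nn)}\epsilon t^{1/2}$ if $\delta=0$, and $\xi_t=\frac{\alpha n^{1/2}}{48\log^{1/2}(Nn)\log^{1/2}(1/\delta)}\epsilon t^{1/2}$ if $\delta>0$. Run NSG with $T=2\alpha/3$ and noise $\xi$. Maintain a public histogram $y$, initially $y^i=1/N$, and a hard-query count $H=0$; let $b_t=\frac{\log N}{t}+\frac{\log(t-1)}{t}+\log\frac{t}{t-1}$. On query $f=f_{t,j}$: (1) if the previous query arrived at time $t'<t$, set $y^i\leftarrow\frac{t'}{t}y^i+\frac{t-t'}{t}\cdot\frac1N$; (2) submit to NSG the queries $g_1(x)=f(x)-f(y)$ and $g_2(x)=f(y)-f(x)$, getting $a_1,a_2\in\mathbb R\cup\{\bot\}$; (3) if $a_1=a_2=\bot$, output $f(y)$; (4) otherwise set $H\leftarrow H+1$; if $H>\frac{36}{\alpha^2}(\log N+\sum_{\tau=n+1}^t b_\tau)$ halt with output $\bot$; else output $a=f(y)+a_1$ if $a_1\in\mathbb R$ and $a=f(y)-a_2$ otherwise; let $r=f$ if $a<f(y)$ and $r=1-f$ otherwise, and update $y^i\leftarrow y^i e^{-\alpha r^i/6}/\sum_{i'}y^{i'}e^{-\alpha r^{i'}/6}$.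
   Formalization: Privacy is claimed only for 0 < α ≤ 1: for very large α the bound on the hard-query count H is below 1, the mechanism halts at the first hard query, and (ε,δ)-differential privacy fails. Accuracy is claimed for every α satisfying the stated lower bound. *)

(* Defs.v *)
From HB Require Import structures.
From mathcomp Require Import all_boot all_order all_algebra.
From mathcomp Require Import all_classical all_reals all_analysis.

Set Implicit Arguments.
Unset Strict Implicit.
Unset Printing Implicit Defensive.
Import Order.TTheory GRing.Theory Num.Theory.
Import numFieldNormedType.Exports.

Local Open Scope classical_set_scope.
Local Open Scope ring_scope.

Section Databases.
Context {R : realType} {N : nat}.
Implicit Types (x : 'I_N -> R) (X : nat -> 'I_N -> R).

(* Linear queries, databases and public histograms are all vectors of R^N. *)
Definition is_linear_query (f : 'I_N -> R) := forall i, 0 <= f i <= 1.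

Definition eval (f x : 'I_N -> R) : R := \sum_(i < N) f i * x i.

Definition is_database (t : nat) x :=
  exists c : 'I_N -> nat,
    (\sum_(i < N) c i)%N = t /\ forall i, x i = (c i)%:R / t%:R.

(* An entry of type i is replaced by one of type j. *)
Definition neighboring (t : nat) x x' :=
  exists i j : 'I_N, i != j /\
    forall k, x' k = x k + ((k == j)%:R - (k == i)%:R) / t%:R.

Definition adds_entry (t : nat) x x' :=
  exists i : 'I_N, forall k, x' k = (t%:R * x k + (k == i)%:R) / t.+1%:R.

(* The values X t with t < n are junk. *)
Definition is_database_stream (n : nat) X :=
  forall t, (n <= t)%N -> is_database t (X t) /\ adds_entry t (X t) (X t.+1).

Definition neighboring_streams (n : nat) X X' :=
  exists2 t, (n <= t)%N &
    (forall tau, (n <= tau < t)%N -> X tau = X' tau) /\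
    (forall tau, (t <= tau)%N -> neighboring tau (X tau) (X' tau)).

End Databases.

(* An adaptive query stream: given the list h of all (real) answers received so
   far, [arrival F h] is the database size at which the next query arrives, or
   None if no further query is ever asked, and [query F h] is that query.
   Histories contain no ⊥, because the mechanism stops upon outputting ⊥. *)
Record query_stream (R : realType) (N : nat) := QueryStream {
  arrival : seq R -> option nat;
  query : seq R -> 'I_N -> R
}.

Section QueryStreams.
Context {R : realType} {N : nat}.
Implicit Types (F : query_stream R N) (h : seq R).

(* The number ell_tau of queries arriving at size tau in a run with answers h,
   counting the query asked right after h. *)
Definition ell F h (tau : nat) : nat :=
  \sum_(k < (size h).+1) (arrival F (take k h) == Some tau).

Definition is_query_stream (n : nat) F :=
  [/\ forall h, is_linear_query (query F h),
      forall h t, arrival F h = Some t -> (n <= t)%N,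
      forall h a t', arrival F (rcons h a) = Some t' ->
        exists2 t, arrival F h = Some t & (t <= t')%N,
      forall (a : nat -> R) t,
        exists L : nat, forall k, (ell F (mkseq a k) t <= L)%N &
      (* measurability in the answers *)
      (forall k t, measurable [set h : k.-tuple R | arrival F h = Some t]) /\
      (forall k i, measurable_fun setT (fun h : k.-tuple R => query F h i))].

End QueryStreams.

(* An output transcript: Some a at index k if the k-th query (counting from 0,
   over the whole stream) is answered by a; None if its answer is ⊥, if the
   mechanism has already halted, or if no such query is asked. *)
Definition transcript (R : realType) := nat -> option R.

(* The product sigma-algebra on transcripts. *)
Definition measurable_transcripts (R : realType) : set (set (transcript R)) :=
  <<s [set S | exists k (B : set R), measurable B /\
         S = [set tau : transcript R | exists2 a, tau k = Some a & B a]] >>.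

Section PrivacyAccuracy.
Context {R : realType} {N : nat} {d : measure_display}
  {Omega : measurableType d}.
Variable P : probability Omega R.
Implicit Type A : (nat -> 'I_N -> R) -> Omega -> transcript R.

Definition differentially_private (n : nat) (eps delta : R) A :=
  forall X X', is_database_stream n X -> is_database_stream n X' ->
    neighboring_streams n X X' ->
    forall S, measurable_transcripts S ->
      (P (A X @^-1` S) <= (expR eps)%:E * P (A X' @^-1` S) + delta%:E)%E.

(* Every query asked along the transcript (after the real answers h) receives a
   real answer, within alpha of its value on the database of its arrival. *)
Definition accurate_transcript (F : query_stream R N) (alpha : R)
    (X : nat -> 'I_N -> R) (tau : transcript R) :=
  forall h t, mkseq tau (size h) = map Some h -> arrival F h = Some t ->
    exists2 a, tau (size h) = Some a & `|eval (query F h) (X t) - a| <= alpha.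

Definition accurate (n : nat) (F : query_stream R N) (alpha beta : R) A :=
  forall X, is_database_stream n X ->
    ((1 - beta)%:E
       <= P [set w | accurate_transcript F alpha X (A X w)])%E.

End PrivacyAccuracy.

Definition laplace_pdf {R : realType} (b z : R) : R :=
  (2 * b)^-1 * expR (- (`|z| / b)).

Definition laplace_prob {R : realType} (b : R) (B : set R) : \bar R :=
  (\int[lebesgue_measure]_(z in B) (laplace_pdf b z)%:E)%E.

Definition mutually_independent {R : realType} {d : measure_display}
    {Omega : measurableType d} (P : probability Omega R) (I : eqType)
    (W : I -> Omega -> R) :=
  forall (s : seq I) (B : I -> set R), uniq s ->
    (forall i, measurable (B i)) ->
    P (\bigcap_(i in [set` s]) W i @^-1` B i)
    = (\prod_(i <- s) P (W i @^-1` B i))%E.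

(* The three draws of the NATG subroutine: eta, nu and Z. *)
Inductive noise_kind := Eta | Nu | Ans.
HB.instance Definition _ := gen_eqMixin noise_kind.

Section NSG.
Context {R : realType} {N : nat}.
Variables (T : R) (xi : nat -> R).

Definition noise_scale (c : noise_kind) (t : nat) : R :=
  match c with Eta => 2 | Nu => 4 / xi t | Ans => 8 / xi t end.

(* All the random draws are made beforehand: W c t m is the draw of kind c that
   is available to the query submitted to NSG with serial number m, should it
   arrive at size t.  As serial numbers are never reused, each draw used is
   fresh.  Sizes t < n never occur, and the scale may be 0 there. *)
Definition is_noise (n : nat) {d : measure_display} {Omega : measurableType d}
    (P : probability Omega R)
    (W : noise_kind -> nat -> nat -> {RV P >-> R}) :=
  (forall c t m, (n <= t)%N -> forall B : set R, measurable B ->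
     distribution P (W c t m) B = laplace_prob (noise_scale c t) B) /\
  mutually_independent P
    (fun i : noise_kind * nat * nat => W i.1.1 i.1.2 i.2 : Omega -> R).

(* One query g to NSG, arriving at size t with serial number m on the database
   x, with realized draws w.  The state s is Some eta if a NATG instance with
   threshold noise eta is running, None otherwise; None as an answer is ⊥. *)
Definition nsg (w : noise_kind -> nat -> nat -> R) (x : 'I_N -> R) (t m : nat)
    (g : ('I_N -> R) -> R) (s : option R) : option R * option R :=
  let eta := odflt (w Eta t m) s in
  if g x + w Nu t m >= T + eta / xi t then (Some (g x + w Ans t m), None)
  else (None, Some eta).

End NSG.

Section PMWG.
Context {R : realType} {N : nat}.
Variables (eps delta alpha : R) (n : nat).

Definition pmwg_xi (t : nat) : R :=
  if delta == 0 then
    alpha ^+ 2 * Num.sqrt n%:R / (162 * ln (N * n)%:R) * eps * Num.sqrt t%:R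
  else
    alpha * Num.sqrt n%:R
      / (48 * Num.sqrt (ln (N * n)%:R) * Num.sqrt (ln (1 / delta)))
      * eps * Num.sqrt t%:R.

Definition pmwg_b (t : nat) : R :=
  ln N%:R / t%:R + ln t.-1%:R / t%:R + ln (t%:R / t.-1%:R).

Definition hard_bound (t : nat) : R :=
  36 / alpha ^+ 2 * (ln N%:R + \sum_(n.+1 <= tau < t.+1) pmwg_b tau).

Record pmwg_state := PMWGState {
  last_time : option nat; (* arrival time of the previous query *)
  public : 'I_N -> R;
  hard : nat;
  nsg_state : option R
}.

Definition pmwg_init : pmwg_state :=
  PMWGState None (fun=> 1 / N%:R) 0 None.

Definition age (last : option nat) (t : nat) (y : 'I_N -> R) : 'I_N -> R :=
  if last is Some t' then
    if (t' < t)%N then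
      fun i => t'%:R / t%:R * y i + (t - t')%:R / t%:R * (1 / N%:R)
    else y
  else y.

Definition mw_update (r y : 'I_N -> R) : 'I_N -> R :=
  fun i => y i * expR (- (alpha * r i / 6))
           / \sum_(i' < N) y i' * expR (- (alpha * r i' / 6)).

(* The k-th query f, arriving at size t.  It submits to NSG the queries with
   serial numbers 2k and 2k+1.  The answer None is ⊥ and means halting. *)
Definition pmwg_step (w : noise_kind -> nat -> nat -> R) (x : 'I_N -> R)
    (k t : nat) (f : 'I_N -> R) (s : pmwg_state) : option R * pmwg_state :=
  let T := 2 * alpha / 3 in
  let y := age (last_time s) t (public s) in
  let g1 := fun z : 'I_N -> R => eval f z - eval f y in
  let g2 := fun z : 'I_N -> R => eval f y - eval f z in
  let: (a1, s1) := nsg T pmwg_xi w x t k.*2 g1 (nsg_state s) in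
  let: (a2, s2) := nsg T pmwg_xi w x t k.*2.+1 g2 s1 in
  let hard_step (a : R) :=
    let H := (hard s).+1 in
    if H%:R > hard_bound t then (None, PMWGState (Some t) y H s2)
    else
      let r := if a < eval f y then f else fun i => 1 - f i in
      (Some a, PMWGState (Some t) (mw_update r y) H s2) in
  match a1, a2 with
  | None, None => (Some (eval f y), PMWGState (Some t) y (hard s) s2)
  | Some b, _ => hard_step (eval f y + b)
  | None, Some b => hard_step (eval f y - b)
  end.

(* The answers to the first k queries and the resulting state, or None if the
   mechanism has halted or the query stream has ended before that. *)
Fixpoint pmwg_run (w : noise_kind -> nat -> nat -> R) (X : nat -> 'I_N -> R)
    (F : query_stream R N) (k : nat) : option (seq R * pmwg_state) :=
  if k is k'.+1 then
    if pmwg_run w X F k' is Some (h, s) then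
      if arrival F h is Some t then
        let: (a, s') := pmwg_step w (X t) k' t (query F h) s in
        omap (fun a => (rcons h a, s')) a
      else None
    else None
  else Some ([::], pmwg_init).

Definition pmwg (w : noise_kind -> nat -> nat -> R) (X : nat -> 'I_N -> R)
    (F : query_stream R N) : transcript R :=
  fun k => omap (fun hs => last 0 hs.1) (pmwg_run w X F k.+1).

End PMWG.

(* Main.v *)
(* Privacy.  Neighboring streams change the value of a submitted query by at most
   1/t at size t, so a NATG instance started at size s is
   (9/8) xi_s / s-differentially private, however long it runs.  The number of
   instances that are completed is limited by the bound on the hard queries, and
   so is the sum R of the squares of their privacy parameters.  The instances are
   composed through the inequality
     Pr[A in S] <= e^b Pr[A' in S] + exp(-(a - 1) b + 3/2 a^2 R),
   proved for all real b simultaneously by induction on the number of remaining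
   steps; b = eps and a = 4 ln(1/delta) / eps make the last term at most delta.
   Accuracy.  The draws are fixed in advance, so a union bound over sizes and
   serial numbers makes all the draws that can be used small, whatever the query
   stream adaptively does.  Then a hard query lowers the cross entropy
   -sum_i x^i ln y^i by at least alpha^2/36, whereas passing from size t-1 to t
   raises it by at most b_t, so the mechanism never halts. *)

Require Import Defs.
From HB Require Import structures.
From mathcomp Require Import all_boot all_order all_algebra.
From mathcomp Require Import all_classical all_reals all_analysis.
From mathcomp Require Import measurable_realfun.
From mathcomp Require Import ring lra.
Set Implicit Arguments.
Unset Strict Implicit.
Unset Printing Implicit Defensive.
Import Order.TTheory GRing.Theory Num.Theory.
Import numFieldNormedType.Exports.
Local Open Scope classical_set_scope.
Local Open Scope ring_scope.

(** * Laplace noise *)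

(** The number of NATG instances, their starting sizes and their privacy parameters depend on
    earlier answers, so a composition theorem for a list of mechanisms fixed in advance does not
    apply. Privacy is therefore a backward induction on the expected value of an event, and no
    likelihood ratio is ever formed; a potential on public states dominates the squares that can
    still be spent. Quantifying over all real [b] is what closes the induction: an instance of
    parameter [e] moves the exponent to [b - e] or [b + e], possibly below 0. The factor 9/8 is the
    price of one sparse vector run: 1/2 for moving the threshold noise, 1/2 for moving the noise of
    the single query that crosses the threshold, 1/8 for moving its answer. Two transfers surround
    this core: the draws in use have random indices, so a step must be shown to integrate against
    fixed laws; and transcripts are infinite, so their events are approximated by events on finitely
    many answers. *)

Section Laplace.
Context {R : realType}.
Local Notation mu := (@lebesgue_measure R).

Lemma lebesgue_measure_shift (s : R) (A : set R) : measurable A ->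
  pushforward mu ((fun x => x + s) : _ -> measurableTypeR R) A = mu A.
Proof.
move=> mA.
have ms : measurable_fun setT ((fun x => x + s) : measurableTypeR R -> measurableTypeR R).
  exact: measurable_funD.
pose h : {mfun measurableTypeR R >-> measurableTypeR R} :=
  HB.pack ((fun x => x + s) : measurableTypeR R -> measurableTypeR R) (isMeasurableFun.Build _ _ _ _ _ ms).
apply/esym/(@lebesgue_measure_unique _ (pushforward mu h)) => //= _ [[a b]] _ <-.
rewrite /pushforward.
rewrite [X in mu X = _](_ : _ = [set` `]a, b]]) // [X in _ = mu X](_ : _ = [set` `]a - s, b - s]]).
  rewrite !lebesgue_measure_itv/= !lte_fin ltrD2r -!EFinB; case: ifP => // _; congr EFin; ring.
by apply/seteqP; split => x /=; rewrite !in_itv/= ltrBlDr lerBrDr.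
Qed.

Lemma ge0_integral_shift (s : R) (B : set R) (f : R -> \bar R) :
  measurable B -> measurable_fun setT f -> (forall x, 0 <= f x)%E ->
  (\int[mu]_(x in (fun x => (x + s)%R) @^-1` B) f (x + s)%R =
   \int[mu]_(x in B) f x)%E.
Proof.
move=> mB mf f0.
have ms : measurable_fun setT ((fun x => x + s) : measurableTypeR R -> measurableTypeR R).
  exact: measurable_funD.
have h := @ge0_integral_pushforward _ _ (measurableTypeR R) (measurableTypeR R) R
  _ ms mu B f mB (measurable_funTS mf) (fun x _ => f0 x).
rewrite -[LHS]h; apply: eq_measure_integral => A mA _.
exact: lebesgue_measure_shift.
Qed.

Lemma measurable_laplace_pdf (b : R) : measurable_fun setT (laplace_pdf b).
Proof.
apply: measurable_funM => //; apply: measurableT_comp => //.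
apply: measurableT_comp => //; apply: measurable_funM => //.
Qed.

Lemma laplace_pdf_ge0 (b x : R) : 0 <= b -> 0 <= laplace_pdf b x.
Proof. by move=> b0; rewrite mulr_ge0 ?expR_ge0 // invr_ge0 mulr_ge0. Qed.

Lemma measurable_EFin_laplace_pdf (b : R) D : measurable_fun D (fun x => (laplace_pdf b x)%:E).
Proof. by apply: measurable_funTS; apply: measurableT_comp => //; exact: measurable_laplace_pdf. Qed.

Lemma measurable_shift (s : R) (B : set R) : measurable B ->
  measurable ((fun x => x + s) @^-1` B).
Proof.
move=> mB; rewrite -[X in measurable X]setTI.
by apply: (measurable_funD (@measurable_id _ _ setT) (measurable_cst s)).
Qed.

(** By the triangle inequality the density at [x] is at most [expR (|s| / b)] times the density at
    [x + s]. *)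
Lemma laplace_prob_shift (b s : R) (B : set R) : 0 < b -> measurable B ->
  (laplace_prob b ((fun x => (x + s)%R) @^-1` B) <=
   (expR (`|s| / b))%:E * laplace_prob b B)%E.
Proof.
move=> b0 mB; rewrite /laplace_prob -(@ge0_integral_shift s B) //; last 2 first.
- exact: measurable_EFin_laplace_pdf.
- by move=> x; rewrite lee_fin laplace_pdf_ge0 // ltW.
have mB' := measurable_shift s mB.
rewrite -ge0_integralZl //; last 2 first.
- apply: measurable_funTS; apply: measurableT_comp => //.
  apply: (measurableT_comp (measurable_laplace_pdf b)); exact: measurable_funD.
- by move=> x _; rewrite lee_fin laplace_pdf_ge0 // ltW.
apply: ge0_le_integral => //.
- by move=> x _; rewrite lee_fin laplace_pdf_ge0 // ltW.
- exact: measurable_EFin_laplace_pdf.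
- apply: measurable_funeM; apply: measurable_funTS; apply: measurableT_comp => //.
  apply: (measurableT_comp (measurable_laplace_pdf b)); exact: measurable_funD.
move=> x _; rewrite -EFinM lee_fin /laplace_pdf mulrCA ler_wpM2l //.
  by rewrite invr_ge0 mulr_ge0 // ltW.
rewrite -expRD ler_expR -mulrBl -mulNr ler_pM2r ?invr_gt0 //.
by have := ler_normD x s; lra.
Qed.

(** A tail is compared with a translate of itself: moving [B] back by [s] lands in a set of mass at
    most 1 and gains the factor [expR (- (c / b))] in the density, so the density is never
    integrated explicitly. *)
Lemma laplace_prob_tail (b c : R) (B B0 : set R) (s : R) : 0 < b ->
  measurable B -> measurable B0 -> (laplace_prob b B0 <= 1)%E ->
  (forall x, B (x + s) -> B0 x /\ c + `|x| <= `|x + s|) ->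
  (laplace_prob b B <= (expR (- (c / b)))%:E)%E.
Proof.
move=> b0 mB mB0 B01 Bs; rewrite /laplace_prob -(@ge0_integral_shift s B) //; last 2 first.
- exact: measurable_EFin_laplace_pdf.
- by move=> x; rewrite lee_fin laplace_pdf_ge0 // ltW.
have mB' := measurable_shift s mB.
apply: (@le_trans _ _ (\int[mu]_(x in (fun x => (x + s)%R) @^-1` B)
  ((expR (- (c / b)))%:E * (laplace_pdf b x)%:E)%E))%E.
  apply: ge0_le_integral => //.
  - by move=> x _; rewrite lee_fin laplace_pdf_ge0 // ltW.
  - apply: measurable_funTS; apply: measurableT_comp => //.
    apply: (measurableT_comp (measurable_laplace_pdf b)); exact: measurable_funD.
  - by apply: measurable_funeM; exact: measurable_EFin_laplace_pdf.
  move=> x /Bs [_ cx]; rewrite -EFinM lee_fin /laplace_pdf mulrCA ler_wpM2l //.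
    by rewrite invr_ge0 mulr_ge0 // ltW.
  rewrite -expRD ler_expR -!mulNr -mulrDl ler_pM2r ?invr_gt0 //.
  by lra.
rewrite ge0_integralZl //; last 2 first.
- exact: measurable_EFin_laplace_pdf.
- by move=> x _; rewrite lee_fin laplace_pdf_ge0 // ltW.
rewrite -[leRHS]mule1 lee_wpmul2l // ?lee_fin ?expR_ge0 //.
apply: le_trans B01; apply: ge0_subset_integral => //.
- exact: measurable_EFin_laplace_pdf.
- by move=> x _; rewrite lee_fin laplace_pdf_ge0 // ltW.
- by move=> x /Bs [].
Qed.

(** The factor 2 counts the two half-lines, each translated back to one ending at 0 whose mass is
    merely bounded by 1. *)
Lemma laplace_tail (L : probability R R) (b c : R) : 0 < b -> 0 <= c ->
  (forall B, measurable B -> L B = laplace_prob b B) ->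
  (L [set x | (c <= `|x|)%R] <= (2 * expR (- (c / b)))%:E)%E.
Proof.
move=> b0 c0 LE.
have -> : [set x : R | c <= `|x|] = [set` `]-oo, - c]] `|` [set` `[c, +oo[].
  apply/seteqP; split => x /=; rewrite !in_itv/= andbT.
    by rewrite ler_normr => /orP[]; [right|left; lra].
  by case=> h; rewrite ler_normr; apply/orP; [right; lra|left].
apply: (le_trans (measureU2 _ _ _)) => //.
rewrite mulr2n mulrDl mul1r EFinD; apply: leeD.
- suff : (laplace_prob b [set` `]-oo, (- c)%R]] <= (expR (- (c / b)))%:E)%E by rewrite -LE.
  apply: (@laplace_prob_tail _ _ _ [set` `]-oo, 0]] (- c)) => //.
    by rewrite -LE // probability_le1.
  move=> x /=; rewrite !in_itv/= => h; have x0 : x <= 0 by lra.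
  by split => //; rewrite !ler0_norm; lra.
- suff : (laplace_prob b [set` `[c%R, +oo[] <= (expR (- (c / b)))%:E)%E by rewrite -LE.
  apply: (@laplace_prob_tail _ _ _ [set` `[0, +oo[] c) => //.
    by rewrite -LE // probability_le1.
  move=> x /=; rewrite !in_itv/= !andbT => h; have x0 : 0 <= x by lra.
  by split => //; rewrite !ger0_norm; lra.
Qed.

Lemma ge0_integral_prob_shift (L : probability R R) (b s : R) (f : R -> \bar R) :
  0 < b -> (forall B, measurable B -> L B = laplace_prob b B) ->
  measurable_fun setT f -> (forall x, 0 <= f x)%E ->
  (\int[L]_x f (x + s)%R <= (expR (`|s| / b))%:E * \int[L]_x f x)%E.
Proof.
move=> b0 LE mf f0.
have ms : measurable_fun setT (fun x : R => x + s) by exact: measurable_funD.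
have e0 : 0 <= expR (`|s| / b) by exact: expR_ge0.
rewrite -(@ge0_integral_mscale _ _ _ L setT measurableT (NngNum e0) f) //.
pose h : {mfun R >-> R} :=
  HB.pack (fun x : R => x + s) (isMeasurableFun.Build _ _ _ _ _ ms).
have /= -> := esym (@ge0_integral_pushforward _ _ _ _ _ _ ms L setT f measurableT mf (fun x _ => f0 x)).
apply: (@ge0_le_measure_integral _ _ _ (pushforward L h) (mscale (NngNum e0) L)) => //=.
move=> S mS; rewrite /mscale/= /pushforward !LE //.
  exact: laplace_prob_shift.
exact: measurable_shift.
Qed.

End Laplace.

(** * A Gaussian bound on the hyperbolic cosine *)

Section Cosh.
Context {R : realType}.

(** The sharp constant would be 1/2; with 3/2 the inequality [1 + s <= expR s] is almost all that is
    needed. *)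
Lemma half_expRDexpRN_le (x : R) :
  (expR x + expR (- x)) / 2 <= expR (3 / 2 * x ^+ 2).
Proof.
set y := x ^+ 2; have y0 : 0 <= y by exact: sqr_ge0.
have yE : y = `|x| ^+ 2 by rewrite real_normK ?num_real.
have nx0 := normr_ge0 x.
(* Beyond [|x| = 2 / 3] already [|x|] is at most [3 / 2 * x ^+ 2]. Below it, [expR s <= (1 - s)^-1]
   averages to [(1 - y)^-1]. *)
have [yb|yb] := leP y (4 / 9); last first.
  have h (s : R) : expR s <= expR `|s| by rewrite ler_expR ler_norm.
  have := h x; have := h (- x); rewrite normrN.
  suff : expR `|x| <= expR (3 / 2 * y) by lra.
  rewrite ler_expR yE; have : 2 / 3 <= `|x| by rewrite leNgt; apply/negP => ?; move: yb; rewrite yE; nra.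
  nra.
have y1 : 0 < 1 - y by lra.
apply: (@le_trans _ _ (1 - y)^-1).
  have x1 : `|x| < 1 by rewrite ltNge; apply/negP => ?; move: yb; rewrite yE; nra.
  have /andP[xm xp] : - 1 < x < 1 by rewrite -ltr_norml.
  have h (s : R) : s < 1 -> expR s <= (1 - s)^-1.
    move=> s1; rewrite -[expR s]invrK lef_pV2 ?posrE ?invr_gt0 ?expR_gt0 ?subr_gt0 //.
    by rewrite -expRN; have := expR_ge1Dx (- s); lra.
  have := h x xp; have := h (- x) ltac:(lra); rewrite opprK.
  have -> : (1 - y)^-1 = ((1 + x)^-1 + (1 - x)^-1) / 2 by rewrite /y; field; rewrite !lt0r_neq0 //; lra.
  lra.
rewrite -[(1 - y)^-1]mul1r ler_pdivrMr //.
have h : 1 + y / 2 <= expR (y / 2) by exact: expR_ge1Dx.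
have h3 : (1 + y / 2) ^+ 3 <= expR (3 / 2 * y).
  have -> : 3 / 2 * y = y / 2 * 3%:R by field.
  by rewrite expRM_natr ?lerXn2r ?nnegrE ?expR_ge0 //; lra.
apply: (@le_trans _ _ ((1 + y / 2) ^+ 3 * (1 - y))); last by rewrite ler_wpM2r // ltW.
nra.
Qed.

End Cosh.

(** * Privacy of an abstract sequence of NATG instances *)

Section MeasurableNat.
Context d (X : measurableType d).

Lemma measurable_nat_fun d' (Y : measurableType d') (f : nat -> Y) : measurable_fun setT f.
Proof. by []. Qed.

(** The noise laws are indexed by the size, itself a function of the state; splitting on its
    countably many values reduces measurability to a fixed size. *)
Lemma measurable_fun_nat_cases d' (Y : measurableType d') (tau : X -> nat) (F : nat -> X -> Y) :
  measurable_fun setT tau -> (forall t, measurable_fun setT (F t)) ->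
  measurable_fun setT (fun x => F (tau x) x).
Proof.
move=> mtau mF _ B mB; rewrite setTI.
rewrite (_ : _ @^-1` B = \bigcup_t (tau @^-1` [set t] `&` F t @^-1` B)).
  apply: bigcupT_measurable => t; apply: measurableI; rewrite -[X in measurable X]setTI.
    exact: mtau.
  exact: mF.
apply/seteqP; split => [x Bx|x [t _ [/= <-]]] //.
by exists (tau x).
Qed.

Lemma measurable_fun_integral_family (R : realType) d' (Y : measurableType d')
  (tau : X -> nat) (m : nat -> probability Y R) (f : X -> Y -> \bar R) :
  measurable_fun setT tau -> (forall x y, 0 <= f x y)%E ->
  measurable_fun setT (fun p : X * Y => f p.1 p.2) ->
  measurable_fun setT (fun x => \int[m (tau x)]_y f x y)%E.
Proof.
move=> mtau f0 mf; apply: (measurable_fun_nat_cases mtau (F := fun t x => \int[m t]_y f x y)%E) => t.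
by apply: (@measurable_fun_fubini_tonelli_F _ _ _ _ _ (m t) _ mf) => -[].
Qed.

End MeasurableNat.

Section Machine.
Context {R : realType} {d : measure_display} {Z : measurableType d}.
Variables (live : Z -> bool) (tm : Z -> nat) (nb : Z -> Z) (nh : Z -> R -> Z).
Variables (T : R) (xi : nat -> R) (L : noise_kind -> nat -> probability R R).
Hypothesis mlive : measurable_fun setT live.
Hypothesis mtm : measurable_fun setT tm.
Hypothesis mnb : measurable_fun setT nb.
Hypothesis mnh : measurable_fun setT (fun p : Z * R => nh p.1 p.2).

(* NSG on an abstract state z, to be updated by [nb] after the answer ⊥ and by
   [nh] after a real answer.  The pair of a boolean and a real number tells
   whether a NATG instance is running, and its threshold noise. *)
Definition machine_step (g : Z -> R) (zs : Z * (bool * R)) (e v a : R) : Z * (bool * R) :=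
  if live zs.1 then
    let eta := if zs.2.1 then zs.2.2 else e in
    if T + eta / xi (tm zs.1) <= g zs.1 + v then (nh zs.1 (g zs.1 + a), (false, 0))
    else (nb zs.1, (true, eta))
  else zs.

(** The expectation of [phi] after [j] steps, as an iterated integral. All three kinds of draws are
    integrated at each step, used or not, to match a process whose draws are all made beforehand. *)
Fixpoint machine_value (g : Z -> R) (phi : Z -> \bar R) (j : nat) (zs : Z * (bool * R)) : \bar R :=
  if j is j'.+1 then
    (\int[L Eta (tm zs.1)]_e \int[L Nu (tm zs.1)]_v \int[L Ans (tm zs.1)]_a
      machine_value g phi j' (machine_step g zs e v a))%E
  else phi zs.1.

(* The NATG instance with threshold noise [eta] is run until it halts; the reward
   [chi i z] is collected there, with i steps left. *)
Fixpoint instance_value (g : Z -> R) (j : nat) (chi : nat -> Z -> \bar R) (z : Z) (eta : R) : \bar R :=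
  if j is j'.+1 then
    if live z then
      (\int[L Nu (tm z)]_v
        if (T + eta / xi (tm z) <= g z + v)%R
        then \int[L Ans (tm z)]_a chi j' (nh z (g z + a)%R)
        else instance_value g j' chi (nb z) eta)%E
    else chi 0%N z
  else chi 0%N z.

Section Measurability.
Variable (g : Z -> R).
Hypothesis mg : measurable_fun setT g.

Lemma measurable_machine_step : measurable_fun setT
  (fun p : Z * (bool * R) * R * R * R => machine_step g p.1.1.1 p.1.1.2 p.1.2 p.2).
Proof.
have m1 : measurable_fun setT (fun p : Z * (bool * R) * R * R * R => p.1.1.1) by do 3 apply: measurableT_comp => //.
have mz : measurable_fun setT (fun p : Z * (bool * R) * R * R * R => p.1.1.1.1) by apply: measurableT_comp => //.
have mgz : measurable_fun setT (fun p : Z * (bool * R) * R * R * R => g p.1.1.1.1) by apply: measurableT_comp => //.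
have meta : measurable_fun setT (fun p : Z * (bool * R) * R * R * R =>
    if p.1.1.1.2.1 then p.1.1.1.2.2 else p.1.1.2).
  apply: measurable_fun_ifT.
  - by do 5 apply: measurableT_comp => //.
  - by do 5 apply: measurableT_comp => //.
  - by do 3 apply: measurableT_comp => //.
apply: measurable_fun_ifT => //.
  by apply: (measurableT_comp mlive).
apply: measurable_fun_ifT => //.
- apply: measurable_fun_ler.
    apply: measurable_funD => //; apply: measurable_funM => //.
    apply: (measurableT_comp (measurable_nat_fun (fun t => (xi t)^-1))).
    exact: (measurableT_comp mtm).
  by apply: measurable_funD => //; do 2 apply: measurableT_comp => //.
- apply: measurable_fun_pair => //.
  apply: (measurableT_comp mnh (g := fun p : Z * (bool * R) * R * R * R => (p.1.1.1.1, g p.1.1.1.1 + p.2))).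
  by apply: measurable_fun_pair => //; apply: measurable_funD.
- apply: measurable_fun_pair => //; first exact: (measurableT_comp mnb).
  exact: measurable_fun_pair.
Qed.

Variable (phi : Z -> \bar R).
Hypothesis mphi : measurable_fun setT phi.
Hypothesis phi0 : forall z, (0 <= phi z)%E.

Lemma machine_value_ge0 j zs : (0 <= machine_value g phi j zs)%E.
Proof. by elim: j zs => [|j IH] zs //=; do 3 apply: integral_ge0 => ? _. Qed.

Lemma measurable_machine_value j : measurable_fun setT (machine_value g phi j).
Proof.
elim: j => [|j IH] /=; first exact: measurableT_comp.
have mt1 : measurable_fun setT (fun zs : Z * (bool * R) => tm zs.1) by exact: (measurableT_comp mtm).
apply: (measurable_fun_integral_family _ (f := fun zs e =>
  \int[L Nu (tm zs.1)]_v \int[L Ans (tm zs.1)]_a machine_value g phi j (machine_step g zs e v a)))%E => //.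
  by move=> ? ?; do 2 apply: integral_ge0 => ? _; exact: machine_value_ge0.
apply: (measurable_fun_integral_family _ (tau := fun p => tm p.1.1)
  (f := fun (p : Z * (bool * R) * R) v =>
  \int[L Ans (tm p.1.1)]_a machine_value g phi j (machine_step g p.1 p.2 v a)))%E => //.
- exact: (measurableT_comp mt1).
- by move=> ? ?; apply: integral_ge0 => ? _; exact: machine_value_ge0.
apply: (measurable_fun_integral_family _ (tau := fun p => tm p.1.1.1)
  (f := fun (p : Z * (bool * R) * R * R) a =>
  machine_value g phi j (machine_step g p.1.1 p.1.2 p.2 a)))%E => //.
- by apply: (measurableT_comp mt1); apply: measurableT_comp.
- by move=> ? ?; exact: machine_value_ge0.
exact: (measurableT_comp IH measurable_machine_step).
Qed.

End Measurability.

Lemma integral_prob_cst (m : probability R R) (c : \bar R) : (\int[m]_x c = c)%E.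
Proof. by rewrite integral_cst //= [X in (_ * X)%E](_ : _ = 1%E) ?mule1 //; exact: (probability_setT m). Qed.

Lemma machine_value_dead g phi j z s : ~~ live z -> machine_value g phi j (z, s) = phi z.
Proof.
move=> /negbTE lz; elim: j s => [//|j IH] s /=.
by rewrite /machine_step /= lz IH !integral_prob_cst.
Qed.

(** Cuts the run at the halting of the current instance, after which the machine is in the fresh
    state [(false, 0)]; instances are the units of the composition. *)
Lemma machine_value_running g phi j z eta :
  machine_value g phi j (z, (true, eta)) =
  instance_value g j (fun i z => machine_value g phi i (z, (false, 0))) z eta.
Proof.
elim: j z eta => [//|j IH] z eta; rewrite /= /machine_step/=.
case: ifPn => lz; last by rewrite machine_value_dead // !integral_prob_cst.
rewrite integral_prob_cst; apply: eq_integral => v _.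
by case: ifP => // _; rewrite integral_prob_cst IH.
Qed.

Lemma machine_value_fresh g phi j z : live z ->
  machine_value g phi j.+1 (z, (false, 0)) =
  (\int[L Eta (tm z)]_e instance_value g j.+1
    (fun i z => machine_value g phi i (z, (false, 0%R))) z e)%E.
Proof.
move=> lz /=; apply: eq_integral => e _; rewrite lz.
apply: eq_integral => v _; rewrite /machine_step/= lz.
by case: ifP => // _; rewrite integral_prob_cst machine_value_running.
Qed.

Section Instance.
Variable (g : Z -> R).
Hypothesis mg : measurable_fun setT g.
Implicit Type chi : nat -> Z -> \bar R.

Lemma instance_value_ge0 chi j z eta :
  (forall i z, 0 <= chi i z)%E -> (0 <= instance_value g j chi z eta)%E.
Proof.
move=> chi0; elim: j z eta => [|j IH] z eta //=; case: ifP => // _.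
by apply: integral_ge0 => v _; case: ifP => // _; apply: integral_ge0.
Qed.

Lemma measurable_ans chi j z : measurable_fun setT (chi j) ->
  measurable_fun setT (fun a => chi j (nh z (g z + a))).
Proof.
move=> mchi; apply: (measurableT_comp mchi).
apply: (measurableT_comp mnh (g := fun a => (z, g z + a))).
by apply: measurable_fun_pair => //; exact: measurable_funD.
Qed.

Lemma measurable_cond z eta :
  measurable_fun setT (fun v => T + eta / xi (tm z) <= g z + v).
Proof. by apply: measurable_fun_ler => //; apply: measurable_funD. Qed.

Lemma measurable_instance_value chi j :
  (forall i z, 0 <= chi i z)%E -> (forall i, measurable_fun setT (chi i)) ->
  measurable_fun setT (fun p : Z * R => instance_value g j chi p.1 p.2).
Proof.
move=> chi0 mchi; elim: j => [|j IH] /=; first exact: measurableT_comp.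
have mtz : measurable_fun setT (fun p : Z * R => tm p.1) by exact: (measurableT_comp mtm).
have mz : measurable_fun setT (fun p : Z * R * R => p.1.1) by exact: measurableT_comp.
have mgz : measurable_fun setT (fun p : Z * R * R => g p.1.1) by exact: measurableT_comp.
apply: measurable_fun_ifT; first exact: measurableT_comp.
  apply: (measurable_fun_integral_family (L Nu) (tau := fun p => tm p.1)
    (f := fun (p : Z * R) v => if (T + p.2 / xi (tm p.1) <= g p.1 + v)%R
        then \int[L Ans (tm p.1)]_a chi j (nh p.1 (g p.1 + a)%R)
        else instance_value g j chi (nb p.1) p.2)%E) => //.
    by move=> p v; case: ifP => // _; [exact: integral_ge0|exact: instance_value_ge0].
  apply: measurable_fun_ifT.
  - apply: measurable_fun_ler; last exact: measurable_funD.
    apply: measurable_funD => //; apply: measurable_funM.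
      by do 2 apply: measurableT_comp => //.
    apply: (measurableT_comp (measurable_nat_fun (fun t => (xi t)^-1))).
    exact: (measurableT_comp mtz).
  - apply: (measurable_fun_integral_family _ (tau := fun p => tm p.1.1)
      (f := fun (p : Z * R * R) a => chi j (nh p.1.1 (g p.1.1 + a)))) => //.
      exact: (measurableT_comp mtz).
    apply: (measurableT_comp (mchi j)).
    apply: (measurableT_comp mnh (g := fun p : Z * R * R * R => (p.1.1.1, g p.1.1.1 + p.2))).
    apply: measurable_fun_pair; first by do 2 apply: measurableT_comp => //.
    by apply: measurable_funD => //; apply: (measurableT_comp mgz).
  - apply: (measurableT_comp IH (g := fun p : Z * R * R => (nb p.1.1, p.1.2))).
    apply: measurable_fun_pair; first exact: (measurableT_comp mnb).
    exact: measurableT_comp.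
exact: measurableT_comp.
Qed.

Lemma measurable_instance_branches z eta (A B : \bar R) :
  measurable_fun setT (fun v => if T + eta / xi (tm z) <= g z + v then A else B).
Proof. by apply: measurable_fun_ifT => //; exact: measurable_cond. Qed.

Lemma instance_value_linear (c1 c2 : R) chi1 chi2 j z eta : 0 <= c1 -> 0 <= c2 ->
  (forall i z, 0 <= chi1 i z)%E -> (forall i, measurable_fun setT (chi1 i)) ->
  (forall i z, 0 <= chi2 i z)%E -> (forall i, measurable_fun setT (chi2 i)) ->
  (instance_value g j (fun i z => c1%:E * chi1 i z + c2%:E * chi2 i z) z eta =
   c1%:E * instance_value g j chi1 z eta + c2%:E * instance_value g j chi2 z eta)%E.
Proof.
move=> c10 c20 chi10 mchi1 chi20 mchi2.
elim: j z eta => [//|j IH] z eta /=; case: ifP => // _.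
have intlin (m : probability R R) (f1 f2 : R -> \bar R) :
    measurable_fun setT f1 -> measurable_fun setT f2 ->
    (forall x, 0 <= f1 x)%E -> (forall x, 0 <= f2 x)%E ->
    (\int[m]_x (c1%:E * f1 x + c2%:E * f2 x) = c1%:E * \int[m]_x f1 x + c2%:E * \int[m]_x f2 x)%E.
  move=> mf1 mf2 f10 f20; rewrite ge0_integralD //.
  - by rewrite !ge0_integralZl.
  - by move=> x _; rewrite mule_ge0.
  - exact: measurable_funeM.
  - by move=> x _; rewrite mule_ge0.
  - exact: measurable_funeM.
rewrite -intlin.
- apply: eq_integral => v _; case: ifP => _ //.
  by rewrite -intlin //; exact: measurable_ans.
- exact: measurable_instance_branches.
- exact: measurable_instance_branches.
- by move=> v; case: ifP => _; [exact: integral_ge0|exact: instance_value_ge0].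
- by move=> v; case: ifP => _; [exact: integral_ge0|exact: instance_value_ge0].
Qed.

Lemma instance_value_cst (c : \bar R) j z eta : instance_value g j (fun _ _ => c) z eta = c.
Proof.
elim: j z eta => [//|j IH] z eta /=; case: ifP => // _.
rewrite -[RHS](integral_prob_cst (L Nu (tm z))); apply: eq_integral => v _.
by case: ifP => // _; rewrite integral_prob_cst.
Qed.

(** The rewards need comparing only where the instance can halt: [good] is kept by the answers ⊥,
    and [stop] holds after a real answer. The reward [chi 0] is also collected in dead states and
    when the steps run out, so it is compared everywhere. *)
Lemma le_instance_value (good stop : Z -> Prop) chi1 chi2 j z eta :
  (forall i z, 0 <= chi1 i z)%E -> (forall i, measurable_fun setT (chi1 i)) ->
  (forall i z, 0 <= chi2 i z)%E -> (forall i, measurable_fun setT (chi2 i)) ->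
  (forall z, live z -> good z -> good (nb z)) ->
  (forall z a, live z -> good z -> stop (nh z a)) ->
  (forall z, chi1 0%N z <= chi2 0%N z)%E ->
  (forall i z, (i < j)%N -> stop z -> chi1 i z <= chi2 i z)%E ->
  good z -> (instance_value g j chi1 z eta <= instance_value g j chi2 z eta)%E.
Proof.
move=> chi10 mchi1 chi20 mchi2 gnb gnh chi00 chij gz.
elim: j z eta gz chij => [|j IH] z eta gz chij /=; first exact: chi00.
case: ifP => // lz.
apply: ge0_le_integral => //.
- by move=> v _; case: ifP => _; [exact: integral_ge0|exact: instance_value_ge0].
- exact: measurable_instance_branches.
- exact: measurable_instance_branches.
move=> v _; case: ifP => _.
  apply: ge0_le_integral => //; try exact: measurable_ans.
  by move=> a _; apply: chij => //; exact: gnh.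
apply: IH; first exact: gnb.
by move=> i z' ij; apply: chij; rewrite ltnW.
Qed.

End Instance.

(** * Privacy of a single instance *)

Section Privacy.
Hypothesis tm_gt0 : forall z, (0 < tm z)%N.
Hypothesis xi_gt0 : forall z, 0 < xi (tm z).
Hypothesis lawL : forall c z B, measurable B ->
  L c (tm z) B = laplace_prob (noise_scale xi c (tm z)) B.

(* A query arriving at size t changes by at most 1/t between neighboring streams,
   which costs [theta] when the noise is scaled by [xi t]. *)
Definition theta (z : Z) : R := xi (tm z) / (tm z)%:R.

Hypothesis theta_nb : forall z, live z -> live (nb z) -> theta (nb z) <= theta z.

Lemma theta_gt0 z : 0 < theta z.
Proof. by rewrite divr_gt0 // ltr0n. Qed.

(** The sparse vector coupling. With the threshold noise raised by [th], [gB] stays below the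
    threshold whenever [gA] does, so the answers ⊥ are free. Only the crossing query pays: its noise
    moves by at most [2 * th / xi t], at cost [th / 2], and its answer by [1 / t], at cost [th / 8].
    One [th] serves the whole instance because [theta] does not increase along it. *)
Lemma instance_value_shift (gA gB : Z -> R) chi j th z eta :
  measurable_fun setT gA -> measurable_fun setT gB ->
  (forall z, live z -> `|gA z - gB z| <= 1 / (tm z)%:R) ->
  (forall i z, 0 <= chi i z)%E -> (forall i, measurable_fun setT (chi i)) ->
  0 <= th -> (live z -> theta z <= th) ->
  (instance_value gA j chi z eta <=
   (expR (5 / 8 * th))%:E * instance_value gB j chi z (eta + th)%R)%E.
Proof.
move=> mgA mgB gAB chi0 mchi th0.
have le_exp x c : 0 <= c -> (0 <= x)%E -> (x <= (expR c)%:E * x)%E.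
  move=> c0 x0; rewrite -[leLHS]mul1e lee_wpmul2r // lee_fin.
  by rewrite -expR0 ler_expR.
elim: j z eta => [|j IH] z eta thz /=; first by apply: le_exp => //; lra.
case: ifP => lz; last by apply: le_exp => //; lra.
have {}thz := thz lz; have x0 := xi_gt0 z; have t0 := tm_gt0 z.
set t := tm z in thz x0 t0 *.
have gABz := gAB z lz; rewrite -/t in gABz.
have xt : xi t / t%:R <= th by [].
have tR : (0 : R) < t%:R by rewrite ltr0n.
have tth : 1 / t%:R <= th / xi t by rewrite ler_pdivlMr // mulrC mulrA mulr1.
set IA := (\int[L Ans t]_a chi j (nh z (gA z + a)%R))%E.
set IB := (\int[L Ans t]_a chi j (nh z (gB z + a)%R))%E.
set BA := instance_value gA j chi (nb z) eta.
set BB := instance_value gB j chi (nb z) (eta + th).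
have IA0 : (0 <= IA)%E by exact: integral_ge0.
have IB0 : (0 <= IB)%E by exact: integral_ge0.
have BA0 : (0 <= BA)%E by exact: instance_value_ge0.
have BB0 : (0 <= BB)%E by exact: instance_value_ge0.
have IAB : (IA <= (expR (th / 8))%:E * IB)%E.
  have -> : IA = (\int[L Ans t]_a (fun b => chi j (nh z (gB z + b)%R)) (a + (gA z - gB z))%R)%E.
    by apply: eq_integral => a _ /=; congr (chi j (nh z _)); ring.
  have h := @ge0_integral_prob_shift R (L Ans t) (8 / xi t) (gA z - gB z)
    (fun b => chi j (nh z (gB z + b))).
  apply: (le_trans (h _ _ _ _)) => //.
  - by rewrite divr_gt0.
  - by move=> B mB; exact: lawL.
  - exact: (@measurable_ans gB chi).
  rewrite lee_wpmul2r // lee_fin ler_expR invf_div mulrA ler_pM2r //.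
  apply: le_trans xt; rewrite mulrC ler_pM2l //.
  by rewrite -[leRHS]mul1r.
have BAB : (BA <= (expR (5 / 8 * th))%:E * BB)%E.
  by apply: IH => lnb; apply: le_trans thz; exact: theta_nb.
have mc g eta' (A B : \bar R) := measurable_instance_branches g z eta' A B.
have split g eta' (A B : \bar R) : (0 <= A)%E -> (0 <= B)%E ->
    (\int[L Nu t]_v (if (T + eta' / xi t <= g z + v)%R then A else B) =
     \int[L Nu t]_v (if (T + eta' / xi t <= g z + v)%R then A else 0) +
     \int[L Nu t]_v (if (T + eta' / xi t <= g z + v)%R then 0 else B))%E.
  move=> A0 B0; rewrite -ge0_integralD //; try exact: mc; try by move=> v _; case: ifP.
  by apply: eq_integral => v _; case: ifP => _; rewrite ?adde0 ?add0e.
rewrite (split gA eta IA BA) // (split gB (eta + th) IB BB) // ge0_muleDr; last 2 first.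
- by apply: integral_ge0 => v _; case: ifP.
- by apply: integral_ge0 => v _; case: ifP.
apply: leeD.
(* The shift of the noise that turns the crossing condition for [gB] and [eta + th] into the one for
   [gA] and [eta]. *)
- set s := th / xi t + (gA z - gB z).
  have s0 : 0 <= s by have := ler_norm (gB z - gA z); rewrite distrC /s; lra.
  have s2 : s <= 2 * (th / xi t) by have := ler_norm (gA z - gB z); rewrite /s; lra.
  pose F v : \bar R := if (T + (eta + th) / xi t <= gB z + v)%R then IB else 0%E.
  have F0 v : (0 <= F v)%E by rewrite /F; case: ifP.
  have mF : measurable_fun setT F by exact: (mc gB (eta + th) IB 0%E).
  have mFs : measurable_fun setT (fun v : R => F (v + s)).
    have ms : measurable_fun setT (fun v : R => v + s) by exact: measurable_funD.
    exact: (measurableT_comp mF ms).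
  apply: (@le_trans _ _ (\int[L Nu t]_v ((expR (th / 8))%:E * F (v + s)%R))%E).
    apply: ge0_le_integral => //.
    - by move=> v _; case: ifP.
    - exact: measurable_funeM.
    move=> v _; rewrite /F.
    have -> : (T + (eta + th) / xi t <= gB z + (v + s)) = (T + eta / xi t <= gA z + v).
      by rewrite /s mulrDl; apply/idP/idP; lra.
    by case: ifP => _; rewrite ?mule0.
  rewrite ge0_integralZl //.
  apply: (@le_trans _ _ ((expR (th / 8))%:E * ((expR (`|s| / (4 / xi t)))%:E * \int[L Nu t]_v F v))%E).
    rewrite lee_wpmul2l //; apply: ge0_integral_prob_shift => //.
      by rewrite divr_gt0.
    by move=> B mB; exact: lawL.
  rewrite muleA -EFinM -expRD; apply: lee_wpmul2r; first exact: integral_ge0.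
  rewrite lee_fin ler_expR ger0_norm // invf_div mulrA.
  have : s * xi t <= 2 * th.
    by rewrite -[leRHS](divfK (lt0r_neq0 x0)) ler_pM2r // -mulrA.
  by lra.
- rewrite -ge0_integralZl //; last by move=> v _; case: ifP.
  apply: ge0_le_integral => //.
  + by move=> v _; case: ifP.
  + by apply: measurable_funeM; exact: (mc gB (eta + th) 0%E BB).
  move=> v _; have s0 : 0 <= th / xi t + (gA z - gB z).
    by have := ler_norm (gB z - gA z); rewrite distrC; lra.
  case: ifPn => [_|cA].
    by case: ifP => _; rewrite ?mule0 // mule_ge0.
  rewrite ifN //; rewrite -!ltNge in cA *; rewrite mulrDl; lra.
Qed.

Definition instance_start (g : Z -> R) j chi z : \bar R :=
  (\int[L Eta (tm z)]_e instance_value g j chi z e)%E.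

(** The threshold noise has scale 2, so moving it by [theta z] costs [theta z / 2]; with the 5/8 of
    [instance_value_shift] this makes 9/8. *)
Lemma instance_start_dp (gA gB : Z -> R) chi j z :
  measurable_fun setT gA -> measurable_fun setT gB ->
  (forall z, live z -> `|gA z - gB z| <= 1 / (tm z)%:R) ->
  (forall i z, 0 <= chi i z)%E -> (forall i, measurable_fun setT (chi i)) ->
  (instance_start gA j chi z <=
   (expR (9 / 8 * theta z))%:E * instance_start gB j chi z)%E.
Proof.
move=> mgA mgB gAB chi0 mchi; rewrite /instance_start.
have th0 := theta_gt0 z.
have mi g (mg : measurable_fun setT g) : measurable_fun setT (fun e => instance_value g j chi z e).
  exact: (measurable_fun_pair2 (f := fun p : Z * R => instance_value g j chi p.1 p.2) z
    (measurable_instance_value mg j chi0 mchi)).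
have mis : measurable_fun setT (fun e : R => instance_value gB j chi z (e + theta z)).
  have ms : measurable_fun setT (fun e : R => e + theta z) by exact: measurable_funD.
  exact: (measurableT_comp (mi _ mgB) ms).
apply: (@le_trans _ _ (\int[L Eta (tm z)]_e
    ((expR (5 / 8 * theta z))%:E * instance_value gB j chi z (e + theta z)%R))%E).
  apply: ge0_le_integral => //.
  - by move=> e _; exact: instance_value_ge0.
  - exact: mi.
  - exact: measurable_funeM.
  by move=> e _; apply: instance_value_shift => //; exact: ltW.
rewrite ge0_integralZl //; last first.
  by move=> e _; exact: instance_value_ge0.
apply: (@le_trans _ _ ((expR (5 / 8 * theta z))%:E *
   ((expR (`|theta z| / 2))%:E * \int[L Eta (tm z)]_e instance_value gB j chi z e))%E).
  rewrite lee_wpmul2l //.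
  apply: (@ge0_integral_prob_shift _ _ _ _ (fun e => instance_value gB j chi z e)) => //.
  - by move=> B mB; exact: lawL.
  - exact: mi.
  - by move=> e; exact: instance_value_ge0.
rewrite muleA -EFinM -expRD; apply: lee_wpmul2r.
  by apply: integral_ge0 => e _; exact: instance_value_ge0.
rewrite lee_fin ler_expR gtr0_norm //; lra.
Qed.

Section StartOperator.
Variable (g : Z -> R).
Hypothesis mg : measurable_fun setT g.
Implicit Type chi : nat -> Z -> \bar R.

Lemma measurable_instance_eta chi j z :
  (forall i z, 0 <= chi i z)%E -> (forall i, measurable_fun setT (chi i)) ->
  measurable_fun setT (fun e => instance_value g j chi z e).
Proof.
move=> chi0 mchi.
exact: (measurable_fun_pair2 (f := fun p : Z * R => instance_value g j chi p.1 p.2) z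
    (measurable_instance_value mg j chi0 mchi)).
Qed.

Lemma instance_start_linear (c1 c2 : R) chi1 chi2 j z : 0 <= c1 -> 0 <= c2 ->
  (forall i z, 0 <= chi1 i z)%E -> (forall i, measurable_fun setT (chi1 i)) ->
  (forall i z, 0 <= chi2 i z)%E -> (forall i, measurable_fun setT (chi2 i)) ->
  (instance_start g j (fun i z => c1%:E * chi1 i z + c2%:E * chi2 i z) z =
   c1%:E * instance_start g j chi1 z + c2%:E * instance_start g j chi2 z)%E.
Proof.
move=> c10 c20 chi10 mchi1 chi20 mchi2; rewrite /instance_start.
have m1 := measurable_instance_eta j z chi10 mchi1.
have m2 := measurable_instance_eta j z chi20 mchi2.
have h1 e : (0 <= instance_value g j chi1 z e)%E by exact: instance_value_ge0.
have h2 e : (0 <= instance_value g j chi2 z e)%E by exact: instance_value_ge0.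
rewrite -!ge0_integralZl // -ge0_integralD //.
- by apply: eq_integral => e _; rewrite instance_value_linear.
- by move=> x _; rewrite mule_ge0.
- exact: measurable_funeM.
- by move=> x _; rewrite mule_ge0.
- exact: measurable_funeM.
Qed.

Lemma instance_start_cst (c : \bar R) j z : instance_start g j (fun _ _ => c) z = c.
Proof.
rewrite /instance_start -[RHS](integral_prob_cst (L Eta (tm z))).
by apply: eq_integral => e _; rewrite instance_value_cst.
Qed.

Lemma instance_start_ge0 chi j z :
  (forall i z, 0 <= chi i z)%E -> (0 <= instance_start g j chi z)%E.
Proof. by move=> chi0; apply: integral_ge0 => e _; exact: instance_value_ge0. Qed.

Lemma le_instance_start (good stop : Z -> Prop) chi1 chi2 j z :
  (forall i z, 0 <= chi1 i z)%E -> (forall i, measurable_fun setT (chi1 i)) ->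
  (forall i z, 0 <= chi2 i z)%E -> (forall i, measurable_fun setT (chi2 i)) ->
  (forall z, live z -> good z -> good (nb z)) ->
  (forall z a, live z -> good z -> stop (nh z a)) ->
  (forall z, chi1 0%N z <= chi2 0%N z)%E ->
  (forall i z, (i < j)%N -> stop z -> chi1 i z <= chi2 i z)%E ->
  good z -> (instance_start g j chi1 z <= instance_start g j chi2 z)%E.
Proof.
move=> chi10 mchi1 chi20 mchi2 gnb gnh chi00 chij gz.
apply: ge0_le_integral => //.
- by move=> e _; exact: instance_value_ge0.
- exact: measurable_instance_eta.
- exact: measurable_instance_eta.
by move=> e _; exact: (@le_instance_value g good stop).
Qed.

Lemma instance_start_fin chi (c : R) j z :
  (forall i z, 0 <= chi i z)%E -> (forall i, measurable_fun setT (chi i)) ->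
  (forall i z, (i <= j)%N -> (chi i z <= c%:E)%E) ->
  {r : R | instance_start g j chi z = r%:E & 0 <= r <= c}.
Proof.
move=> chi0 mchi chic.
have h0 := instance_start_ge0 j z chi0.
have h1 : (instance_start g j chi z <= c%:E)%E.
  rewrite -(instance_start_cst c%:E j z).
  apply: (@le_instance_start (fun=> True) (fun=> True)) => //.
  - by move=> i z'; apply: le_trans (chic 0%N z' _).
  - by move=> z'; exact: chic.
  - by move=> i z' ij _; apply: chic; rewrite ltnW.
have hf : instance_start g j chi z \is a fin_num.
  by rewrite ge0_fin_numE //; apply: le_lt_trans h1 _; rewrite ltry.
exists (fine (instance_start g j chi z)); first by rewrite fineK.
by rewrite -!lee_fin fineK // h0.
Qed.

Variable S : set Z.
Hypothesis mS : measurable S.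
Let phi z : \bar R := (\1_S z)%:E.
Let V i z := machine_value g phi i (z, (false, 0)).

Let mphi : measurable_fun setT phi.
Proof. by apply: measurableT_comp => //; exact: measurable_indic. Qed.

Let phi0 z : (0 <= phi z)%E. Proof. by rewrite lee_fin. Qed.

Lemma machine_value_fresh_ge0 i z : (0 <= V i z)%E.
Proof. exact: machine_value_ge0. Qed.

Lemma measurable_machine_value_fresh i : measurable_fun setT (V i).
Proof.
apply: (measurable_fun_pair1 (f := machine_value g phi i) (false, 0)).
exact: measurable_machine_value.
Qed.

Lemma machine_value_fresh_fin i z : {r : R | V i z = r%:E & 0 <= r <= 1}.
Proof.
suff h1 : (V i z <= 1%E)%E.
  have h0 := machine_value_fresh_ge0 i z.
  have hf : V i z \is a fin_num.
    by rewrite ge0_fin_numE //; apply: le_lt_trans h1 _; rewrite ltry.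
  exists (fine (V i z)); first by rewrite fineK.
  by rewrite -!lee_fin fineK // h0.
elim/ltn_ind: i z => i IH z.
have p1 z' : (phi z' <= 1)%E by rewrite lee_fin /indic; case: (_ \in _).
have [lz|lz] := boolP (live z); last by rewrite /V machine_value_dead.
case: i => [|i] in IH *; first exact: p1.
rewrite /V machine_value_fresh // -(instance_start_cst 1%E i.+1 z).
apply: (@le_instance_start (fun=> True) (fun=> True)) => //.
- exact: machine_value_fresh_ge0.
- exact: measurable_machine_value_fresh.
- by move=> k z' ki _; exact: IH.
Qed.

End StartOperator.

(* The worst case of a likelihood ratio in [[1/E, E]] is attained at the
   endpoints; here [x] plays the role of the value to be transported, and [m]
   is the Lagrange multiplier of the constraint that the ratio has mean 1. *)
Lemma bang_bang (x y m e E E' K P Q : R) : 0 <= m -> 1 + e <= E -> 1 - e <= E' ->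
  m * e = K * ((P - Q) / 2) -> E * x <= y + P * K -> E' * x <= y + Q * K ->
  m + E * Num.max (x - m) 0 <= y + K * ((P + Q) / 2) + E' * Num.max (m - x) 0.
Proof.
move=> m0 eE eE' me h1 h2.
have : 0 <= m * (E - 1 - e) by rewrite mulr_ge0 //; lra.
have : 0 <= m * (E' - 1 + e) by rewrite mulr_ge0 //; lra.
have [xm|xm] := leP m x.
  by rewrite max_l ?subr_ge0 // max_r ?subr_le0 //; lra.
by rewrite max_r ?subr_le0 ?(ltW xm) // max_l ?subr_ge0 ?(ltW xm) //; lra.
Qed.

(** * Adaptive composition of the instances *)

Section Composition.
Variables (gA gB : Z -> R) (S : set Z) (U : Z -> R) (a : R).
Hypothesis mgA : measurable_fun setT gA.
Hypothesis mgB : measurable_fun setT gB.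
Hypothesis gAB : forall z, live z -> `|gA z - gB z| <= 1 / (tm z)%:R.
Hypothesis mS : measurable S.
Hypothesis U_ge0 : forall z, 0 <= U z.
Hypothesis U_nb : forall z, live z -> U (nb z) <= U z.
Hypothesis U_nh : forall z x, live z -> live (nh z x) ->
  U (nh z x) + (9 / 8 * theta (nh z x)) ^+ 2 <= U z.
Hypothesis a_ge1 : 1 <= a.

Let phi z : \bar R := (\1_S z)%:E.
Let V g i z := machine_value g phi i (z, (false, 0)).

(** [U z] pays for the instances that start after the one starting at [z]; that one is added here,
    unless the machine is dead or out of steps and it never starts. *)
Let budget i z := if (0 < i)%N && live z then U z + (9 / 8 * theta z) ^+ 2 else 0.

(* The first instance has a likelihood ratio in [[exp (- e), exp e]] with
   [e = 9 / 8 * theta z]; the induction hypotheses at [b - e] and [b + e] are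
   combined by [bang_bang], and [cosh (a * e)] is absorbed by the exponent. *)
Lemma machine_value_dp j z (b : R) :
  (V gA j z <= (expR b)%:E * V gB j z +
    (expR (- (a - 1) * b + 3 / 2 * a ^+ 2 * budget j z))%:E)%E.
Proof.
elim/ltn_ind: j z b => j IH z b.
have [|] := boolP ((0 < j)%N && live z); last first.
  move=> hj; rewrite /budget (negbTE hj) mulr0 addr0.
  have VE g : V g j z = phi z.
    case: j hj {IH} => [|j] //= hj.
    by rewrite /V machine_value_dead.
  rewrite !VE /phi -EFinM -EFinD lee_fin /indic.
  have [b0|b0] := leP 0 b.
    have := expR_ge1Dx b; have := expR_ge0 (- (a - 1) * b).
    by case: (z \in S) => /=; lra.
  have : 1 <= expR (- (a - 1) * b).
    rewrite -[leLHS]expR0 ler_expR mulNr -mulrN.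
    by apply: mulr_ge0; [rewrite subr_ge0|rewrite oppr_ge0 ltW].
  have := expR_ge0 b.
  by case: (z \in S) => /=; lra.
case: j IH => // j IH /= lz; rewrite /budget /= lz.
set e := 9 / 8 * theta z.
have e0 : 0 < e by rewrite mulr_gt0 // theta_gt0.
set K := expR (- (a - 1) * b + 3 / 2 * a ^+ 2 * U z).
have K0 : 0 < K by exact: expR_gt0.
set P := expR (a * e); set Q := expR (- (a * e)).
have a0 : 0 <= a by exact: le_trans a_ge1.
have ae0 : 0 <= a * e by rewrite mulr_ge0 // ltW.
have QP : Q <= P by rewrite ler_expR; lra.
(* The slope of the chord of [K * expR (a * s)] over [s] in [[- e, e]]. *)
set m := K * ((P - Q) / 2) / e.
have m0 : 0 <= m.
  by apply: divr_ge0; [apply: mulr_ge0; [exact: ltW|rewrite divr_ge0 // subr_ge0]|exact: ltW].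
have me : m * e = K * ((P - Q) / 2) by rewrite divfK // gt_eqF.
have mV g (mg : measurable_fun setT g) i := measurable_machine_value_fresh mg mS i.
have V0 g i z' : (0 <= V g i z')%E by exact: machine_value_fresh_ge0.
have vfin g (mg : measurable_fun setT g) i z' : {r : R | V g i z' = r%:E & 0 <= r <= 1}.
  exact: machine_value_fresh_fin.
pose r i z' := fine (V gA i z').
have rE i z' : V gA i z' = (r i z')%:E.
  by rewrite /r; have [x -> _] := vfin _ mgA i z'.
have r01 i z' : 0 <= r i z' <= 1.
  by rewrite /r; have [x -> h] := vfin _ mgA i z'.
have mr i : measurable_fun setT (r i).
  by apply: (measurableT_comp (fine_measurable measurableT)); exact: mV.
(* Splitting the value at [m] into nonnegative parts lets the privacy of one instance be used in
   both directions: from A to B above [m], from B to A below. *)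
pose p i z' : \bar R := (Num.max (r i z' - m) 0)%:E.
pose q i z' : \bar R := (Num.max (m - r i z') 0)%:E.
have p0 i z' : (0 <= p i z')%E by rewrite lee_fin le_max lexx orbT.
have q0 i z' : (0 <= q i z')%E by rewrite lee_fin le_max lexx orbT.
have mp i : measurable_fun setT (p i).
  by apply: measurableT_comp => //; apply: measurable_maxr => //; exact: measurable_funB.
have mq i : measurable_fun setT (q i).
  by apply: measurableT_comp => //; apply: measurable_maxr => //; exact: measurable_funB.
have [IA IAE _] := vfin _ mgA j.+1 z.
have [IB IBE _] := vfin _ mgB j.+1 z.
have p1 i z' : (i <= j.+1)%N -> (p i z' <= 1%:E)%E.
  by move=> _; rewrite lee_fin ge_max; have /andP[? ?] := r01 i z'; apply/andP; split; lra.
have qm i z' : (i <= j.+1)%N -> (q i z' <= m%:E)%E.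
  by move=> _; rewrite lee_fin ge_max; have /andP[? ?] := r01 i z'; apply/andP; split; lra.
have [IAp IApE _] := instance_start_fin mgA z p0 mp p1.
have [IBp IBpE _] := instance_start_fin mgB z p0 mp p1.
have [IAq IAqE _] := instance_start_fin mgA z q0 mq qm.
have [IBq IBqE _] := instance_start_fin mgB z q0 mq qm.
have VE g : V g j.+1 z = instance_start g j.+1 (V g) z by rewrite /V machine_value_fresh.
have mc (c : R) i : measurable_fun setT ((fun (_ : nat) (_ : Z) => c%:E) i) by exact: measurable_cst.
have eq1 : IA + IAq = m + IAp.
  have := @instance_start_linear gA mgA 1 1 (V gA) q j.+1 z ler01 ler01 (V0 gA) (mV _ mgA) q0 mq.
  rewrite -VE IAE IAqE -!EFinM -EFinD.
  have -> : (fun i z' => 1%:E * V gA i z' + 1%:E * q i z')%E =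
    (fun i z' => 1%:E * (fun _ _ => m%:E) i z' + 1%:E * p i z')%E.
    apply/funext => i; apply/funext => z'; rewrite !mul1e rE /p /q -!EFinD.
    congr EFin; have [h|h] := leP m (r i z').
      by rewrite max_r ?subr_le0 // max_l ?subr_ge0 //; ring.
    by rewrite max_l ?subr_ge0 ?(ltW h) // max_r ?subr_le0 ?(ltW h) //; ring.
  rewrite instance_start_linear // instance_start_cst IApE -!EFinM -EFinD.
  by case; rewrite !mul1r => ->.
set E := expR e; set E' := expR (- e).
have leAp : IAp <= E * IBp.
  by rewrite -lee_fin EFinM -IApE -IBpE; apply: instance_start_dp.
have leBq : IBq <= E * IAq.
  rewrite -lee_fin EFinM -IAqE -IBqE; apply: instance_start_dp => //.
  by move=> z' lz'; rewrite distrC; exact: gAB.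
have E'E : E' * E = 1 by rewrite -expRD addNr expR0.
have {}leBq : E' * IBq <= IAq.
  by rewrite -[leRHS]mul1r -E'E -mulrA ler_wpM2l // expR_ge0.
have leB : m + E * IBp <= expR b * IB + K * ((P + Q) / 2) + E' * IBq.
  have Kc0 : 0 <= K * ((P + Q) / 2) by rewrite mulr_ge0 ?divr_ge0 ?addr_ge0 // ?expR_ge0 // ltW.
  have mKB i : measurable_fun setT (fun z' => (expR b)%:E * V gB i z' + 1%:E * (K * ((P + Q) / 2))%:E)%E.
    by apply: emeasurable_funD => //; apply: measurable_funeM; exact: mV.
  have KB0 i z' : (0 <= (expR b)%:E * V gB i z' + 1%:E * (K * ((P + Q) / 2))%:E)%E.
    by rewrite adde_ge0 ?mule_ge0.
  have E0 : 0 <= E by exact: expR_ge0.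
  have E'0 : 0 <= E' by exact: expR_ge0.
  rewrite -lee_fin; pose chi1 i z' := (1%:E * (fun (_ : nat) (_ : Z) => m%:E) i z' + E%:E * p i z')%E.
  pose chi2 i z' := (1%:E * (fun i z' => (expR b)%:E * V gB i z' +
    1%:E * (K * ((P + Q) / 2))%:E) i z' + E'%:E * q i z')%E.
  have -> : (m + E * IBp)%:E = instance_start gB j.+1 chi1 z.
    by rewrite /chi1 instance_start_linear // instance_start_cst IBpE mul1e.
  have -> : (expR b * IB + K * ((P + Q) / 2) + E' * IBq)%:E = instance_start gB j.+1 chi2 z.
    rewrite /chi2 instance_start_linear // IBqE.
    have := @instance_start_linear gB mgB (expR b) 1 (V gB) (fun _ _ => (K * ((P + Q) / 2))%:E)
      j.+1 z (expR_ge0 b) ler01 (V0 gB) (mV _ mgB).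
    move=> -> //.
    by rewrite -VE IBE instance_start_cst !mul1e -!EFinM -!EFinD.
  have key i z' : (i <= j)%N -> budget i z' <= U z -> (chi1 i z' <= chi2 i z')%E.
    move=> ij bU; rewrite /chi1 /chi2 !mul1e.
    have [rB rBE rB01] := vfin _ mgB i z'.
    rewrite [V gB i z']rBE /p /q -!EFinM -!EFinD lee_fin.
    (* The induction hypothesis at [b - s], multiplied by [expR s]; the exponents [(a - 1) * s] and
       [s] add up to [a * s]. *)
    have up s : expR s * r i z' <= expR b * rB + expR (a * s) * K.
      have := IH i ij z' (b - s); rewrite rE [V gB i z']rBE -!EFinM -!EFinD lee_fin => h.
      apply: (@le_trans _ _ (expR s * (expR (b - s) * rB +
         expR (- (a - 1) * (b - s) + 3 / 2 * a ^+ 2 * budget i z')))).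
        by rewrite ler_wpM2l // expR_ge0.
      rewrite mulrDr mulrA -expRD subrKC lerD2l -!expRD ler_expR.
      have : 3 / 2 * a ^+ 2 * budget i z' <= 3 / 2 * a ^+ 2 * U z.
        by rewrite ler_wpM2l // mulr_ge0 // exprn_ge0 //; lra.
      lra.
    apply: (@bang_bang _ _ _ e) => //; try exact: expR_ge1Dx.
    - exact: up.
    - by have := up (- e); rewrite mulrN.
  apply: (@le_instance_start gB mgB (fun z' => U z' <= U z)
    (fun z' => live z' -> U z' + (9 / 8 * theta z') ^+ 2 <= U z)) => //.
  - by move=> i z'; apply: adde_ge0; apply: mule_ge0 => //.
  - by move=> i; apply: emeasurable_funD => //; apply: measurable_funeM.
  - by move=> i z'; apply: adde_ge0; apply: mule_ge0 => //; exact: KB0.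
  - by move=> i; apply: emeasurable_funD => //; apply: measurable_funeM.
  - by move=> z' lz'; apply: le_trans; exact: U_nb.
  - by move=> z' x lz' Uz' lnh; apply: le_trans Uz'; exact: U_nh.
  - by move=> z'; apply: key.
  - move=> i z' ij stop; apply: key => //; rewrite /budget.
    by case: ifP => // /andP[_ /stop].
have PQ : K * ((P + Q) / 2) <= expR (- (a - 1) * b + 3 / 2 * a ^+ 2 * (U z + e ^+ 2)).
  rewrite mulrDr addrA expRD; apply: ler_wpM2l; first exact: expR_ge0.
  by apply: le_trans (half_expRDexpRN_le (a * e)) _; rewrite exprMn ler_expR mulrA.
rewrite IAE IBE -EFinM -EFinD lee_fin; lra.
Qed.

End Composition.
End Privacy.
End Machine.

(** * Law of a process driven by independent draws *)

Section Independence.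
Context {R : realType} {d : measure_display} {Omega : measurableType d}.
Variables (P : probability Omega R) (I : eqType) (W : I -> {RV P >-> R}).

Definition box (s : seq I) (B : I -> set R) : set Omega :=
  \bigcap_(i in [set` s]) W i @^-1` B i.

Definition indep_of d' (T : measurableType d') (Y : Omega -> T) (J : pred I) :=
  forall (s : seq I) (B : I -> set R), uniq s -> all J s ->
    (forall i, measurable (B i)) -> forall A, measurable A ->
    P (Y @^-1` A `&` box s B) = (P (Y @^-1` A) * P (box s B))%E.

Lemma measurable_box s B : (forall i, measurable (B i)) -> measurable (box s B).
Proof.
move=> mB; rewrite /box; apply: fin_bigcap_measurable; first exact: finite_seq.
by move=> i _; exact: measurable_funPTI.
Qed.

Lemma box_cons i s B : box (i :: s) B = W i @^-1` B i `&` box s B.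
Proof.
rewrite /box; apply/seteqP; split => [w h|w [h1 h2] k /=].
  split; first by apply: h; rewrite /= in_cons eqxx.
  by move=> k /= ks; apply: h; rewrite /= in_cons ks orbT.
by rewrite in_cons => /predU1P[->//|]; exact: h2.
Qed.

Lemma box_nil B : box [::] B = setT.
Proof. by apply/seteqP; split. Qed.

Lemma box_eq s B B' : {in s, B =1 B'} -> box s B = box s B'.
Proof.
move=> h; rewrite /box; apply: eq_bigcapr => i /= si.
by rewrite h.
Qed.

Context {d' : measure_display} {T : measurableType d'}.

Lemma rectangle_measure_unique d2 (T2 : measurableType d2)
    (m1 m2 : {measure set (T * T2) -> \bar R}) :
  (m1 setT < +oo)%E ->
  (forall A B, measurable A -> measurable B -> m1 (A `*` B) = m2 (A `*` B)) ->
  forall C, measurable C -> m1 C = m2 C.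
Proof.
move=> m1oo h C mC.
pose G : set (set (T * T2)) :=
  [set C | exists A, measurable A /\ exists B, measurable B /\ C = A `*` B].
apply: (measure_unique G (fun=> setT)) => //.
- rewrite measurable_prod_measurableType //; congr (<<s _ >>).
  rewrite predeqE; split => [[A mA [B mB <-]]|[A [mA [B [mB ->]]]]].
    by exists A; split => //; exists B.
  by exists A => //; exists B.
- move=> _ _ [X1 [mX1 [X2 [mX2 ->]]]] [Y1 [mY1 [Y2 [mY2 ->]]]].
  rewrite -setXI; exists (X1 `&` Y1); split; first exact: measurableI.
  by exists (X2 `&` Y2); split => //; exact: measurableI.
- by move=> _; exists setT; split => //; exists setT; rewrite setXTT.
- by rewrite bigcup_const //; exists 0%N.
by move=> _ [A [mA [B [mB ->]]]]; exact: h.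
Qed.

Variables (Y : Omega -> T) (J : pred I) (j : I).
Hypothesis mY : measurable_fun setT Y.
Hypothesis iY : indep_of Y J.
Hypothesis Jj : J j.

Let YW w := (Y w, W j w).

Let mYW : measurable_fun setT YW.
Proof. exact: measurable_fun_pair. Qed.

Let h : {mfun Omega >-> (T * R)%type} :=
  HB.pack YW (isMeasurableFun.Build _ _ _ _ _ mYW).

Hypothesis indepW : mutually_independent P W.

Lemma indep_of_rectangle s B A C : uniq s ->
  all (fun i => J i && (i != j)) s ->
  (forall i, measurable (B i)) -> measurable A -> measurable C ->
  P (YW @^-1` (A `*` C) `&` box s B) = (P (Y @^-1` A) * P (W j @^-1` C) * P (box s B))%E.
Proof.
move=> us /allP Js mB mA mC.
pose B' i := if i == j then C else B i.
have mB' i : measurable (B' i) by rewrite /B'; case: ifP.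
have js : j \notin s by apply/negP => /Js; rewrite eqxx andbF.
have boxE : box s B' = box s B.
  by apply: box_eq => i si; rewrite /B' ifN //; apply: contraNneq js => <-.
have Bj : B' j = C by rewrite /B' eqxx.
have -> : YW @^-1` (A `*` C) `&` box s B = Y @^-1` A `&` box (j :: s) B'.
  by rewrite box_cons boxE Bj setIA; congr (_ `&` _).
have Jjs : all J (j :: s) by rewrite /= Jj; apply/allP => i /Js /andP[].
rewrite iY //=; last by rewrite js.
rewrite -muleA; congr (_ * _)%E.
have mi s' : uniq s' -> P (box s' B') = (\prod_(i <- s') P (W i @^-1` B' i))%E.
  by move=> us'; exact: indepW.
by rewrite -boxE !mi //= ?js // big_cons Bj.
Qed.

(** Consumes the draw [j]: paired with [Y], it leaves the set of free draws. Rectangles come from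
    boxes enlarged by [j], general sets from uniqueness of measures. *)
Lemma indep_of_pair : indep_of YW (fun i => J i && (i != j)).
Proof.
move=> s B us Js mB C mC; have mE := measurable_box s mB.
pose m1 := pushforward (mrestr P mE) h.
have PE0 : 0 <= fine (P (box s B)) by rewrite fine_ge0 // measure_ge0.
pose m2 := mscale (NngNum PE0) (distribution P h).
have : m1 C = m2 C.
  apply: rectangle_measure_unique => //.
    rewrite /m1 /= /pushforward /mrestr /= preimage_setT setTI.
    by apply: le_lt_trans (probability_le1 P mE) _; rewrite ltry.
  move=> A B' mA mB'; rewrite /m1 /m2 /= /pushforward /mscale/= /mrestr.
  rewrite [LHS](@indep_of_rectangle s B A B') // fineK ?fin_num_measure // muleC; congr (_ * _)%E.
  have := @indep_of_rectangle [::] B A B' erefl erefl mB mA mB'.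
  by rewrite box_nil setIT probability_setT mule1.
rewrite /m1 /m2 /= /pushforward /mscale/= /mrestr => -> .
by rewrite fineK ?fin_num_measure // muleC.
Qed.

(** A draw independent of [Y] is integrated out against its own law, since the pair has a product
    law. *)
Lemma indep_of_integral (m : probability R R) (f : T -> R -> \bar R) :
  (forall B, measurable B -> distribution P (W j) B = m B) ->
  (forall x y, 0 <= f x y)%E -> measurable_fun setT (fun p : T * R => f p.1 p.2) ->
  (\int[P]_w f (Y w) (W j w) = \int[P]_w \int[m]_y f (Y w) y)%E.
Proof.
move=> mE f0 mf.
pose hY : {mfun Omega >-> T} := HB.pack Y (isMeasurableFun.Build _ _ _ _ _ mY).
pose lY := distribution P hY.
have -> : (\int[P]_w f (Y w) (W j w) = \int[distribution P h]_p f p.1 p.2)%E.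
  by rewrite ge0_integral_distribution.
have -> : (\int[distribution P h]_p f p.1 p.2 = \int[lY \x m]_p f p.1 p.2)%E.
  apply: eq_measure_integral => C mC _; apply/esym.
  apply: (@product_measure_unique _ _ _ _ _ lY m (distribution P h)) => //.
  move=> A B mA mB.
  have := @indep_of_rectangle [::] (fun=> setT) A B erefl erefl (fun=> measurableT) mA mB.
  rewrite box_nil setIT probability_setT mule1 => e.
  by apply: (eq_trans e); congr (_ * _)%E; exact: mE.
rewrite fubini_tonelli1 // /fubini_F.
rewrite ge0_integral_distribution //.
- by apply: (@measurable_fun_fubini_tonelli_F _ _ _ _ _ m _ mf) => -[].
- by move=> x; exact: integral_ge0.
Qed.

End Independence.

Section ProcessLaw.
Context {R : realType} {d : measure_display} {Omega : measurableType d}.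
Variables (P : probability Omega R) (W : noise_kind -> nat -> nat -> {RV P >-> R}).
Hypothesis indepW : mutually_independent P
  (fun i : noise_kind * nat * nat => W i.1.1 i.1.2 i.2 : Omega -> R).
Context {d' : measure_display} {ST : measurableType d'}.
Variables (tau : ST -> nat) (step : ST -> R -> R -> R -> ST) (s0 : ST).
Hypothesis mtau : measurable_fun setT tau.
Hypothesis mstep : measurable_fun setT
  (fun p : ST * R * R * R => step p.1.1.1 p.1.1.2 p.1.2 p.2).

Fixpoint process (m : nat) (w : Omega) : ST :=
  if m is m'.+1 then
    let s := process m' w in let t := tau s in
    step s (W Eta t m' w) (W Nu t m' w) (W Ans t m' w)
  else s0.

Lemma measurable_process m : measurable_fun setT (process m).
Proof.
elim: m => [|m IH] /=; first exact: measurable_cst.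
apply: (measurable_fun_nat_cases (tau := fun w => tau (process m w))
  (F := fun t w => step (process m w) (W Eta t m w) (W Nu t m w) (W Ans t m w))).
  exact: (measurableT_comp mtau).
move=> t; apply: (measurableT_comp mstep
  (g := fun w => (process m w, W Eta t m w, W Nu t m w, W Ans t m w))).
by do 3 (apply: measurable_fun_pair => //).
Qed.

Let Wi (i : noise_kind * nat * nat) := W i.1.1 i.1.2 i.2.

Let quad m t w := (process m w, W Eta t m w, W Nu t m w, W Ans t m w).

(** The draws are attached to the process one at a time; each stage is recorded because the draws
    will also be integrated out one at a time. *)
Lemma indep_quad m t (J : pred (noise_kind * nat * nat)) :
  indep_of Wi (process m) (fun i => (m <= i.2)%N) ->
  indep_of Wi (fun w => (process m w, W Eta t m w))
    (fun i => (m <= i.2)%N && (i != (Eta, t, m))) /\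
  indep_of Wi (fun w => (process m w, W Eta t m w, W Nu t m w))
    (fun i => (m <= i.2)%N && (i != (Eta, t, m)) && (i != (Nu, t, m))) /\
  indep_of Wi (quad m t)
    (fun i => (m <= i.2)%N && (i != (Eta, t, m)) && (i != (Nu, t, m)) && (i != (Ans, t, m))).
Proof.
move=> im; have mp := measurable_process m.
have i1 := @indep_of_pair _ _ _ P _ Wi _ _ _ _ (Eta, t, m) mp im (leqnn _) indepW.
have mp1 : measurable_fun setT (fun w => (process m w, W Eta t m w)) by exact: measurable_fun_pair.
have i2 := @indep_of_pair _ _ _ P _ Wi _ _ _ _ (Nu, t, m) mp1 i1 _ indepW.
have mp2 : measurable_fun setT (fun w => (process m w, W Eta t m w, W Nu t m w)) by exact: measurable_fun_pair.
have NE : (Nu, t, m) != (Eta, t, m) by apply/eqP.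
have AE : (Ans, t, m) != (Eta, t, m) by apply/eqP.
have AN : (Ans, t, m) != (Nu, t, m) by apply/eqP.
split => //; split; first by apply: i2; rewrite /= leqnn NE.
apply: (@indep_of_pair _ _ _ P _ Wi _ _ _ _ (Ans, t, m) mp2 _ _ indepW).
  by apply: i2; rewrite /= leqnn NE.
by rewrite /= leqnn AE AN.
Qed.

(** The draws of step [m] are indexed by the random size of the current state, so the event is cut
    into pieces on which the size is a fixed [t]. On each piece the consumed draws have serial
    number [m], and those with larger ones remain free. *)
Lemma indep_process m : indep_of Wi (process m) (fun i => (m <= i.2)%N).
Proof.
elim: m => [|m IH].
  move=> s B us Js mB A mA /=; rewrite preimage_cst.
  case: ifPn => _; last by rewrite set0I measure0 mul0e.
  by rewrite setTI probability_setT mul1e.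
move=> s B us Js mB A mA.
have mp := measurable_process m.
pose D t := (tau \o process m) @^-1` [set t].
have mD t : measurable (D t).
  rewrite -[X in measurable X]setTI.
  by apply: (measurableT_comp mtau mp).
pose C t : set (ST * R * R * R) :=
  [set p | tau p.1.1.1 = t] `&` (fun p => step p.1.1.1 p.1.1.2 p.1.2 p.2) @^-1` A.
have mC t : measurable (C t).
  apply: measurableI; rewrite -[X in measurable X]setTI; last exact: mstep.
  have : measurable_fun setT (fun p : ST * R * R * R => tau p.1.1.1).
    by apply: (measurableT_comp mtau); do 2 apply: measurableT_comp => //.
  by move=> /(_ measurableT [set t]); apply.
have mq t : measurable_fun setT (quad m t) by do 3 (apply: measurable_fun_pair => //).
have mqC t : measurable (quad m t @^-1` C t).
  by rewrite -[X in measurable X]setTI; exact: mq.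
have cover (E : set Omega) : process m.+1 @^-1` A `&` E = \bigcup_t (quad m t @^-1` C t `&` E).
  apply/seteqP; split => [w [Aw Ew]|w [t _ [[/= <- ?] ?]]] //.
  by exists (tau (process m w)).
have triv (E : set Omega) : trivIset setT (fun t => quad m t @^-1` C t `&` E).
  by move=> i j _ _ [w [[[/= <- _] _] [[/= <- _] _]]].
have mbox := measurable_box Wi s mB.
have coverT : process m.+1 @^-1` A = \bigcup_t quad m t @^-1` C t.
  by rewrite -[LHS]setIT cover; apply: eq_bigcupr => t _; rewrite setIT.
have trivT : trivIset setT (fun t => quad m t @^-1` C t).
  by have := triv setT; under eq_fun do rewrite setIT.
rewrite [X in P X = _]cover coverT !measure_bigcup //; last by move=> t _; exact: measurableI.
rewrite muleC -(fineK (fin_num_measure P _ mbox)) -nneseriesZl //; apply: eq_eseriesr => t _.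
rewrite fineK ?fin_num_measure // muleC.
have [_ [_ iq]] := @indep_quad m t predT IH.
apply: iq => //; apply/allP => i /(allP Js) mi.
rewrite (ltnW mi) /=; apply/andP; split; first (apply/andP; split).
all: by apply: contraTneq mi => ->; rewrite /= ltnn.
Qed.

Variables (n : nat) (L : noise_kind -> nat -> probability R R).
Hypothesis lawW : forall c t m, (n <= t)%N -> forall B, measurable B ->
  distribution P (W c t m) B = L c t B.
Hypothesis tau_ge : forall s, (n <= tau s)%N.

(** One step averages over draws from the fixed laws [L]; iterated, this identifies probabilities of
    the process with [machine_value]. *)
Lemma process_integral m (f : ST -> \bar R) :
  (forall s, 0 <= f s)%E -> measurable_fun setT f ->
  (\int[P]_w f (process m.+1 w) = \int[P]_w
    \int[L Eta (tau (process m w))]_e \int[L Nu (tau (process m w))]_v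
      \int[L Ans (tau (process m w))]_a f (step (process m w) e v a))%E.
Proof.
move=> f0 mf; have mp := measurable_process m.
have mpS := measurable_process m.+1.
(* [F t] vanishes unless the size is [t], so on it the draws have a fixed index. *)
pose F t s e v a : \bar R := if tau s == t then f (step s e v a) else 0%E.
have F0 t s e v a : (0 <= F t s e v a)%E by rewrite /F; case: ifP.
have mF t : measurable_fun setT (fun p : ST * R * R * R => F t p.1.1.1 p.1.1.2 p.1.2 p.2).
  apply: measurable_fun_ifT => //; last exact: (measurableT_comp mf mstep).
  apply: (measurableT_comp (measurable_nat_fun (fun k => k == t))).
  by apply: (measurableT_comp mtau); do 2 apply: measurableT_comp => //.
have mF2 t : measurable_fun setT (fun p : ST * R * R => \int[L Ans t]_a F t p.1.1 p.1.2 p.2 a)%E.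
  by apply: (@measurable_fun_fubini_tonelli_F _ _ _ _ _ (L Ans t) _ (mF t)) => -[].
have mF1 t : measurable_fun setT (fun p : ST * R => \int[L Nu t]_v \int[L Ans t]_a F t p.1 p.2 v a)%E.
  apply: (@measurable_fun_fubini_tonelli_F _ _ _ _ _ (L Nu t) _ (mF2 t)) => -[].
  by move=> *; exact: integral_ge0.
pose D t := (tau \o process m) @^-1` [set t].
have mD t : measurable (D t).
  by rewrite -[X in measurable X]setTI; apply: (measurableT_comp mtau mp).
have DT : setT = \bigcup_t D t by apply/seteqP; split => // w _; exists (tau (process m w)).
have tD : trivIset setT D by move=> i j _ _ [w [/= <- <-]].
have mk : measurable_fun setT (fun s => \int[L Eta (tau s)]_e \int[L Nu (tau s)]_v
      \int[L Ans (tau s)]_a f (step s e v a))%E.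
  apply: (measurable_fun_nat_cases mtau (F := fun t s => \int[L Eta t]_e \int[L Nu t]_v
      \int[L Ans t]_a f (step s e v a))%E) => t.
  have m2 : measurable_fun setT (fun p : ST * R * R => \int[L Ans t]_a f (step p.1.1 p.1.2 p.2 a))%E.
    by apply: (@measurable_fun_fubini_tonelli_F _ _ _ _ _ (L Ans t) _ (measurableT_comp mf mstep)) => -[] /=.
  have m1 : measurable_fun setT (fun p : ST * R => \int[L Nu t]_v \int[L Ans t]_a f (step p.1 p.2 v a))%E.
    apply: (@measurable_fun_fubini_tonelli_F _ _ _ _ _ (L Nu t) _ m2) => -[] /=.
    by move=> *; exact: integral_ge0.
  apply: (@measurable_fun_fubini_tonelli_F _ _ _ _ _ (L Eta t) _ m1) => -[] /=.
  by move=> *; do 2 (apply: integral_ge0 => ? _).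
have mL : measurable_fun setT (fun w => f (process m.+1 w)) by exact: (measurableT_comp mf mpS).
have mR := measurableT_comp mk mp.
rewrite DT [LHS]ge0_integral_bigcup //; last exact: measurable_funTS.
rewrite [RHS]ge0_integral_bigcup //; last 2 first.
- exact: (measurable_funTS mR).
- by move=> w _; do 3 (apply: integral_ge0 => ? _).
apply: eq_eseriesr => t _.
have [lt|nt] := leqP n t; last first.
  have -> : D t = set0.
    by apply/seteqP; split => // w h; have := tau_ge (process m w); rewrite (h : tau (process m w) = t) leqNgt nt.
  by rewrite !integral_set0.
have DE w : (w \in D t) = (tau (process m w) == t).
  by apply/idP/eqP => [|h]; rewrite inE.
have [i1 [i2 _]] := @indep_quad m t predT (@indep_process m).
have mp1 : measurable_fun setT (fun w => (process m w, W Eta t m w)) by exact: measurable_fun_pair.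
have mp2 : measurable_fun setT (fun w => (process m w, W Eta t m w, W Nu t m w)) by exact: measurable_fun_pair.
transitivity (\int[P]_w F t (process m w) (W Eta t m w) (W Nu t m w) (W Ans t m w))%E.
  rewrite integral_mkcond; apply: eq_integral => w _.
  by rewrite patchE DE /F; case: eqP => //= <-.
have Jm (c : noise_kind) : (m <= (c, t, m).2)%N by [].
have NE : (Nu, t, m) != (Eta, t, m) by apply/eqP.
have AE : (Ans, t, m) != (Eta, t, m) by apply/eqP.
have AN : (Ans, t, m) != (Nu, t, m) by apply/eqP.
have jN : (m <= (Nu, t, m).2)%N && ((Nu, t, m) != (Eta, t, m)) by rewrite Jm NE.
have jA : (m <= (Ans, t, m).2)%N && ((Ans, t, m) != (Eta, t, m)) && ((Ans, t, m) != (Nu, t, m)).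
  by rewrite Jm AE AN.
transitivity (\int[P]_w \int[L Ans t]_a F t (process m w) (W Eta t m w) (W Nu t m w) a)%E.
  exact: (@indep_of_integral _ _ _ P _ Wi _ _ _ _ (Ans, t, m) mp2 i2 jA indepW (L Ans t)
    (fun p a => F t p.1.1 p.1.2 p.2 a) (lawW Ans m lt) (fun p a => F0 t p.1.1 p.1.2 p.2 a) (mF t)).
transitivity (\int[P]_w \int[L Nu t]_v \int[L Ans t]_a F t (process m w) (W Eta t m w) v a)%E.
  apply: (@indep_of_integral _ _ _ P _ Wi _ _ _ _ (Nu, t, m) mp1 i1 jN indepW (L Nu t)
    (fun p v => \int[L Ans t]_a F t p.1 p.2 v a)%E (lawW Nu m lt) _ (mF2 t)).
  by move=> *; exact: integral_ge0.
transitivity (\int[P]_w \int[L Eta t]_e \int[L Nu t]_v \int[L Ans t]_a F t (process m w) e v a)%E.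
  have h0 p e : (0 <= \int[L Nu t]_v \int[L Ans t]_a F t p e v a)%E.
    by do 2 (apply: integral_ge0 => ? _).
  have := @indep_of_integral _ _ _ P _ Wi _ _ _ _ (Eta, t, m) mp (@indep_process m) (Jm Eta)
    indepW (L Eta t) (fun p e => \int[L Nu t]_v \int[L Ans t]_a F t p e v a)%E
    (lawW Eta m lt) h0 (mF1 t).
  exact.
rewrite [RHS]integral_mkcond; apply: eq_integral => w _.
rewrite patchE DE; case: eqP => [h|h] /=.
  by rewrite h; do 3 (apply: eq_integral => ? _); rewrite /F h eqxx.
by rewrite /F; do 3 (apply: integral0_eq => ? _); case: eqP h.
Qed.

End ProcessLaw.

(** * The privacy budget *)

Section Budget.
Context {R : realType}.
Variables (N n : nat) (alpha : R).
Hypothesis N_ge3 : (3 <= N)%N.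
Hypothesis n_ge17 : (17 <= n)%N.
Hypothesis alpha_gt0 : 0 < alpha.

Lemma ln_nat_ge0 k : 0 <= ln (k%:R : R).
Proof. by case: k => [|k]; [rewrite ln0|rewrite ln_ge0 // ler1n]. Qed.

(** [expR (1 / 4) <= 4 / 3], and the eighth power of [4 / 3] is below 10. *)
Lemma ln_nat_ge2 k : (17 <= k)%N -> 2 <= ln (k%:R : R).
Proof.
move=> k17; have k0 : (0 : R) < k%:R by rewrite ltr0n; apply: leq_trans k17.
rewrite -ler_expR lnK ?posrE //; apply: (@le_trans _ _ 17%:R); last by rewrite ler_nat.
have -> : (2 : R) = 1 / 4 * 8%:R by field.
rewrite expRM_natr.
have h : expR (1 / 4) <= (4 / 3 : R).
  rewrite -[expR _]invrK -expRN -[leRHS]invrK lef_pV2 ?posrE ?expR_gt0 //.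
  by have := expR_ge1Dx (- (1 / 4) : R); lra.
apply: (@le_trans _ _ ((4 / 3) ^+ 8)); first by rewrite lerXn2r ?nnegrE ?expR_ge0.
lra.
Qed.

Lemma ln_succ_div t : (0 < t)%N ->
  0 <= ln (t.+1%:R / t%:R : R) <= 1 / t%:R.
Proof.
move=> t0; have tR : (0 : R) < t%:R by rewrite ltr0n.
have -> : t.+1%:R / t%:R = 1 + 1 / t%:R :> R by rewrite -[t.+1%:R]natr1; field; rewrite gt_eqF.
have h : 0 < 1 / t%:R :> R by rewrite divr_gt0.
by rewrite ln_ge0 ?le_ln1Dx //; lra.
Qed.

Lemma pmwg_b_ge0 t : (0 < t)%N -> 0 <= pmwg_b (R := R) (N := N) t.+1.
Proof.
move=> t0; rewrite /pmwg_b /=; have /andP[h _] := ln_succ_div t0.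
by rewrite !addr_ge0 // divr_ge0 // ln_nat_ge0.
Qed.

(* [tail_bound t] bounds the tail sum of [pmwg_b tau / tau] over [tau > t]. *)
Definition tail_bound (t : nat) : R := (ln N%:R + ln t%:R + 2) / t%:R.

Lemma tail_bound_ge0 t : 0 <= tail_bound t.
Proof. by rewrite divr_ge0 // !addr_ge0 // ln_nat_ge0. Qed.

(** [tail_bound t] is the integral of [(ln N + ln s + 1) / s ^ 2] over [s >= t], and [pmwg_b s / s]
    is close to this integrand. *)
Lemma pmwg_b_le_tail_bound t : (0 < t)%N ->
  pmwg_b (R := R) (N := N) t.+1 / t.+1%:R <= tail_bound t - tail_bound t.+1.
Proof.
move=> t0; rewrite /pmwg_b /tail_bound /=.
have /andP[a0 a1] := ln_succ_div t0.
have tR : (0 : R) < t%:R by rewrite ltr0n.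
have lt : ln (t.+1%:R : R) = ln t%:R + ln (t.+1%:R / t%:R).
  by rewrite ln_div ?posrE ?ltr0n // subrKC.
rewrite lt; set a := ln (t.+1%:R / t%:R) in a0 a1 *.
have := ln_nat_ge0 N; have := ln_nat_ge0 t.
set u := ln t%:R; set v := ln N%:R => u0 v0.
rewrite -subr_ge0 -[t.+1%:R]natr1; set T : R := t%:R in tR a1 *.
have aT : a * T <= 1 by move: a1; rewrite ler_pdivlMr.
have -> : (v + u + 2) / T - (v + (u + a) + 2) / (T + 1) -
    (v / (T + 1) + u / (T + 1) + a) / (T + 1) =
   (v + u + 2 * (T + 1) * (1 - a * T)) / (T * (T + 1) ^+ 2).
  by field; rewrite !gt_eqF //; lra.
rewrite divr_ge0 // ?mulr_ge0 ?exprn_ge0 //; try lra.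
by rewrite !addr_ge0 // !mulr_ge0 //; lra.
Qed.

Lemma hard_boundS t : (n <= t)%N ->
  hard_bound (N := N) alpha n t.+1 =
  hard_bound (N := N) alpha n t + 36 / alpha ^+ 2 * pmwg_b (N := N) t.+1.
Proof.
by move=> nt; rewrite /hard_bound big_nat_recr //= addrA mulrDr.
Qed.

(* Bounds twice the sum of 1/s over the hard queries that may still be answered at sizes
   s >= t: those allowed at size t come at once, and those that [hard_bound]
   allows later come as soon as they can. *)
Definition future_cost (H t : nat) : R :=
  2 * (Num.max (hard_bound (N := N) alpha n t - H%:R) 0 / t%:R)
  + 72 / alpha ^+ 2 * tail_bound t.

Lemma future_cost_ge0 H t : 0 <= future_cost H t.
Proof.
apply: addr_ge0; apply: mulr_ge0 => //.
- by rewrite divr_ge0 // le_max lexx orbT.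
- by rewrite divr_ge0 // sqr_ge0.
- exact: tail_bound_ge0.
Qed.

(** At size [t.+1] the queries already allowed become cheaper, and the newly allowed ones, priced at
    [2 / t.+1] each, are paid for by the decrement of [tail_bound]; hence 72, twice the 36 of
    [hard_bound]. *)
Lemma future_costS H t : (n <= t)%N -> future_cost H t.+1 <= future_cost H t.
Proof.
move=> nt; have t0 : (0 < t)%N by apply: leq_trans nt; apply: leq_trans n_ge17.
have tR : (0 : R) < t%:R by rewrite ltr0n.
rewrite /future_cost hard_boundS //.
have := pmwg_b_le_tail_bound t0; have := pmwg_b_ge0 t0.
set b := pmwg_b _; set h := hard_bound _ _ _ => b0 bT.
have c0 : 0 < alpha ^+ 2 by rewrite exprn_gt0.
set k := 36 / alpha ^+ 2; have k0 : 0 < k by rewrite divr_gt0.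
have -> : 72 / alpha ^+ 2 = 2 * k by rewrite /k; field; rewrite gt_eqF.
set m := Num.max (h - H%:R) 0.
have m0 : 0 <= m by rewrite le_max lexx orbT.
have hm : h - H%:R <= m by rewrite le_max lexx.
have h1 : Num.max (h + k * b - H%:R) 0 / t.+1%:R <= m / t%:R + k * (b / t.+1%:R).
  apply: (@le_trans _ _ ((m + k * b) / t.+1%:R)).
    have kb0 : 0 <= k * b by rewrite mulr_ge0 // ltW.
    rewrite ler_pM2r ?invr_gt0 ?ltr0n // ge_max; apply/andP; split; lra.
  rewrite mulrDl mulrA lerD2r ler_wpM2l // lef_pV2 ?posrE ?ltr0n //.
  by rewrite ler_nat.
have h2 : k * (b / t.+1%:R) <= k * (tail_bound t - tail_bound t.+1) by rewrite ler_wpM2l // ltW.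
move: h1 h2; rewrite mulrBr -!mulrA.
move: (_ / t.+1%:R) (b / _) (m / _) (k * tail_bound t) => x1 x2 x3 x4.
lra.
Qed.

Lemma le_future_cost H t t' : (n <= t)%N -> (t <= t')%N ->
  future_cost H t' <= future_cost H t.
Proof.
move=> nt; elim: t' => [|t' IH]; first by rewrite leqn0 => /eqP ->.
rewrite leq_eqVlt => /predU1P[-> //|tt'].
by apply: le_trans (IH tt'); apply: future_costS; exact: leq_trans nt tt'.
Qed.

(** The 2 is there because a hard query may complete two instances, one for each query it
    submits. *)
Lemma future_cost_hard H t : (n <= t)%N -> H.+1%:R <= hard_bound (N := N) alpha n t ->
  future_cost H.+1 t = future_cost H t - 2 / t%:R.
Proof.
move=> nt h; rewrite /future_cost; have t0 : (0 < t)%N by apply: leq_trans nt; apply: leq_trans n_ge17.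
have H1 : H.+1%:R = H%:R + 1 :> R by rewrite natr1.
rewrite !max_l; last 2 first.
- by move: h; rewrite H1; lra.
- by move: h; rewrite H1; lra.
by rewrite H1; field; rewrite !gt_eqF // ltr0n.
Qed.

(** [budget_unit / t] is the squared privacy parameter of an instance started at size [t]. The
    constant 3/128 is 9/8 divided by the 48 of [pmwg_xi]. *)
Definition budget_unit (eps delta : R) : R :=
  (3 / 128) ^+ 2 * (alpha ^+ 2 * n%:R * eps ^+ 2 / (ln (N * n)%:R * ln (1 / delta))).

Hypothesis alpha_le1 : alpha <= 1.
Variables (eps delta : R).
Hypothesis eps01 : 0 < eps <= 1.
Hypothesis delta0e : 0 < delta < expR (-1).

Lemma ln_inv_delta_gt1 : 1 < ln (1 / delta).
Proof.
case/andP: delta0e => d0 de.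
by rewrite -ltr_expR lnK ?posrE ?divr_gt0 // div1r -[ltLHS]invrK -expRN ltf_pV2 ?posrE ?expR_gt0.
Qed.

Lemma Nn_gt0 : (0 : R) < N%:R /\ (0 : R) < n%:R.
Proof. by rewrite !ltr0n; split; [exact: leq_trans N_ge3|exact: leq_trans n_ge17]. Qed.

Lemma lnNn : ln (N * n)%:R = ln N%:R + ln n%:R :> R.
Proof. by have [N0 n0] := Nn_gt0; rewrite natrM lnM ?posrE. Qed.

Lemma lnNn_gt0 : (0 : R) < ln (N * n)%:R.
Proof. by rewrite lnNn; have := ln_nat_ge0 N; have := ln_nat_ge2 n_ge17; lra. Qed.

Lemma budget_unit_ge0 : 0 <= budget_unit eps delta.
Proof.
have l1 := ln_inv_delta_gt1; have L0 := lnNn_gt0.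
rewrite /budget_unit; apply: mulr_ge0; first exact: sqr_ge0.
apply: divr_ge0; first by rewrite mulr_ge0 ?sqr_ge0 // mulr_ge0 ?sqr_ge0.
by apply: mulr_ge0; [exact: ltW|lra].
Qed.

Lemma theta_budget_unit t : (n <= t)%N ->
  (9 / 8 * (pmwg_xi (N := N) eps delta alpha n t / t%:R)) ^+ 2 = budget_unit eps delta / t%:R.
Proof.
move=> nt; rewrite /pmwg_xi /budget_unit; case/andP: delta0e => d0 _.
have l1 := ln_inv_delta_gt1; have L0 := lnNn_gt0; have [_ n0] := Nn_gt0.
have tR : (0 : R) < t%:R by rewrite ltr0n; apply: leq_trans nt; apply: leq_trans n_ge17.
rewrite gt_eqF //.
set L := ln _ in L0 *; set l := ln _ in l1 *.
have sL : 0 < Num.sqrt L by rewrite sqrtr_gt0.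
have sl : 0 < Num.sqrt l by rewrite sqrtr_gt0; lra.
have st : 0 < Num.sqrt (t%:R : R) by rewrite sqrtr_gt0.
have eL : L = Num.sqrt L ^+ 2 by rewrite sqr_sqrtr // ltW.
have el : l = Num.sqrt l ^+ 2 by rewrite sqr_sqrtr //; lra.
have en : n%:R = Num.sqrt n%:R ^+ 2 :> R by rewrite sqr_sqrtr.
have et : t%:R = Num.sqrt t%:R ^+ 2 :> R by rewrite sqr_sqrtr.
move: (Num.sqrt L) (Num.sqrt l) (Num.sqrt n%:R) (Num.sqrt t%:R) sL sl st eL el en et.
move=> sL sl sn st sL0 sl0 st0 -> -> -> ->.
by field; rewrite !gt_eqF.
Qed.

(** Over [alpha ^+ 2 * n], the hard bound contributes [72 * ln N] and the tail
    [72 * (ln N + ln n + 2)]; the constant 48 of the noise is large enough for [ln (N * n)] to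
    absorb both, given [2 <= ln n]. In [3 / t], one part is the first instance itself and two are
    the reserve for the current query. *)
Lemma initial_budget t : (n <= t)%N ->
  budget_unit eps delta * (future_cost 0 t + 3 / t%:R) <= eps ^+ 2 / (12 * ln (1 / delta)).
Proof.
move=> nt; have l1 := ln_inv_delta_gt1; have L0 := lnNn_gt0; have [_ n0] := Nn_gt0.
apply: (@le_trans _ _ (budget_unit eps delta * (future_cost 0 n + 3 / n%:R))).
  rewrite ler_wpM2l ?budget_unit_ge0 //; apply: lerD.
    exact: le_future_cost.
  rewrite ler_wpM2l // lef_pV2 ?posrE ?ler_nat // ltr0n.
  by apply: leq_trans nt; apply: leq_trans n_ge17.
have -> : future_cost 0 n + 3 / n%:R =
    (72 * (2 * ln N%:R + ln n%:R + 2) + 3 * alpha ^+ 2) / (alpha ^+ 2 * n%:R).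
  rewrite /future_cost /hard_bound big_geq // addr0 subr0 max_l; last first.
    by rewrite mulr_ge0 ?ln_nat_ge0 // divr_ge0 // sqr_ge0.
  by rewrite /tail_bound; field; rewrite !gt_eqF.
rewrite /budget_unit lnNn in L0 *; set l := ln (1 / delta) in l1 *.
have a1 : alpha ^+ 2 <= 1 by rewrite expr_le1 // ltW.
have a0 : 0 < alpha ^+ 2 by rewrite exprn_gt0.
have := ln_nat_ge2 n_ge17; have := ln_nat_ge0 N.
move: (alpha ^+ 2) (ln (N%:R : R)) (ln (n%:R : R)) a0 a1 L0 => a2 u v a0 a1 uv0 u0 v2.
move: (n%:R : R) (eps ^+ 2) n0 (sqr_ge0 eps) => m e2 m0 e20.
set q := 72 * (2 * u + v + 2) + 3 * a2.
have -> : (3 / 128) ^+ 2 * (a2 * m * e2 / ((u + v) * l)) * (q / (a2 * m)) =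
   (e2 / (12 * l)) * (27 / 64 * (q / 64) / (u + v)).
  by field; rewrite !gt_eqF //; lra.
rewrite -[leRHS]mulr1 ler_wpM2l //; first by rewrite divr_ge0 //; lra.
by rewrite ler_pdivrMr // mul1r /q; lra.
Qed.

End Budget.

(** * The mechanism as a machine *)

(* The public part of the state of the mechanism: everything except the
   threshold noise of the running NATG instance.  [pphase] is 0 before the query
   [g1] is submitted; afterwards it is 1 if the answer to [g1] was ⊥ and 2 if it
   was the real number [pa1]. *)
Record pub (R : realType) (N : nat) := Pub {
  pdead : bool; ph : seq R; plast : option nat; py : 'I_N -> R; phard : nat;
  pphase : nat; pa1 : R
}.

HB.instance Definition _ R N := gen_eqMixin (pub R N).
HB.instance Definition _ R N := gen_choiceMixin (pub R N).
HB.instance Definition _ (R : realType) N :=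
  isPointed.Build (pub R N) (Pub false [::] None (fun=> 0) 0 0 0).

(** Real coordinates that generate the sigma-algebra on public states. A list of answers has no
    fixed length, so it is read through its size and its entries, with 0 past the end. *)
Inductive coord (N : nat) :=
  CDead | CSize | CNth of nat | CLast | CY of 'I_N | CHard | CPhase | CAns.

Definition last_code (l : option nat) : nat := if l is Some t then t.+1 else 0.

Definition pub_coord {R : realType} {N} (c : coord N) (z : pub R N) : R :=
  match c with
  | CDead => (pdead z)%:R
  | CSize => (size (ph z))%:R
  | CNth k => nth 0 (ph z) k
  | CLast => (last_code (plast z))%:R
  | CY i => py z i
  | CHard => (phard z)%:R
  | CPhase => (pphase z)%:R
  | CAns => pa1 z
  end.

Definition pub_gen {R : realType} {N} : set (set (pub R N)) :=
  [set A | exists c (B : set R), measurable B /\ A = pub_coord c @^-1` B].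

Definition mpub (R : realType) N := g_sigma_algebraType (@pub_gen R N).

Section MeasurablePub.
Context {R : realType} {N : nat}.
Local Notation Z := (mpub R N).

Lemma measurable_pub_coord c : measurable_fun setT (pub_coord c : Z -> R).
Proof. by move=> _ B mB; rewrite setTI; apply: sub_sigma_algebra; exists c, B. Qed.

Context {d : measure_display} {X : measurableType d}.

Lemma measurable_into_pub (f : X -> Z) :
  (forall c, measurable_fun setT (fun x => pub_coord c (f x))) -> measurable_fun setT f.
Proof.
move=> mf; apply: (@measurability _ _ X Z setT f pub_gen) => //.
by move=> _ [_ [c [B [mB ->]]] <-]; exact: mf.
Qed.

Lemma measurable_natr (f : X -> nat) :
  measurable_fun setT (fun x => (f x)%:R : R) -> measurable_fun setT f.
Proof.
move=> mf _ B _; rewrite setTI.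
rewrite (_ : f @^-1` B = \bigcup_k ((fun x => (f x)%:R : R) @^-1` [set (k%:R : R)] `&` [set _ | B k])).
  apply: bigcupT_measurable => k; apply: measurableI.
    by rewrite -[X in measurable X]setTI; apply: mf.
  by have [Bk|Bk] := pselect (B k); [rewrite (_ : [set _ | _] = setT)|rewrite (_ : [set _ | _] = set0)] => //;
    apply/seteqP; split.
apply/seteqP; split => [x Bx|x [k _ [/= /eqP]]]; first by exists (f x).
by rewrite eqr_nat => /eqP ->.
Qed.

Lemma measurable_natfun (f : X -> nat) (h : nat -> R) :
  measurable_fun setT f -> measurable_fun setT (fun x => h (f x)).
Proof. exact: (measurableT_comp (measurable_nat_fun h)). Qed.

Lemma measurable_eqnat (f : X -> nat) k : measurable_fun setT f ->
  measurable_fun setT (fun x => f x == k).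
Proof. exact: (measurableT_comp (measurable_nat_fun (fun m => m == k))). Qed.

Variable (z : X -> Z).
Hypothesis mz : measurable_fun setT z.

Lemma measurable_coord c : measurable_fun setT (fun x => pub_coord c (z x)).
Proof. exact: (measurableT_comp (measurable_pub_coord c) mz). Qed.

Lemma measurable_size : measurable_fun setT (fun x => size (ph (z x))).
Proof. by apply: measurable_natr; exact: (measurable_coord (CSize N)). Qed.

Lemma measurable_last : measurable_fun setT (fun x => last_code (plast (z x))).
Proof. by apply: measurable_natr; exact: (measurable_coord (CLast N)). Qed.

Lemma measurable_hard : measurable_fun setT (fun x => phard (z x)).
Proof. by apply: measurable_natr; exact: (measurable_coord (CHard N)). Qed.

Lemma measurable_phase : measurable_fun setT (fun x => pphase (z x)).
Proof. by apply: measurable_natr; exact: (measurable_coord (CPhase N)). Qed.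

Lemma measurable_dead : measurable_fun setT (fun x => pdead (z x)).
Proof.
have m : measurable_fun setT (fun x => pdead (z x) : nat).
  by apply: measurable_natr; exact: (measurable_coord (CDead N)).
have : measurable_fun setT (fun x => (pdead (z x) : nat) == 1%N) by exact: measurable_eqnat.
by congr measurable_fun; apply/funext => x; case: (pdead _).
Qed.

(** Query streams are measurable on tuples of each length while a history is a list: histories are
    split by size and rebuilt as tuples. *)
Lemma measurable_hist d' (T : measurableType d') (phi : seq R -> T) :
  (forall k, measurable_fun setT (fun v : k.-tuple R => phi v)) ->
  measurable_fun setT (fun x => phi (ph (z x))).
Proof.
move=> mphi.
have -> : (fun x => phi (ph (z x))) =
    (fun x => phi [tuple nth 0 (ph (z x)) i | i < size (ph (z x))]).
  apply/funext => x; congr phi; apply: (@eq_from_nth _ 0) => [|i ih]; first by rewrite size_tuple.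
  by have := tnth_mktuple (fun i : 'I_(size (ph (z x))) => nth 0 (ph (z x)) i) (Ordinal ih);
    rewrite (tnth_nth 0) => ->.
apply: (measurable_fun_nat_cases measurable_size
  (F := fun k x => phi [tuple nth 0 (ph (z x)) i | i < k])) => k.
apply: (measurableT_comp (mphi k) (g := fun x => [tuple nth 0 (ph (z x)) i | i < k])).
apply/measurable_fun_tnthP => i.
rewrite (_ : _ \o _ = fun x => pub_coord (CNth N i) (z x)); first exact: measurable_coord.
by apply/funext => x /=; rewrite tnth_mktuple.
Qed.

End MeasurablePub.

Lemma measurable_nat_points d (X : measurableType d) (f : X -> nat) :
  (forall t, measurable (f @^-1` [set t.+1])) -> measurable_fun setT f.
Proof.
move=> mf _ B _; rewrite setTI.
have m0 : measurable (f @^-1` [set 0%N]).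
  rewrite (_ : _ @^-1` _ = ~` \bigcup_t (f @^-1` [set t.+1])).
    by apply: measurableC; exact: bigcupT_measurable.
  apply/seteqP; split => [x /= fx [t _ /=]|x nx /=]; first by rewrite fx.
  case fx : (f x) => [//|t]; exfalso; apply: nx; by exists t.
have mt t : measurable (f @^-1` [set t]) by case: t.
rewrite (_ : f @^-1` B = \bigcup_(t in B) (f @^-1` [set t])).
  by apply: bigcup_measurable => t _; exact: mt.
by apply/seteqP; split => [x Bx|x [t Bt /= ->]] //; exists (f x).
Qed.

Lemma measurable_invr (R : realType) : measurable_fun setT (fun x : R => x^-1).
Proof.
have -> : (fun x : R => x^-1) = (fun x => if 0 < x then expR (- ln x)
    else if x < 0 then - expR (- ln (- x)) else 0).
  apply/funext => x; case: ltgtP => [x0|x0|x0]; last by rewrite -x0 invr0.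
  - by rewrite expRN lnK.
  - by rewrite expRN lnK ?posrE ?oppr_gt0 // invrN opprK.
have me (f : R -> R) : measurable_fun setT f -> measurable_fun setT (fun x => expR (- ln (f x))).
  move=> mf; have h : measurable_fun setT (fun x => - ln (f x)).
    by apply: measurable_funN; exact: (measurableT_comp (@measurable_ln R) mf).
  exact: (measurableT_comp (@measurable_expR R) h).
apply: measurable_fun_ifT; first exact: measurable_fun_ltr.
  exact: (me id).
apply: measurable_fun_ifT => //; first exact: measurable_fun_ltr.
by apply: measurable_funN; exact: (me -%R).
Qed.

Section PMWGMachine.
Context {R : realType} {N : nat}.
Variables (alpha : R) (n : nat) (F : query_stream R N).
Local Notation Z := (mpub R N).

(** The default [n] gives even a state without further query a size at which the noise laws are
    meaningful. *)
Definition pub_time (z : Z) : nat := odflt n (arrival F (ph z)).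

Definition pub_live (z : Z) : bool := ~~ pdead z && (arrival F (ph z) != None).

Definition pub_aged (z : Z) : 'I_N -> R := age (plast z) (pub_time z) (py z).

Definition pub_ef (z : Z) : R := Defs.eval (query F (ph z)) (pub_aged z).

Definition pub_query (X : nat -> 'I_N -> R) (z : Z) : R :=
  let fx := Defs.eval (query F (ph z)) (X (pub_time z)) in
  if pphase z == 0 then fx - pub_ef z else pub_ef z - fx.

Definition pub_push (z : Z) (a : R) (y : 'I_N -> R) (H : nat) : Z :=
  Pub (pdead z) (rcons (ph z) a) (Some (pub_time z)) y H 0 0.

Definition pub_put (z : Z) (p : nat) (a : R) : Z :=
  Pub (pdead z) (ph z) (plast z) (py z) (phard z) p a.

Definition pub_kill (z : Z) : Z :=
  Pub true (ph z) (plast z) (py z) (phard z) 0 0.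

Definition pub_hard (z : Z) (a : R) : Z :=
  if (phard z).+1%:R > hard_bound (N := N) alpha n (pub_time z) then pub_kill z
  else pub_push z a (mw_update alpha
    (if a < pub_ef z then query F (ph z) else fun i => 1 - query F (ph z) i)
    (pub_aged z)) (phard z).+1.

Definition pub_bot (z : Z) : Z :=
  if pphase z == 0 then pub_put z 1 0
  else if pphase z == 1 then pub_push z (pub_ef z) (pub_aged z) (phard z)
  else pub_hard z (pub_ef z + pa1 z).

(** In phase 2 the answer to [g2] is dropped, because the real answer to [g1] takes precedence. *)
Definition pub_real (z : Z) (a : R) : Z :=
  if pphase z == 0 then pub_put z 2 a
  else if pphase z == 1 then pub_hard z (pub_ef z - a)
  else pub_hard z (pub_ef z + pa1 z).

Section Measurability.
Hypothesis marrival : forall k t, measurable [set h : k.-tuple R | arrival F h = Some t].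
Hypothesis mquery : forall k i, measurable_fun setT (fun h : k.-tuple R => query F h i).
Context {d : measure_display} {X : measurableType d}.
Variables (z : X -> Z) (a : X -> R).
Hypothesis mz : measurable_fun setT z.
Hypothesis ma : measurable_fun setT a.

Lemma measurable_arrival : measurable_fun setT (fun x => last_code (arrival F (ph (z x)))).
Proof.
apply: (measurable_hist mz (phi := fun h => last_code (arrival F h))) => k.
apply: measurable_nat_points => t.
rewrite (_ : _ @^-1` _ = [set h : k.-tuple R | arrival F h = Some t]); first exact: marrival.
by apply/seteqP; split => h /=; case: (arrival F h) => //= t' [->].
Qed.

Lemma measurable_pub_time : measurable_fun setT (fun x => pub_time (z x)).
Proof.
have := measurableT_comp (measurable_nat_fun (fun c => if c is t.+1 then t else n)) measurable_arrival.
by congr measurable_fun; apply/funext => x; rewrite /= /pub_time; case: (arrival _ _).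
Qed.

Lemma measurable_pub_live : measurable_fun setT (fun x => pub_live (z x)).
Proof.
apply: measurable_and; first by apply: measurable_neg; exact: measurable_dead.
have := measurableT_comp (measurable_nat_fun (fun c : nat => c != 0%N)) measurable_arrival.
by congr measurable_fun; apply/funext => x /=; case: (arrival _ _).
Qed.

Lemma measurable_pub_aged i : measurable_fun setT (fun x => pub_aged (z x) i).
Proof.
pose dec c : option nat := if c is t.+1 then Some t else None.
have -> : (fun x => pub_aged (z x) i) =
    (fun x => age (dec (last_code (plast (z x)))) (pub_time (z x)) (py (z x)) i).
  by apply/funext => x; rewrite /pub_aged; case: (plast _).
apply: (measurable_fun_nat_cases (measurable_last mz)
  (F := fun c x => age (dec c) (pub_time (z x)) (py (z x)) i)) => c.
apply: (measurable_fun_nat_cases measurable_pub_time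
  (F := fun t x => age (dec c) t (py (z x)) i)) => t.
have my := measurable_coord mz (CY i).
rewrite /age; case: (dec c) => [t'|//]; case: (t' < t)%N => //.
by apply: measurable_funD => //; apply: measurable_funM.
Qed.

Lemma measurable_pub_f i : measurable_fun setT (fun x => query F (ph (z x)) i).
Proof. exact: (measurable_hist mz (phi := fun h => query F h i)). Qed.

Lemma measurable_pub_ef : measurable_fun setT (fun x => pub_ef (z x)).
Proof.
apply: measurable_sum => i; apply: measurable_funM; first exact: measurable_pub_f.
exact: measurable_pub_aged.
Qed.

Lemma measurable_pub_query D : measurable_fun setT (fun x => pub_query D (z x)).
Proof.
have mf : measurable_fun setT (fun x => Defs.eval (query F (ph (z x))) (D (pub_time (z x)))).
  apply: measurable_sum => i; apply: measurable_funM; first exact: measurable_pub_f.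
  exact: (measurable_natfun (fun t => D t i) measurable_pub_time).
have mef := measurable_pub_ef.
apply: measurable_fun_ifT; first exact: measurable_eqnat (measurable_phase mz).
- exact: measurable_funB.
- exact: measurable_funB.
Qed.

Lemma measurable_pub_push (y : X -> 'I_N -> R) (H : X -> nat) :
  (forall i, measurable_fun setT (fun x => y x i)) -> measurable_fun setT H ->
  measurable_fun setT (fun x => pub_push (z x) (a x) (y x) (H x)).
Proof.
move=> my mH; apply: measurable_into_pub => -[||k||i|||] //=.
- exact: (measurable_coord mz (CDead N)).
- under eq_fun do rewrite size_rcons.
  exact: (measurable_natfun (fun k => k.+1%:R) (measurable_size mz)).
- under eq_fun do rewrite nth_rcons.
  apply: measurable_fun_ifT => //.
  + exact: (measurableT_comp (measurable_nat_fun (fun m => (k < m)%N)) (measurable_size mz)).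
  + exact: (measurable_coord mz (CNth N k)).
  + apply: measurable_fun_ifT => //.
    exact: (measurableT_comp (measurable_nat_fun (fun m => (k == m)%N)) (measurable_size mz)).
- exact: (measurable_natfun (fun k => k.+1%:R) measurable_pub_time).
- exact: measurable_natfun.
Qed.

Lemma measurable_pub_put p (b : X -> R) : measurable_fun setT b ->
  measurable_fun setT (fun x => pub_put (z x) p (b x)).
Proof.
move=> mb; apply: measurable_into_pub => -[||k||i|||] //=.
- exact: (measurable_coord mz (CDead N)).
- exact: (measurable_coord mz (CSize N)).
- exact: (measurable_coord mz (CNth N k)).
- exact: (measurable_coord mz (CLast N)).
- exact: (measurable_coord mz (CY i)).
- exact: (measurable_coord mz (CHard N)).
Qed.

Lemma measurable_pub_kill : measurable_fun setT (fun x => pub_kill (z x)).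
Proof.
apply: measurable_into_pub => -[||k||i|||] //=.
- exact: (measurable_coord mz (CSize N)).
- exact: (measurable_coord mz (CNth N k)).
- exact: (measurable_coord mz (CLast N)).
- exact: (measurable_coord mz (CY i)).
- exact: (measurable_coord mz (CHard N)).
Qed.

Lemma measurable_pub_hard : measurable_fun setT (fun x => pub_hard (z x) (a x)).
Proof.
apply: measurable_fun_ifT.
- apply: measurable_fun_ltr.
    exact: (measurable_natfun (hard_bound (N := N) alpha n) measurable_pub_time).
  exact: (measurable_natfun (fun k => k.+1%:R) (measurable_hard mz)).
- exact: measurable_pub_kill.
apply: measurable_pub_push; last first.
  exact: (measurableT_comp (measurable_nat_fun S) (measurable_hard mz)).
move=> i; pose r x i := if a x < pub_ef (z x) then query F (ph (z x)) i else 1 - query F (ph (z x)) i.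
have mr j : measurable_fun setT (fun x => r x j).
  have mf := measurable_pub_f j.
  apply: measurable_fun_ifT => //.
    by apply: measurable_fun_ltr => //; exact: measurable_pub_ef.
  exact: measurable_funB.
have mw j : measurable_fun setT (fun x => pub_aged (z x) j * expR (- (alpha * r x j / 6))).
  apply: measurable_funM; first exact: measurable_pub_aged.
  have h : measurable_fun setT (fun x => - (alpha * r x j / 6)).
    by apply: measurable_funN; apply: measurable_funM => //; apply: measurable_funM.
  exact: (measurableT_comp (@measurable_expR R) h).
have -> : (fun x => mw_update alpha
    (if a x < pub_ef (z x) then query F (ph (z x)) else fun i => 1 - query F (ph (z x)) i)
    (pub_aged (z x)) i) =
  (fun x => pub_aged (z x) i * expR (- (alpha * r x i / 6)) /
     \sum_(j < N) pub_aged (z x) j * expR (- (alpha * r x j / 6))).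
  by apply/funext => x; rewrite /mw_update /r; case: ifP.
apply: measurable_funM => //.
apply: (measurableT_comp (@measurable_invr R)); exact: measurable_sum.
Qed.

End Measurability.

Section Instances.
Hypothesis marrival : forall k t, measurable [set h : k.-tuple R | arrival F h = Some t].
Hypothesis mquery : forall k i, measurable_fun setT (fun h : k.-tuple R => query F h i).

Lemma measurable_pub_bot : measurable_fun setT pub_bot.
Proof.
have mid : measurable_fun setT (id : Z -> Z) by exact: measurable_id.
have mef := measurable_pub_ef marrival mquery mid.
apply: measurable_fun_ifT; first exact: measurable_eqnat (measurable_phase mid).
  exact: (measurable_pub_put mid).
apply: measurable_fun_ifT; first exact: measurable_eqnat (measurable_phase mid).
  apply: (measurable_pub_push marrival mid mef).
    by move=> i; exact: (measurable_pub_aged marrival mid).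
  exact: (measurable_hard mid).
apply: (measurable_pub_hard marrival mquery mid (a := fun z => pub_ef z + pa1 z)).
by apply: measurable_funD => //; exact: (measurable_coord mid (CAns N)).
Qed.

Lemma measurable_pub_real : measurable_fun setT (fun p : Z * R => pub_real p.1 p.2).
Proof.
have m1 : measurable_fun setT (fst : Z * R -> Z) by exact: measurable_fst.
have mef := measurable_pub_ef marrival mquery m1.
apply: measurable_fun_ifT; first exact: measurable_eqnat (measurable_phase m1).
  exact: (measurable_pub_put m1).
apply: measurable_fun_ifT; first exact: measurable_eqnat (measurable_phase m1).
  apply: (measurable_pub_hard marrival mquery m1 (a := fun p : Z * R => pub_ef p.1 - p.2)).
  by apply: measurable_funB.
apply: (measurable_pub_hard marrival mquery m1 (a := fun p : Z * R => pub_ef p.1 + pa1 p.1)).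
by apply: measurable_funD => //; exact: (measurable_coord m1 (CAns N)).
Qed.

End Instances.
End PMWGMachine.

(** * Agreement of the machine with the mechanism *)

Section Correspondence.
Context {R : realType} {N : nat} {d : measure_display} {Omega : measurableType d}.
Variables (P : probability Omega R) (W : noise_kind -> nat -> nat -> {RV P >-> R}).
Variables (eps delta alpha : R) (n : nat) (F : query_stream R N) (X : nat -> 'I_N -> R).
Local Notation Z := (mpub R N).

Definition pub0 : Z := Pub false [::] None (fun=> 1 / N%:R) 0 0 0.

Definition pub_step : Z * (bool * R) -> R -> R -> R -> Z * (bool * R) :=
  machine_step (pub_live F) (pub_time n F) (pub_bot alpha n F) (pub_real alpha n F)
    (2 * alpha / 3) (pmwg_xi (N := N) eps delta alpha n) (pub_query n F X).

Definition pub_process : nat -> Omega -> Z * (bool * R) :=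
  process W (fun s => pub_time n F s.1) pub_step (pub0, (false, 0)).

Arguments pub_process : simpl never.

Definition encode (s : option R) : bool * R := if s is Some eta then (true, eta) else (false, 0).

Definition pub_of (h : seq R) (s : pmwg_state) : Z :=
  Pub false h (last_time s) (public s) (hard s) 0 0.

Lemma pub_step_nsg (w : noise_kind -> nat -> nat -> R) z s t m g :
  pub_live F z -> pub_time n F z = t -> g (X t) = pub_query n F X z ->
  pub_step (z, encode s) (w Eta t m) (w Nu t m) (w Ans t m) =
  let: (o, s1) := nsg (2 * alpha / 3) (pmwg_xi (N := N) eps delta alpha n) w (X t) t m g s in
  (if o is Some a then pub_real alpha n F z a else pub_bot alpha n F z, encode s1).
Proof.
move=> lz tz gz; rewrite /pub_step /machine_step /nsg lz tz gz.
by case: s => [eta|] /=; case: ifP.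
Qed.

(** One query is two machine steps, one per submission, so serial numbers are step numbers. After a
    halt only the history matters, since nothing else reaches the transcript. *)
Lemma pub_process_step2 k w h s t :
  arrival F h = Some t ->
  pub_process k.*2 w = (pub_of h s, encode (nsg_state s)) ->
  let: (a, s') := pmwg_step eps delta alpha n (fun c t m => W c t m w) (X t) k t (query F h) s in
  if a is Some b then
    pub_process k.+1.*2 w = (pub_of (rcons h b) s', encode (nsg_state s'))
  else pdead (pub_process k.+1.*2 w).1 /\ ph (pub_process k.+1.*2 w).1 = h.
Proof.
move=> Fh prock.
pose Ww c t m := W c t m w.
have procS m z s' : pub_process m w = (z, s') -> pub_live F z -> pub_time n F z = t ->
    pub_process m.+1 w = pub_step (z, s') (Ww Eta t m) (Ww Nu t m) (Ww Ans t m).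
  by move=> + _ tz; rewrite /pub_process /= => ->; rewrite /= tz.
rewrite /pmwg_step; set y := age (last_time s) t (public s).
set g1 := (fun z : 'I_N -> R => _ - _); set g2 := (fun z : 'I_N -> R => _ - _).
have tE : pub_time n F (pub_of h s) = t by rewrite /pub_time /= Fh.
have lE : pub_live F (pub_of h s) by rewrite /pub_live /= Fh.
have yE : pub_aged n F (pub_of h s) = y by rewrite /pub_aged tE.
have := procS _ _ _ prock lE tE.
rewrite (@pub_step_nsg Ww _ _ _ _ g1) //; last first.
  by rewrite /pub_query /= tE /pub_ef yE.
rewrite -/Ww; case: (nsg _ _ _ _ _ _ g1 _) => a1 s1.
set z1 := (if a1 is Some a then _ else _) => proc1.
have [p [b z1E]] : exists p b, z1 = pub_put (pub_of h s) p b.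
  by rewrite /z1; case: a1 {z1 proc1} => [a|]; [exists 2%N, a|exists 1%N, 0].
have z1p : pphase z1 = if a1 is Some _ then 2%N else 1%N by rewrite /z1; case: (a1).
have z1a : a1 = if a1 is Some _ then Some (pa1 z1) else None by rewrite /z1; case: (a1).
have tE1 : pub_time n F z1 = t by rewrite z1E.
have lE1 : pub_live F z1 by rewrite z1E.
have yE1 : pub_aged n F z1 = y by rewrite z1E.
have eE1 : pub_ef n F z1 = Defs.eval (query F h) y by rewrite /pub_ef yE1 z1E.
have := procS _ _ _ proc1 lE1 tE1.
rewrite (@pub_step_nsg Ww _ _ _ _ g2) //; last first.
  by rewrite /pub_query tE1 eE1 z1p z1E; case: (a1).
rewrite -doubleS; case: (nsg _ _ _ _ _ _ g2 _) => a2 s2 ->.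
have hardE a : pub_hard alpha n F z1 a =
   if (hard s).+1%:R > hard_bound (N := N) alpha n t then pub_kill z1
   else pub_push n F z1 a (mw_update alpha
     (if a < Defs.eval (query F h) y then query F h else fun i => 1 - query F h i) y) (hard s).+1.
  by rewrite /pub_hard tE1 eE1 yE1 z1E.
have pushE a y' H : pub_push n F z1 a y' H = Pub false (rcons h a) (Some t) y' H 0 0.
  by rewrite /pub_push tE1 z1E.
have killE : pub_kill z1 = Pub true h (last_time s) (public s) (hard s) 0 0 by rewrite z1E.
have hardz : phard z1 = hard s by rewrite z1E.
rewrite /pub_real /pub_bot.
clear proc1; clearbody z1.
case: a1 z1p z1a => [a|] -> => [[->]|_] /=; case: a2 => [a'|];
  rewrite ?hardE ?eE1 ?yE1 ?hardz ?pushE ?killE //; case: ifP => _; rewrite ?pushE //.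
Qed.

Lemma pub_process_dead m w : ~~ pub_live F (pub_process m w).1 ->
  pub_process m.+2 w = pub_process m w.
Proof.
have dead m' : ~~ pub_live F (pub_process m' w).1 -> pub_process m'.+1 w = pub_process m' w.
  by rewrite /pub_process /= => /negbTE ld; rewrite /pub_step /machine_step ld.
by move=> ld; rewrite dead dead.
Qed.

Lemma pub_process_run k w :
  if pmwg_run eps delta alpha n (fun c t m => W c t m w) X F k is Some (h, s) then
    pub_process k.*2 w = (pub_of h s, encode (nsg_state s)) /\ size h = k
  else ~~ pub_live F (pub_process k.*2 w).1 /\ (size (ph (pub_process k.*2 w).1) < k)%N.
Proof.
have dead m := @pub_process_dead m w.
elim: k => [//|k] /=.
case: (pmwg_run _ _ _ _ _ _ _ k) => [[h s]|]; last first.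
  by case=> ld sz; rewrite doubleS dead // ltnW.
case=> prock szh; case Fh : (arrival F h) => [t|]; last first.
  have ld : ~~ pub_live F (pub_process k.*2 w).1 by rewrite prock /pub_live /= Fh.
  rewrite doubleS dead // prock /= szh ltnS leqnn; split => //.
  by rewrite -[X in pub_live F X]/(pub_of h s, encode (nsg_state s)).1 -prock.
have := pub_process_step2 Fh prock.
case: (pmwg_step _ _ _ _ _ _ _ _ _ _) => [[b|] s'] /=; first by rewrite size_rcons szh.
by case=> dd ->; rewrite szh /pub_live dd.
Qed.

(** The transcript is read off the history in the public state: [onth] past its end gives [None], as
    the transcript does after a halt. *)
Lemma pmwg_process j k w : (j < k)%N ->
  pmwg eps delta alpha n (fun c t m => W c t m w) X F j = onth (ph (pub_process k.*2 w).1) j.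
Proof.
have dead m := @pub_process_dead m w.
elim: k => [//|k IH]; rewrite ltnS leq_eqVlt => jk.
have := pub_process_run k w.
case runk : (pmwg_run _ _ _ _ _ _ _ k) => [[h s]|] /=; last first.
  case=> ld sz; rewrite doubleS dead //.
  case/predU1P: jk => [->|//].
  by rewrite /pmwg /= runk onth_default // ltnW.
case=> prock szh; case Fh : (arrival F h) => [t|]; last first.
  have ld : ~~ pub_live F (pub_process k.*2 w).1 by rewrite prock /pub_live /= Fh.
  rewrite doubleS dead //; case/predU1P: jk => [->|]; last exact: IH.
  by rewrite /pmwg /= runk Fh prock onth_default // szh.
have IHj : (j < k)%N -> pmwg eps delta alpha n (fun c t m => W c t m w) X F j = onth h j.
  by move=> /IH; rewrite prock.
have := pub_process_step2 Fh prock.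
case stepE : (pmwg_step _ _ _ _ _ _ _ _ _ _) => [[b|] s'] /=.
  move=> -> /=; case/predU1P: jk => [->|jk].
    by rewrite /pmwg /= runk Fh stepE /= last_rcons -cats1 onth_cat szh ltnn subnn.
  by rewrite IHj // -cats1 onth_cat szh jk.
case=> _ ->; case/predU1P: jk => [->|jk]; last exact: IHj.
by rewrite /pmwg /= runk Fh stepE /= onth_default // szh.
Qed.

End Correspondence.

(** * Sensitivity of linear queries on neighboring streams *)

Section StreamSensitivity.
Context {R : realType} {N : nat}.

Lemma eval_neighboring (f x x' : 'I_N -> R) t : is_linear_query f ->
  neighboring t x x' -> `|Defs.eval f x - Defs.eval f x'| <= 1 / t%:R.
Proof.
move=> lf [i [j [_ xx']]].
have -> : Defs.eval f x - Defs.eval f x' = (f i - f j) / t%:R.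
  rewrite /Defs.eval -sumrB.
  have delta1 k : \sum_(l < N) f l * (l == k)%:R = f k.
    by rewrite (bigD1 k) //= eqxx mulr1 big1 ?addr0 // => l /negbTE ->; rewrite mulr0.
  rewrite -(delta1 i) -[in X in _ - X](delta1 j) -sumrB mulr_suml.
  by apply: eq_bigr => k _; rewrite xx'; ring.
rewrite normrM [`|_^-1|]ger0_norm ?invr_ge0 // ler_wpM2r ?invr_ge0 //.
have /andP[? ?] := lf i; have /andP[? ?] := lf j.
by rewrite ler_norml; apply/andP; split; lra.
Qed.

Lemma eval_neighboring_streams (f : 'I_N -> R) (X X' : nat -> 'I_N -> R) n t :
  is_linear_query f -> neighboring_streams n X X' -> (n <= t)%N ->
  `|Defs.eval f (X t) - Defs.eval f (X' t)| <= 1 / t%:R.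
Proof.
move=> lf [t0 nt0 [e nb]] nt.
have [h|h] := leqP t0 t; first by apply: eval_neighboring => //; exact: nb.
by rewrite e ?nt //= subrr normr0 divr_ge0.
Qed.

End StreamSensitivity.

(** * Privacy of the public state after finitely many steps *)

Section PublicPrivacy.
Context {R : realType} {N : nat} {d : measure_display} {Omega : measurableType d}.
Variables (P : probability Omega R) (W : noise_kind -> nat -> nat -> {RV P >-> R}).
Variables (eps delta alpha : R) (n : nat) (F : query_stream R N).
Hypothesis N_ge3 : (3 <= N)%N.
Hypothesis n_ge17 : (17 <= n)%N.
Hypothesis eps01 : 0 < eps <= 1.
Hypothesis delta0e : 0 < delta < expR (-1).
Hypothesis alpha_gt0 : 0 < alpha.
Local Notation xi := (pmwg_xi (N := N) eps delta alpha n).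
Hypothesis noiseW : is_noise xi n W.
Hypothesis streamF : is_query_stream n F.
Local Notation Z := (mpub R N).
Local Notation live := (pub_live F).
Local Notation tm := (pub_time n F).
Local Notation nb := (pub_bot alpha n F).
Local Notation nh := (pub_real alpha n F).

Let L (c : noise_kind) (t : nat) : probability R R := distribution P (W c t 0).

Lemma pub_time_ge z : (n <= tm z)%N.
Proof.
rewrite /pub_time; case Fh : (arrival F (ph z)) => [t|] //=.
by case: streamF => _ h _ _ _; exact: (h _ _ Fh).
Qed.

Let n_gt0 : (0 < n)%N. Proof. exact: leq_trans n_ge17. Qed.

Lemma pub_time_gt0 z : (0 < tm z)%N.
Proof. by apply: leq_trans (pub_time_ge z). Qed.

Lemma pmwg_xi_gt0 t : (n <= t)%N -> 0 < xi t.
Proof.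
move=> nt; have t0 := leq_trans n_gt0 nt.
case/andP: delta0e => d0 _; case/andP: eps01 => e0 _.
have l1 := ln_inv_delta_gt1 delta0e; have L0 : (0 : R) < ln (N * n)%:R := lnNn_gt0 N_ge3 n_ge17.
rewrite /pmwg_xi gt_eqF // !mulr_gt0 ?invr_gt0 ?mulr_gt0 ?sqrtr_gt0 ?ltr0n //.
exact: lt_trans l1.
Qed.

Let marr : forall k t, measurable [set h : k.-tuple R | arrival F h = Some t].
Proof. by case: streamF => _ _ _ _ []. Qed.

Let mque : forall k i, measurable_fun setT (fun h : k.-tuple R => query F h i).
Proof. by case: streamF => _ _ _ _ []. Qed.

Let mid : measurable_fun setT (id : Z -> Z). Proof. exact: measurable_id. Qed.
Let mlive : measurable_fun setT (live : Z -> bool).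
Proof. exact: (measurable_pub_live marr mid). Qed.
Let mtm : measurable_fun setT (tm : Z -> nat).
Proof. exact: (measurable_pub_time n marr mid). Qed.
Let mnb : measurable_fun setT (nb : Z -> Z). Proof. exact: measurable_pub_bot. Qed.
Let mnh : measurable_fun setT (fun p : Z * R => nh p.1 p.2).
Proof. exact: measurable_pub_real. Qed.
Let mg X : measurable_fun setT (pub_query n F X : Z -> R).
Proof. exact: (measurable_pub_query n marr mque mid). Qed.

Let lawW c t m : (n <= t)%N -> forall B, measurable B -> distribution P (W c t m) B = L c t B.
Proof. by move=> nt B mB; case: noiseW => lw _; exact: etrans (lw c t m nt B mB) (esym (lw c t 0%N nt B mB)). Qed.

Let lawL c (z : Z) B : measurable B -> L c (tm z) B = laplace_prob (noise_scale xi c (tm z)) B.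
Proof. by move=> mB; case: noiseW => lw _; apply: lw => //; exact: pub_time_ge. Qed.

Lemma measurable_pub_step X : measurable_fun setT
  (fun p : Z * (bool * R) * R * R * R => pub_step eps delta alpha n F X p.1.1.1 p.1.1.2 p.1.2 p.2).
Proof. exact: measurable_machine_step. Qed.

Lemma measurable_pub_process X m :
  measurable_fun setT (pub_process W eps delta alpha n F X m).
Proof.
apply: measurable_process; first exact: (measurableT_comp mtm).
exact: measurable_pub_step.
Qed.

(** Passes from the process to iterated integrals one step at a time: the mean of [V j] at step [k]
    depends only on [k + j]. *)
Lemma pub_process_value X (S : set Z) m : measurable S ->
  P [set w | S (pub_process W eps delta alpha n F X m w).1] =
  machine_value live tm nb nh (2 * alpha / 3) xi L (pub_query n F X)
    (fun z => (\1_S z)%:E) m (pub0, (false, 0)).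
Proof.
move=> mS; pose phi z : \bar R := (\1_S z)%:E.
have mphi : measurable_fun setT phi.
  by apply: measurableT_comp => //; exact: measurable_indic.
have phi0 z : (0 <= phi z)%E by rewrite lee_fin.
pose V := machine_value live tm nb nh (2 * alpha / 3) xi L (pub_query n F X) phi.
have mproc k := measurable_pub_process X k.
have key j k : (\int[P]_w V j (pub_process W eps delta alpha n F X k w) =
    \int[P]_w phi (pub_process W eps delta alpha n F X (k + j) w).1)%E.
  elim: j k => [|j IH] k; first by rewrite addn0.
  rewrite addnS -addSn -IH; apply/esym.
  apply: (process_integral (proj2 noiseW) _ (measurableT_comp mtm measurable_fst)
    (measurable_pub_step X) lawW _ k (f := V j)).
  - by move=> s; exact: pub_time_ge.
  - by move=> s; exact: machine_value_ge0.
  - exact: measurable_machine_value.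
have := key m 0%N; rewrite add0n /= integral_cst //.
rewrite [X in (_ * X)%E](_ : _ = 1%E); last exact: (probability_setT P).
rewrite mule1 => ->; rewrite /phi.
have mA : measurable [set w | S (pub_process W eps delta alpha n F X m w).1].
  by rewrite -[X in measurable X]setTI; apply: (measurableT_comp measurable_fst (mproc m)).
rewrite -[X in P X]setIT -integral_indic //.
Qed.

(** Beyond [future_cost] there is a reserve for the current query, which may complete two instances,
    or one more in phase 2. It is needed because the hard bound is checked only after both
    submissions, so the query on which the mechanism halts also spends privacy. *)
Definition pub_potential (z : Z) : R :=
  if live z then
    budget_unit N n alpha eps delta * (future_cost N n alpha (phard z) (tm z) +
      (if pphase z == 2%N then 1 else 2) / (tm z)%:R)
  else 0.

Let bu_ge0 : 0 <= budget_unit N n alpha eps delta.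
Proof. exact: budget_unit_ge0. Qed.

Let tmR (z : Z) : (0 : R) < (tm z)%:R.
Proof. by rewrite ltr0n pub_time_gt0. Qed.

Lemma pub_potential_ge0 z : 0 <= pub_potential z.
Proof.
rewrite /pub_potential; case: ifP => // _; rewrite mulr_ge0 // addr_ge0 ?future_cost_ge0 //.
by rewrite divr_ge0 //; case: ifP.
Qed.

Lemma pub_time_rcons (z z' : Z) a : live z -> live z' -> ph z' = rcons (ph z) a ->
  (tm z <= tm z')%N.
Proof.
rewrite /pub_live /pub_time => /andP[_ lz] /andP[_ lz'] hz; rewrite hz in lz' *.
case Fh' : (arrival F (rcons (ph z) a)) lz' => [t'|//] _.
case: streamF => _ _ /(_ _ _ _ Fh') [t -> tt'] _ _.
by [].
Qed.

Lemma pub_hard_live z a : live z -> live (pub_hard alpha n F z a) ->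
  [/\ (tm z <= tm (pub_hard alpha n F z a))%N, phard (pub_hard alpha n F z a) = (phard z).+1,
      pphase (pub_hard alpha n F z a) = 0%N &
      (phard z).+1%:R <= hard_bound (N := N) alpha n (tm z)].
Proof.
move=> lz; rewrite /pub_hard; case: ltP => [//|h] lz'.
by split => //; exact: (@pub_time_rcons _ _ a).
Qed.

Lemma pub_hard_cost z a : live z -> live (pub_hard alpha n F z a) ->
  future_cost N n alpha (phard (pub_hard alpha n F z a)) (tm (pub_hard alpha n F z a))
  <= future_cost N n alpha (phard z) (tm z) - 2 / (tm z)%:R.
Proof.
move=> lz lz'; have [tt -> _ h] := pub_hard_live lz lz'.
rewrite -future_cost_hard ?pub_time_ge //.
by apply: le_future_cost => //; exact: pub_time_ge.
Qed.

Let le_inv_tm (z z' : Z) (c : R) : 0 <= c -> (tm z <= tm z')%N -> c / (tm z')%:R <= c / (tm z)%:R.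
Proof. by move=> c0 h; rewrite ler_wpM2l // lef_pV2 ?posrE ?tmR // ler_nat. Qed.

Let inv_tm_split (z : Z) : 2 / (tm z)%:R = 1 / (tm z)%:R + 1 / (tm z)%:R :> R.
Proof. by rewrite -mulrDl. Qed.

(** The only answer ⊥ that raises the hard count is the one to [g2] after a real answer to [g1]; the
    [2 / t] thus released refills the reserve for the next query. *)
Lemma pub_potential_bot z : live z -> pub_potential (nb z) <= pub_potential z.
Proof.
move=> lz; have [lz'|lz'] := boolP (live (nb z)); last first.
  by rewrite [leLHS]/pub_potential (negbTE lz') pub_potential_ge0.
rewrite /pub_potential lz lz' ler_wpM2l //; move: lz'; rewrite /pub_bot.
have c0 : 0 <= (1 : R) / (tm z)%:R by rewrite divr_ge0.
case: eqP => [p0 _|_]; first by rewrite p0.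
case: eqP => [p1|_] lz'.
  have tt : (tm z <= tm (pub_push n F z (pub_ef n F z) (pub_aged n F z) (phard z)))%N.
    exact: (@pub_time_rcons _ _ (pub_ef n F z)).
  rewrite p1 /=; apply: lerD; last exact: le_inv_tm.
  by apply: le_future_cost => //; exact: pub_time_ge.
have := pub_hard_cost lz lz'; have [tt _ -> _] := pub_hard_live lz lz' => /=.
have := le_inv_tm (ler0n R 2) tt.
have c2 : 1 / (tm z)%:R <= (if pphase z == 2%N then 1 else 2) / (tm z)%:R :> R.
  by rewrite ler_wpM2r ?invr_ge0 //; case: ifP => // _; rewrite ler1n.
set ii := (if _ then _ else _) in c2 *; move: c2 c0.
move: (future_cost _ _ _ _ _) (future_cost _ _ _ _ _) => A B.
by move: (_^-1) (_^-1) => x y; lra.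
Qed.

Lemma theta_sqr z : (9 / 8 * theta tm xi z) ^+ 2 = budget_unit N n alpha eps delta / (tm z)%:R.
Proof. by rewrite /theta theta_budget_unit // pub_time_ge. Qed.

(** In phase 0 the reserve drops from 2 to 1 and pays for the new instance. Otherwise the query is
    hard: the [2 / t] it releases and the reserve left cover the next reserve and the new
    instance. *)
Lemma pub_potential_real z a : live z -> live (nh z a) ->
  pub_potential (nh z a) + (9 / 8 * theta tm xi (nh z a)) ^+ 2 <= pub_potential z.
Proof.
move=> lz lz'; rewrite theta_sqr /pub_potential lz lz' -mulrDr ler_wpM2l //.
move: lz'; rewrite /pub_real.
have c0 : 0 <= (1 : R) / (tm z)%:R by rewrite divr_ge0.
have h2 := inv_tm_split z.
case: eqP => [p0 _|p0].
  rewrite p0 /= [tm (pub_put _ _ _)]/(tm z) h2 mul1r; lra.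
have aux b : live (pub_hard alpha n F z b) ->
    let z' := pub_hard alpha n F z b in
    future_cost N n alpha (phard z') (tm z') + (if pphase z' == 2%N then 1 else 2) / (tm z')%:R
      + (tm z')%:R^-1 <= future_cost N n alpha (phard z) (tm z) + 1 / (tm z)%:R.
  move=> lz' /=; have := pub_hard_cost lz lz'; have [tt _ -> _] := pub_hard_live lz lz' => /=.
  have := le_inv_tm (ler0n R 1) tt.
  move: (future_cost _ _ _ _ _) (future_cost _ _ _ _ _) => A B.
  by move: (_^-1) (_^-1) => x y; lra.
have c2 : 1 / (tm z)%:R <= (if pphase z == 2%N then 1 else 2) / (tm z)%:R :> R.
  by rewrite ler_wpM2r ?invr_ge0 //; case: ifP => // _; rewrite ler1n.
by case: ifP => _ lz'; apply: le_trans (aux _ lz') _; rewrite lerD2l.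
Qed.

Lemma pub_process_dp X X' (S : set Z) m : alpha <= 1 ->
  neighboring_streams n X X' -> measurable S ->
  (P [set w | S (pub_process W eps delta alpha n F X m w).1] <=
   (expR eps)%:E * P [set w | S (pub_process W eps delta alpha n F X' m w).1] + delta%:E)%E.
Proof.
move=> alpha1 XX' mS; rewrite (pub_process_value X m mS) (pub_process_value X' m mS).
have /andP[e0 e1] := eps01; have /andP[d0 _] := delta0e.
have l1 := ln_inv_delta_gt1 delta0e.
(* With this [a] the exponent is at most [- 4 * l + eps + 2 * l], which is at most [- l] because
   [eps <= 1 < l]. *)
set l := ln (1 / delta) in l1; pose a := 4 * l / eps.
have a1 : 1 <= a by rewrite ler_pdivlMr // mul1r; lra.
have h := machine_value_dp (2 * alpha / 3) mlive mtm mnb mnh pub_time_gt0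
  (fun z => pmwg_xi_gt0 (pub_time_ge z)) lawL _ (mg X) (mg X') _ mS
  pub_potential_ge0 pub_potential_bot pub_potential_real a1 m pub0 eps.
apply: (le_trans (h _ _)) => {h}.
- move=> z lz lz'.
  have th0 z' : 0 <= theta tm xi z'.
    by apply: divr_ge0 => //; apply/ltW/pmwg_xi_gt0; exact: pub_time_ge.
  have tt : (tm z <= tm (nb z))%N.
    move: lz'; rewrite /pub_bot; case: ifP => // _; case: ifP => _ lz'.
      exact: (@pub_time_rcons _ _ (pub_ef n F z)).
    by have [] := pub_hard_live lz lz'.
  have sq : (9 / 8 * theta tm xi (nb z)) ^+ 2 <= (9 / 8 * theta tm xi z) ^+ 2.
    by rewrite !theta_sqr ler_wpM2l // lef_pV2 ?posrE ?tmR // ler_nat.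
  have := th0 z; have := th0 (nb z); move: (theta _ _ _) (theta _ _ _) sq => x y sq x0 y0.
  by move: sq; rewrite ler_sqr ?nnegrE; lra.
- move=> z lz; rewrite /pub_query.
  have lf : is_linear_query (query F (ph z)) by case: streamF => h _ _ _ _.
  have := eval_neighboring_streams lf XX' (pub_time_ge z).
  case: ifP => _ hh; last rewrite distrC.
    by rewrite (_ : _ - _ = Defs.eval (query F (ph z)) (X (tm z)) - Defs.eval (query F (ph z)) (X' (tm z))) //; ring.
  by rewrite (_ : _ - _ = Defs.eval (query F (ph z)) (X (tm z)) - Defs.eval (query F (ph z)) (X' (tm z))) //; ring.
apply: leeD => //; rewrite lee_fin.
set B := (if _ then _ else _).
have Bl : B <= eps ^+ 2 / (12 * l).
  rewrite /B; case: ifP => [/andP[_ lz]|_]; last by rewrite divr_ge0 ?sqr_ge0 //; lra.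
  rewrite theta_sqr /pub_potential lz /=.
  apply: le_trans (initial_budget N_ge3 n_ge17 alpha_gt0 alpha1 eps delta0e (pub_time_ge pub0)).
  by rewrite le_eqVlt; apply/orP; left; apply/eqP; ring.
have -> : delta = expR (- l) by rewrite expRN lnK ?posrE ?divr_gt0 // div1r invrK.
rewrite ler_expR.
have aB : 3 / 2 * a ^+ 2 * B <= 2 * l.
  have -> : 2 * l = 3 / 2 * a ^+ 2 * (eps ^+ 2 / (12 * l)).
    by rewrite /a; field; rewrite !gt_eqF //; lra.
  by rewrite ler_wpM2l // mulr_ge0 ?sqr_ge0.
have : a * eps = 4 * l by rewrite /a divfK // gt_eqF.
lra.
Qed.

End PublicPrivacy.

(** * From finitely many answers to transcripts *)

Section SigmaApproximation.
Context {R : realType} {d : measure_display} {Omega : measurableType d}.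
Variables (P : probability Omega R) (T : Type) (f : bool -> Omega -> T).
Variables (gen A : set (set T)).
Hypothesis genA : gen `<=` A.
Hypothesis mA : forall C, A C -> forall b, measurable (f b @^-1` C).
Hypothesis A0 : A set0.
Hypothesis AC : forall C, A C -> A (~` C).
Hypothesis AU : forall C D, A C -> A D -> A (C `|` D).

Let diff (S C : set T) := (S `\` C) `|` (C `\` S).

(** One [C] must serve for both values of [b], since the privacy inequality compares two laws on the
    same event. *)
Definition approximable (S : set T) := (forall b, measurable (f b @^-1` S)) /\
  forall e : R, 0 < e -> exists2 C, A C & forall b,
    (P (f b @^-1` ((S `\` C) `|` (C `\` S))) <= e%:E)%E.

Let mdiff S C b : measurable (f b @^-1` S) -> measurable (f b @^-1` C) ->
  measurable (f b @^-1` (diff S C)).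
Proof. by move=> mS mC; exact: (measurableU _ _ (measurableD mS mC) (measurableD mC mS)). Qed.

Lemma approximable_setC S : approximable S -> approximable (~` S).
Proof.
move=> [mS aS]; split; first by move=> b; rewrite preimage_setC; exact: (measurableC (mS b)).
move=> e /aS[C AsC h]; exists (~` C); first exact: AC.
by move=> b; rewrite !setDE !setCK setUC ![~` _ `&` _]setIC -!setDE.
Qed.

Lemma approximable_setU S S' : approximable S -> approximable S' -> approximable (S `|` S').
Proof.
move=> [mS aS] [mS' aS']; split; first by move=> b; exact: (measurableU _ _ (mS b) (mS' b)).
move=> e e0; have e2 : 0 < e / 2 by rewrite divr_gt0.
have [C AsC hC] := aS _ e2; have [C' AsC' hC'] := aS' _ e2.
exists (C `|` C'); first exact: AU.
move=> b; have -> : e%:E = ((e / 2)%:E + (e / 2)%:E)%E by rewrite -EFinD -splitr.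
apply: le_trans (leeD (hC b) (hC' b)).
apply: le_trans (measureU2 _ (mdiff (mS b) (mA AsC b)) (mdiff (mS' b) (mA AsC' b))).
have mSS : measurable (f b @^-1` (S `|` S')) by exact: (measurableU _ _ (mS b) (mS' b)).
have mCC : measurable (f b @^-1` (C `|` C')) by apply: mA; exact: AU.
apply: le_measure; rewrite ?inE; first exact: mdiff.
  by apply: measurableU; apply: mdiff => //; exact: mA.
by move=> w /=; rewrite /diff /=; tauto.
Qed.

(** Half of the error cuts the union to finitely many sets, the remainder being small for both laws
    by continuity from above; the other half approximates the finite union. *)
Lemma approximable_bigcup (S : nat -> set T) :
  (forall i, approximable (S i)) -> approximable (\bigcup_i S i).
Proof.
move=> aS; pose U n := \big[setU/set0]_(i < n) S i.
have aU n : approximable (U n).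
  rewrite /U; elim: n => [|n IH]; last by rewrite big_ord_recr; exact: approximable_setU.
  rewrite big_ord0; split; first by move=> b; exact: mA.
  move=> e e0; exists set0 => // b.
  by rewrite setD0 setU0 preimage_set0 measure0 lee_fin ltW.
have mB b : measurable (f b @^-1` \bigcup_i S i).
  by rewrite preimage_bigcup; apply: bigcupT_measurable => i; case: (aS i).
split=> // e e0; have e2 : 0 < e / 2 by rewrite divr_gt0.
pose D b n := f b @^-1` (\bigcup_i S i) `\` f b @^-1` (U n).
have mD b n : measurable (D b n) by apply: measurableD => //; case: (aU n).
have niD b : nonincreasing_seq (D b).
  move=> m n mn; apply/subsetPset => w [h1 h2]; split => //; apply: contra_not h2.
  by rewrite /U /= -!bigcup_mkord => -[i im Si]; exists i => //; exact: leq_trans mn.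
have D0 b : \bigcap_n D b n = set0.
  apply/seteqP; split => // w h; have [[i _ Si] _] := h 0%N I.
  have [_] := h i.+1 I; apply; rewrite /U /= -bigcup_mkord; exists i => //=.
have small b : exists n, (P (D b n) <= (e / 2)%:E)%E.
  have cv : P \o D b @ \oo --> P (\bigcap_n D b n).
    apply: nonincreasing_cvg_mu => //; last by rewrite D0.
    by apply: le_lt_trans (probability_le1 P (mD b 0%N)) _; rewrite ltry.
  rewrite D0 measure0 in cv.
  apply: contrapT => /forallNP h.
  have : ((e / 2)%:E <= limn (P \o D b))%E.
    apply: lime_ge; first by apply/cvg_ex; exists 0%E.
    by apply: nearW => n; rewrite ltW // ltNge; apply/negP; exact: h.
  by rewrite (cvg_lim _ cv) // lee_fin leNgt e2.
have [n1 h1] := small true; have [n2 h2] := small false.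
pose n := maxn n1 n2.
have hn b : (P (D b n) <= (e / 2)%:E)%E.
  case: b; [apply: le_trans h1|apply: le_trans h2]; apply: le_measure; rewrite ?inE //;
    apply/subsetPset/niD; rewrite /n; [exact: leq_maxl|exact: leq_maxr].
have [mUn /(_ _ e2)[C AsC hC]] := aU n.
exists C => // b; have -> : e%:E = ((e / 2)%:E + (e / 2)%:E)%E by rewrite -EFinD -splitr.
apply: le_trans (leeD (hn b) (hC b)).
have mdC := mdiff (mUn b) (mA AsC b).
apply: le_trans (measureU2 _ (mD b n) mdC).
have US : U n `<=` \bigcup_i S i.
  by rewrite /U -bigcup_mkord => x [i _ Si]; exists i.
apply: le_measure; rewrite ?inE; first exact: mdiff (mB b) (mA AsC b).
  exact: (measurableU _ _ (mD b n) mdC).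
move=> w [[Sw nC]|[Cw nS]].
  have [Uw|nU] := pselect (U n (f b w)); first by right; left.
  by left.
by right; right; split => //; apply: contra_not nS; exact: US.
Qed.

Lemma approximable_sigma S : <<s gen >> S -> approximable S.
Proof.
move=> gS; apply: (gS approximable); split; last first.
  move=> C /genA AsC; split; first exact: mA.
  by move=> e e0; exists C => // b; rewrite !setDv setU0 preimage_set0 measure0 lee_fin ltW.
split.
- split; first by move=> b; exact: mA.
  by move=> e e0; exists set0 => // b; rewrite setD0 setU0 preimage_set0 measure0 lee_fin ltW.
- by move=> C aC; rewrite setTD; exact: approximable_setC.
- exact: approximable_bigcup.
Qed.

(** Replacing [S] by [C] costs [e / (K + 1)] on the left and [K] times as much on the right, [e] in
    total. *)
Lemma sigma_dp (K delta : R) S : 0 <= K ->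
  (forall C, A C -> (P (f true @^-1` C) <= K%:E * P (f false @^-1` C) + delta%:E)%E) ->
  <<s gen >> S -> (P (f true @^-1` S) <= K%:E * P (f false @^-1` S) + delta%:E)%E.
Proof.
move=> K0 dpA /approximable_sigma[mS aS]; apply/lee_addgt0Pr => e e0.
have e' : 0 < e / (K + 1) by rewrite divr_gt0 //; lra.
have [C AsC hC] := aS _ e'.
have mC := mA AsC.
have up b S1 S2 : measurable (f b @^-1` S1) -> measurable (f b @^-1` S2) ->
    (P (f b @^-1` (diff S1 S2)) <= (e / (K + 1))%:E)%E ->
    (P (f b @^-1` S1) <= P (f b @^-1` S2) + (e / (K + 1))%:E)%E.
  move=> m1 m2 h; apply: le_trans (leeD (lexx _) h).
  apply: le_trans (measureU2 _ m2 (mdiff m1 m2)).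
  apply: le_measure; rewrite ?inE //; first exact: (measurableU _ _ m2 (mdiff m1 m2)).
  move=> w S1w; have [S2w|n2] := pselect (S2 (f b w)); first by left.
  by right; left.
have u1 := up true _ _ (mS true) (mC true) (hC true).
have u2 : (P (f false @^-1` C) <= P (f false @^-1` S) + (e / (K + 1))%:E)%E.
  by apply: up => //; rewrite /diff setUC; exact: hC.
apply: (le_trans u1); apply: (le_trans (leeD (dpA _ AsC) (lexx _))).
apply: (@le_trans _ _ (K%:E * (P (f false @^-1` S) + (e / (K + 1))%:E) + delta%:E + (e / (K + 1))%:E)%E).
  by rewrite !leeD2r // lee_wpmul2l // lee_fin.
rewrite ge0_muleDr // ?lee_fin ?(ltW e') //.
have : P (f false @^-1` S) \is a fin_num by rewrite fin_num_measure.
move: (P _) => [p| |] // _; rewrite -!EFinM -!EFinD lee_fin.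
have : K * (e / (K + 1)) + e / (K + 1) = e by field; rewrite gt_eqF //; lra.
lra.
Qed.

End SigmaApproximation.

(** * Privacy of transcripts *)

Section TranscriptPrivacy.
Context {R : realType} {N : nat} {d : measure_display} {Omega : measurableType d}.
Variables (P : probability Omega R) (W : noise_kind -> nat -> nat -> {RV P >-> R}).
Variables (eps delta alpha : R) (n : nat) (F : query_stream R N).
Hypothesis N_ge3 : (3 <= N)%N.
Hypothesis n_ge17 : (17 <= n)%N.
Hypothesis eps01 : 0 < eps <= 1.
Hypothesis delta0e : 0 < delta < expR (-1).
Hypothesis alpha_gt0 : 0 < alpha.
Hypothesis alpha_le1 : alpha <= 1.
Hypothesis noiseW : is_noise (pmwg_xi (N := N) eps delta alpha n) n W.
Hypothesis streamF : is_query_stream n F.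
Local Notation Z := (mpub R N).

(** Measurability is asked on public states, where probabilities are computed; the history, read by
    [onth], stands for the transcript. *)
Definition cylinder (C : set (transcript R)) :=
  (exists M, forall tau tau' : transcript R,
     (forall k, (k < M)%N -> tau k = tau' k) -> C tau -> C tau') /\
  measurable [set z : Z | C (onth (ph z))].

Lemma cylinder_setC C : cylinder C -> cylinder (~` C).
Proof.
move=> [[M hM] mC]; split; last exact: (measurableC mC).
exists M => tau tau' e; apply: contra_not; apply: hM => k kM.
by rewrite e.
Qed.

Lemma cylinder_setU C D : cylinder C -> cylinder D -> cylinder (C `|` D).
Proof.
move=> [[M hM] mC] [[M' hM'] mD]; split; last exact: (measurableU _ _ mC mD).
exists (maxn M M') => tau tau' e [Ct|Dt]; [left; apply: (hM tau)|right; apply: (hM' tau)] => // k kM.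
  by apply: e; rewrite leq_max kM.
by apply: e; rewrite leq_max kM orbT.
Qed.

Lemma pmwg_cylinder C : cylinder C -> exists M, forall X,
  (fun w => pmwg eps delta alpha n (fun c t m => W c t m w) X F) @^-1` C =
  [set w | [set z : Z | C (onth (ph z))] (pub_process W eps delta alpha n F X M w).1].
Proof.
move=> [[M hM] _]; exists M.*2 => X.
have e w k : (k < M)%N -> pmwg eps delta alpha n (fun c t m => W c t m w) X F k =
    onth (ph (pub_process W eps delta alpha n F X M.*2 w).1) k by exact: pmwg_process.
apply/seteqP; split => w /=; apply: hM => k kM; [exact: e|exact/esym/e].
Qed.

Lemma measurable_pmwg_cylinder X C : cylinder C ->
  measurable ((fun w => pmwg eps delta alpha n (fun c t m => W c t m w) X F) @^-1` C).
Proof.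
move=> cC; have [M ->] := pmwg_cylinder cC.
case: cC => _ mC; rewrite -[X in measurable X]setTI.
by apply: (measurableT_comp measurable_fst (measurable_pub_process _ _ _ _ _ _ _)) => //.
Qed.

Lemma pmwg_differentially_private : differentially_private P n eps delta
  (fun X w => pmwg eps delta alpha n (fun c t m => W c t m w) X F).
Proof.
move=> X X' _ _ XX' S.
move=> mS; pose f (b : bool) w :=
  pmwg eps delta alpha n (fun c t m => W c t m w) (if b then X else X') F.
apply: (@sigma_dp _ _ _ P _ f _ cylinder _ _ _ _ _ (expR eps) delta S _ _ mS).
- move=> _ [k [B [mB ->]]]; split.
    exists k.+1 => tau tau' e [a ta Ba]; exists a => //.
    by rewrite -e.
  have mid : measurable_fun setT (id : Z -> Z) by exact: measurable_id.
  rewrite (_ : [set _ | _] = [set z : Z | (k < size (ph z))%N] `&` (pub_coord (CNth N k)) @^-1` B).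
    apply: measurableI; rewrite -[X in measurable X]setTI.
      exact: (measurable_size mid measurableT (Y := [set m | (k < m)%N])).
    exact: (measurable_pub_coord (CNth N k)).
  apply/seteqP; split => [z [a za Ba]|z [kz Bz]] /=.
    split; first by rewrite -onthTE za.
    by rewrite /preimage /= -(odflt_onth 0) za.
  exists (nth 0 (ph z) k) => //.
  by rewrite onthE (nth_map 0).
- by move=> C cC b; exact: measurable_pmwg_cylinder.
- split; first by exists 0%N.
  by rewrite (_ : [set _ | _] = set0).
- exact: cylinder_setC.
- exact: cylinder_setU.
- exact: expR_ge0.
- move=> C cC; rewrite /f.
  have [M fE] := pmwg_cylinder cC; rewrite !fE.
  by case: cC => _ mC; apply: pub_process_dp.
Qed.

End TranscriptPrivacy.

(** * Accuracy *)

Section Potential.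
Context {R : realType} {N : nat}.
Implicit Types x y r : 'I_N -> R.

Definition is_distribution x := (forall i, 0 <= x i) /\ \sum_i x i = 1.
Definition is_positive_distribution y := (forall i, 0 < y i) /\ \sum_i y i = 1.

(** It differs from the relative entropy by the entropy of [x], which updates of [y] do not touch,
    and it takes logarithms of the positive [y i] only. *)
Definition cross_entropy x y : R := - \sum_i x i * ln (y i).

Lemma database_distribution t x : (0 < t)%N -> is_database t x -> is_distribution x.
Proof.
move=> t0 [c [ct xc]]; split; first by move=> i; rewrite xc divr_ge0.
under eq_bigr do rewrite xc.
by rewrite -mulr_suml -natr_sum ct divff // pnatr_eq0 -lt0n.
Qed.

Lemma cross_entropy_ge0 x y : is_distribution x -> is_positive_distribution y ->
  0 <= cross_entropy x y.
Proof.
move=> [x0 _] [y0 y1]; rewrite /cross_entropy -sumrN; apply: sumr_ge0 => i _.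
rewrite -mulrN mulr_ge0 // oppr_ge0 ln_le0 // -y1 (bigD1 i) //= lerDl.
by apply: sumr_ge0 => j _; exact: ltW.
Qed.

Lemma uniform_positive_distribution : (0 < N)%N ->
  is_positive_distribution ((fun=> 1 / N%:R) : 'I_N -> R).
Proof.
move=> N0; split; first by move=> i; rewrite divr_gt0 // ltr0n.
by rewrite sumr_const card_ord -[_ *+ _]mulr_natr divfK // pnatr_eq0 -lt0n.
Qed.

Lemma cross_entropy_uniform x : (0 < N)%N -> is_distribution x ->
  cross_entropy x (fun=> 1 / N%:R) = ln N%:R.
Proof.
move=> N0 [_ x1]; rewrite /cross_entropy -mulr_suml x1 mul1r div1r lnV ?opprK //.
by rewrite posrE ltr0n.
Qed.

Lemma expRN_le z : 0 <= z -> expR (- z) <= 1 - z + z ^+ 2 :> R.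
Proof.
move=> z0; have h := expR_ge1Dx z; have e0 := expR_gt0 z.
rewrite expRN -[leLHS]mul1r ler_pdivrMr //.
have : (1 - z + z ^+ 2) * (1 + z) <= (1 - z + z ^+ 2) * expR z by rewrite ler_wpM2l //; nra.
apply: le_trans; nra.
Qed.

Section Update.
Variables (alpha : R) (x r y : 'I_N -> R).
Hypothesis alpha_gt0 : 0 < alpha.
Hypothesis dx : is_distribution x.
Hypothesis dy : is_positive_distribution y.
Hypothesis lr : is_linear_query r.

Let S : R := \sum_i y i * expR (- (alpha * r i / 6)).

Let S_gt0 : 0 < S.
Proof.
have [y0 y1] := dy; case: (posnP N) => [N0|N0].
  move: y1; rewrite big1; first by move=> /eqP; rewrite eq_sym oner_eq0.
  by move=> i _; have := ltn_ord i; rewrite {2}N0.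
rewrite /S (bigD1 (Ordinal N0)) //= ltr_wpDr ?mulr_gt0 ?expR_gt0 //.
by apply: sumr_ge0 => i _; rewrite mulr_ge0 ?expR_ge0 // ltW.
Qed.

Lemma mw_update_positive_distribution : is_positive_distribution (mw_update alpha r y).
Proof.
have [y0 _] := dy; split.
  by move=> i; rewrite divr_gt0 // mulr_gt0 // expR_gt0.
by rewrite /mw_update -mulr_suml divff // gt_eqF.
Qed.

(** The normalization enters through [ln S <= S - 1], with [S] expanded to second order by
    [expRN_le]. At a gap of [alpha / 3] the linear term is [- alpha ^+ 2 / 18], which leaves a net
    drop of [alpha ^+ 2 / 36]. *)
Lemma cross_entropy_mw_update :
  cross_entropy x (mw_update alpha r y) <=
  cross_entropy x y + alpha / 6 * (Defs.eval r x - Defs.eval r y) + alpha ^+ 2 / 36.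
Proof.
have [x0 x1] := dx; have [y0 y1] := dy.
have lnE i : ln (mw_update alpha r y i) = ln (y i) - alpha * r i / 6 - ln S.
  by rewrite /mw_update -/S ln_div ?lnM ?posrE ?expR_gt0 ?mulr_gt0 ?expR_gt0 // expRK.
have -> : cross_entropy x (mw_update alpha r y) =
    cross_entropy x y + alpha / 6 * Defs.eval r x + ln S.
  rewrite /cross_entropy; under eq_bigr do rewrite lnE.
  rewrite -[ln S in RHS]mul1r -x1 /Defs.eval mulr_sumr mulr_suml -!sumrN -!big_split /=.
  by apply: eq_bigr => i _; ring.
have : ln S <= S - 1.
  have -> : ln S = ln (1 + (S - 1)) by rewrite subrKC.
  by apply: le_ln1Dx; have := S_gt0; lra.
have : S <= 1 - alpha / 6 * Defs.eval r y + alpha ^+ 2 / 36.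
  have -> : 1 - alpha / 6 * Defs.eval r y + alpha ^+ 2 / 36 =
     \sum_i y i * (1 - alpha / 6 * r i + alpha ^+ 2 / 36).
    rewrite -[X in X - _ + _]y1 -[alpha ^+ 2 / 36 in LHS]mul1r -[X in _ + X * _]y1.
    rewrite /Defs.eval mulr_sumr mulr_suml -sumrN -!big_split /=.
    by apply: eq_bigr => i _; ring.
  apply: ler_sum => i _; rewrite ler_wpM2l //; first exact: ltW.
  have /andP[r0 r1] := lr i.
  have z0 : 0 <= alpha * r i / 6 by rewrite divr_ge0 // mulr_ge0 // ltW.
  apply: le_trans (expRN_le z0) _.
  have -> : alpha ^+ 2 / 36 = (alpha / 6) ^+ 2 by field.
  have -> : alpha * r i / 6 = alpha / 6 * r i by ring.
  rewrite lerD2l // exprMn -[leRHS]mulr1 ler_wpM2l ?sqr_ge0 // expr_le1 //.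
rewrite mulrBr; lra.
Qed.

End Update.

Lemma age_le t0 t y : (t0 <= t)%N -> (0 < t)%N ->
  age (Some t0) t y = fun i => t0%:R / t%:R * y i + (t - t0)%:R / t%:R * (1 / N%:R).
Proof.
rewrite /age leq_eqVlt => /predU1P[<-|-> //] t0_gt0.
by apply/funext => i; rewrite ltnn subnn !mul0r addr0 divff ?mul1r // pnatr_eq0 -lt0n.
Qed.

Lemma age_positive_distribution t0 t y : (0 < N)%N -> (0 < t0)%N -> (t0 <= t)%N ->
  is_positive_distribution y -> is_positive_distribution (age (Some t0) t y).
Proof.
move=> N0 t00 t0t [y0 y1]; have t_gt0 : (0 < t)%N by apply: leq_trans t0t.
have tR : (0 : R) < t%:R by rewrite ltr0n.
have NR : (0 : R) < N%:R by rewrite ltr0n.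
rewrite age_le //; split.
  move=> i; apply: ltr_wpDr; first by rewrite mulr_ge0 ?divr_ge0.
  by rewrite mulr_gt0 // divr_gt0 // ltr0n.
rewrite big_split /= -mulr_sumr y1 sumr_const card_ord -[_ *+ _]mulr_natr natrB //.
by field; rewrite !gt_eqF.
Qed.

(** Ageing over several sizes amounts to adding one uniform entry per size, so the potential can be
    followed size by size although [age] acts only when a query arrives. *)
Lemma ageS t0 t y : (0 < t)%N -> (t0 <= t)%N ->
  age (Some t0) t.+1 y = fun i => (t%:R * age (Some t0) t y i + 1 / N%:R) / t.+1%:R.
Proof.
move=> t_gt0 t0t; rewrite !age_le ?leqW //; apply/funext => i.
have tR : (t%:R : R) != 0 by rewrite pnatr_eq0 -lt0n.
have tR1 : (t.+1%:R : R) != 0 by rewrite pnatr_eq0.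
rewrite subSn // -[(t - t0).+1%:R]natr1 natrB //.
move: (y i) (1 / N%:R : R) => a b.
by move: (t.+1%:R : R) tR1 => s s0; field; apply/andP.
Qed.

(** The old entries have weight [t / t.+1] and lose at most [ln (t.+1 / t)], as [y] is scaled by
    [t / t.+1]. The new entry has weight [1 / t.+1] and costs at most [ln (N * t.+1)], thanks to the
    uniform part mixed into [y]. Together these losses make exactly [pmwg_b t.+1]. *)
Lemma cross_entropy_add_entry t x x' y : (0 < N)%N -> (0 < t)%N ->
  is_distribution x -> is_positive_distribution y -> adds_entry t x x' ->
  cross_entropy x' (fun i => (t%:R * y i + 1 / N%:R) / t.+1%:R) <=
  cross_entropy x y + pmwg_b (N := N) t.+1.
Proof.
move=> N0 t_gt0 dx dy [j xj]; have [x0 x1] := dx; have [y0 y1] := dy.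
have ce0 := cross_entropy_ge0 dx dy.
have NR : (0 : R) < N%:R by rewrite ltr0n.
have tR : (0 : R) < t%:R by rewrite ltr0n.
have tR1 : (0 : R) < t.+1%:R by rewrite ltr0n.
have tS : t.+1%:R = t%:R + 1 :> R by rewrite natr1.
set a : R := ln (t.+1%:R / t%:R).
have lt : ln (t.+1%:R : R) = ln t%:R + a by rewrite /a ln_div ?posrE // subrKC.
pose y' i : R := (t%:R * y i + 1 / N%:R) / t.+1%:R.
have y'1 i : ln (y i) - a <= ln (y' i).
  rewrite /a -ln_div ?posrE ?divr_gt0 // ler_ln ?posrE ?divr_gt0 ?addr_gt0 ?mulr_gt0 ?invr_gt0 //.
  have -> : y i / (t.+1%:R / t%:R) = (t%:R * y i) / t.+1%:R by field; rewrite !gt_eqF.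
  by rewrite ler_pM2r ?invr_gt0 // lerDl divr_ge0 // ltW.
have y'2 : - (ln N%:R + ln t.+1%:R) <= ln (y' j).
  rewrite -lnM ?posrE // -lnV ?posrE ?mulr_gt0 // ler_ln ?posrE //
    ?invr_gt0 ?mulr_gt0 ?divr_gt0 ?addr_gt0 ?mulr_gt0 ?invr_gt0 //.
  by rewrite invfM /y' ler_pM2r ?invr_gt0 // div1r lerDr mulr_ge0 // ltW.
rewrite -[X in X <= _]/(cross_entropy x' y').
have -> : cross_entropy x' y' = (t%:R * - (\sum_i x i * ln (y' i)) - ln (y' j)) / t.+1%:R.
  have -> : cross_entropy x' y' = - ((t%:R * \sum_i x i * ln (y' i) + ln (y' j)) / t.+1%:R).
    rewrite /cross_entropy; congr (- _).
    have -> : ln (y' j) = \sum_i (i == j)%:R * ln (y' i).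
      by rewrite (bigD1 j) //= eqxx mul1r big1 ?addr0 // => i /negbTE ->; rewrite mul0r.
    rewrite mulr_sumr -big_split /= mulr_suml; apply: eq_bigr => i _.
    by rewrite xj; ring.
  by rewrite mulrN -opprD mulNr.
have s1 : - (\sum_i x i * ln (y' i)) <= cross_entropy x y + a.
  rewrite /cross_entropy -[a]mul1r -x1 mulr_suml -!sumrN -big_split /=.
  apply: ler_sum => i _; have : x i * (ln (y i) - a) <= x i * ln (y' i) by rewrite ler_wpM2l.
  rewrite mulrBr; lra.
apply: (@le_trans _ _ ((t%:R * (cross_entropy x y + a) + (ln N%:R + ln t.+1%:R)) / t.+1%:R)).
  rewrite ler_pM2r ?invr_gt0 //; apply: lerD; last by rewrite lerNl.
  by rewrite ler_pM2l.
rewrite ler_pdivrMr // lt /pmwg_b /= -/a mulrDl.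
have -> : (ln N%:R / t.+1%:R + ln t%:R / t.+1%:R + a) * t.+1%:R =
   ln N%:R + ln t%:R + a * t.+1%:R :> R by field; rewrite gt_eqF.
rewrite tS; nra.
Qed.

Lemma cross_entropy_age n X t0 t y : (0 < N)%N -> (0 < n)%N ->
  is_database_stream n X -> (n <= t0)%N -> (t0 <= t)%N -> is_positive_distribution y ->
  cross_entropy (X t) (age (Some t0) t y) <=
  cross_entropy (X t0) y + \sum_(t0.+1 <= tau < t.+1) pmwg_b (N := N) tau.
Proof.
move=> N0 n0 dbX nt0 + dy; elim: t => [|t IH].
  by rewrite leqn0 => /eqP t00; move: nt0; rewrite t00 leqNgt n0.
have t0_gt0 := leq_trans n0 nt0.
rewrite leq_eqVlt => /predU1P[<-|].
  by rewrite /age ltnn big_geq // addr0.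
rewrite ltnS => t0t; have t_gt0 := leq_trans t0_gt0 t0t.
have nt := leq_trans nt0 t0t; have [dbt at'] := dbX _ nt.
rewrite ageS // big_nat_recr //= addrA.
apply: le_trans (cross_entropy_add_entry N0 t_gt0 (database_distribution t_gt0 dbt)
  (age_positive_distribution N0 t0_gt0 t0t dy) at') _.
by rewrite lerD2r; exact: IH.
Qed.

End Potential.

(** * Runs with small noise *)

Section GoodNoise.
Context {R : realType} {N : nat}.
Variables (eps delta alpha : R) (n : nat) (F : query_stream R N) (X : nat -> 'I_N -> R).
Variable (w : noise_kind -> nat -> nat -> R).
Local Notation xi := (pmwg_xi (N := N) eps delta alpha n).
Hypothesis N_ge3 : (3 <= N)%N.
Hypothesis n_ge17 : (17 <= n)%N.
Hypothesis alpha_gt0 : 0 < alpha.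
Hypothesis xi_gt0 : forall t, (n <= t)%N -> 0 < xi t.
Hypothesis xi_le : forall t t', (n <= t)%N -> (t <= t')%N -> xi t <= xi t'.
Hypothesis dbX : is_database_stream n X.
Hypothesis streamF : is_query_stream n F.

Definition small_noise (t m : nat) :=
  [/\ `|w Eta t m| < alpha / 6 * xi t, `|w Nu t m| < alpha / 6 & `|w Ans t m| < alpha / 6].

Definition good_threshold (t : nat) (s : option R) :=
  if s is Some eta then `|eta| < alpha / 6 * xi t else true.

(** The two noises in the comparison move the threshold [2 * alpha / 3] by less than [alpha / 3]
    altogether. *)
Lemma nsg_accurate t m (g : ('I_N -> R) -> R) s : (n <= t)%N ->
  small_noise t m -> good_threshold t s ->
  let: (a, s') := nsg (2 * alpha / 3) xi w (X t) t m g s in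
  good_threshold t s' /\
  if a is Some b then alpha / 3 <= g (X t) /\ `|b - g (X t)| < alpha / 6
  else g (X t) <= alpha.
Proof.
move=> nt [hE hN hA] gs; rewrite /nsg.
have ge : `|odflt (w Eta t m) s| < alpha / 6 * xi t by case: s gs.
set eta := odflt _ _ in ge *.
have x0 := xi_gt0 nt.
have : `|eta / xi t| < alpha / 6.
  by rewrite normrM [`|_^-1|]gtr0_norm ?invr_gt0 // ltr_pdivrMr.
rewrite ltr_norml => /andP[e1 e2]; move: hN; rewrite ltr_norml => /andP[n1 n2].
case: ifPn => [h|].
  by split => //; split; [move: h e1 e2 n1 n2; move: (eta / _) => q; lra|rewrite addrC addKr].
rewrite -ltNge => h; split => //.
by move: h e1 e2 n1 n2; move: (eta / _) => q; lra.
Qed.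

(** Each hard query is charged [alpha ^+ 2 / 36] against the cross entropy; as the latter is
    nonnegative, the count cannot exceed [hard_bound]. *)
Definition run_invariant (s : @pmwg_state R N) :=
  if last_time s is Some t0 then
    [/\ (n <= t0)%N, is_positive_distribution (public s),
      cross_entropy (X t0) (public s) + (hard s)%:R * (alpha ^+ 2 / 36)
        <= ln N%:R + \sum_(n.+1 <= tau < t0.+1) pmwg_b (N := N) tau &
      good_threshold t0 (nsg_state s)]
  else [/\ public s = (fun=> 1 / N%:R), hard s = 0%N & nsg_state s = None].

Let n_gt0 : (0 < n)%N. Proof. exact: leq_trans n_ge17. Qed.
Let N_gt0 : (0 < N)%N. Proof. exact: leq_trans N_ge3. Qed.

Let dX t : (n <= t)%N -> is_distribution (X t).
Proof.
move=> nt; apply: (@database_distribution _ _ t); first exact: leq_trans nt.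
by case: (dbX nt).
Qed.

Lemma run_invariant_age s t : run_invariant s -> (n <= t)%N ->
  (forall t0, last_time s = Some t0 -> (t0 <= t)%N) ->
  let y := age (last_time s) t (public s) in
  [/\ is_positive_distribution y,
    cross_entropy (X t) y + (hard s)%:R * (alpha ^+ 2 / 36)
        <= ln N%:R + \sum_(n.+1 <= tau < t.+1) pmwg_b (N := N) tau &
    good_threshold t (nsg_state s)].
Proof.
rewrite /run_invariant; case ls : (last_time s) => [t0|]; last first.
  move=> [-> -> ->] nt _; split => //; first exact: uniform_positive_distribution.
  rewrite /age cross_entropy_uniform //; last exact: dX.
  rewrite mul0r addr0 lerDl big_nat; apply: sumr_ge0 => tau /andP[ntau _].
  by case: tau ntau => // tau ntau; apply: pmwg_b_ge0; exact: leq_trans n_gt0 ntau.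
move=> [nt0 dy ce gt] nt /(_ _ erefl) t0t; have t0_gt0 := leq_trans n_gt0 nt0.
split; first exact: age_positive_distribution.
  rewrite (big_cat_nat (n := t0.+1)) //=.
  have := cross_entropy_age N_gt0 n_gt0 dbX nt0 t0t dy.
  set A := \sum_(_ <= _ < _) _; set B := cross_entropy _ _; lra.
move: gt; rewrite /good_threshold; case: (nsg_state s) => // eta h.
(* The noise of a running instance was bounded at an earlier size; since [xi] is nondecreasing, the
   bound persists. *)
by apply: lt_le_trans h _; rewrite ler_pM2l ?divr_gt0 //; exact: xi_le.
Qed.

Let mw_linear (c1 c2 u q H : R) :
  c1 <= c2 - u + q -> q * 2 <= u -> c1 + (H * q + q) <= c2 + H * q.
Proof. lra. Qed.

Lemma pmwg_step_accurate s t k f : run_invariant s -> (n <= t)%N ->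
  (forall t0, last_time s = Some t0 -> (t0 <= t)%N) -> is_linear_query f ->
  small_noise t k.*2 -> small_noise t k.*2.+1 ->
  exists a s', [/\ pmwg_step eps delta alpha n w (X t) k t f s = (Some a, s'),
    `|Defs.eval f (X t) - a| <= alpha, run_invariant s' & last_time s' = Some t].
Proof.
have a6 : alpha / 6 <= alpha by rewrite ler_pdivrMr ?ler_peMr ?ler1n // ltW.
move=> inv nt lt lf sn1 sn2.
have [dy ce gt] := run_invariant_age inv nt lt.
rewrite /pmwg_step; set y := age (last_time s) t (public s) in dy ce *.
set g1 := (fun z : 'I_N -> R => _ - _); set g2 := (fun z : 'I_N -> R => _ - _).
have := nsg_accurate g1 nt sn1 gt.
case: (nsg _ _ _ _ _ _ g1 _) => a1 s1 [gs1 ha1].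
have := nsg_accurate g2 nt sn2 gs1.
case: (nsg _ _ _ _ _ _ g2 _) => a2 s2 [gs2 ha2].
rewrite /g1 /g2 in ha1 ha2.
have [dx0 dx1] := dX nt; have [dy0 dy1] := dy.
have compl z : \sum_i z i = 1 -> Defs.eval (fun i => 1 - f i) z = 1 - Defs.eval f z.
  move=> z1; rewrite /Defs.eval -[X in _ = X - _]z1 -sumrB.
  by apply: eq_bigr => i _; ring.
have hardP a : let r := if a < Defs.eval f y then f else fun i => 1 - f i in
    `|Defs.eval f (X t) - a| < alpha / 6 ->
    alpha / 3 <= Defs.eval r y - Defs.eval r (X t) ->
    exists a0 s', [/\ (if (hard s).+1%:R > hard_bound (N := N) alpha n t
        then (None, PMWGState (Some t) y (hard s).+1 s2)
        else (Some a, PMWGState (Some t) (mw_update alpha r y) (hard s).+1 s2)) = (Some a0, s'),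
      `|Defs.eval f (X t) - a0| <= alpha, run_invariant s' & last_time s' = Some t].
  move=> r ha hr.
  have lr : is_linear_query r.
    by rewrite /r; case: ifP => // _ i; have /andP[? ?] := lf i; apply/andP; split; lra.
  have dmw : is_positive_distribution (mw_update alpha r y) by exact: mw_update_positive_distribution.
  have cmw := cross_entropy_mw_update alpha_gt0 (dX nt) dy lr.
  have c0 := cross_entropy_ge0 (dX nt) dmw.
  have asq : 0 < alpha ^+ 2 by rewrite exprn_gt0.
  have H1 : (hard s).+1%:R = (hard s)%:R + 1 :> R by rewrite natr1.
  have cmw' : cross_entropy (X t) (mw_update alpha r y) + (hard s).+1%:R * (alpha ^+ 2 / 36)
      <= ln N%:R + \sum_(n.+1 <= tau < t.+1) pmwg_b (N := N) tau.
    apply: le_trans ce; rewrite H1.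
    have : alpha / 6 * (alpha / 3) <= alpha / 6 * (Defs.eval r y - Defs.eval r (X t)).
      by rewrite ler_wpM2l // divr_ge0 // ltW.
    have -> : alpha / 6 * (alpha / 3) = alpha ^+ 2 / 36 * 2 by field.
    move: cmw; rewrite -[Defs.eval r (X t) - _]opprB mulrN mulrDl mul1r.
    move: (cross_entropy _ (mw_update _ _ _)) => c1; move: (cross_entropy _ y) => c2.
    move: (alpha / 6 * _) (alpha ^+ 2 / 36) ((hard s)%:R : R) => u q H.
    exact: mw_linear.
  rewrite ifN; last first.
    rewrite -leNgt /hard_bound -[leLHS](@mulfK _ (alpha ^+ 2 / 36)); last by rewrite gt_eqF // divr_gt0.
    rewrite mulrC invf_div ler_wpM2l //; first by rewrite divr_ge0 // ltW.
    by apply: le_trans cmw'; rewrite lerDr.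
  exists a; eexists; split; first reflexivity; last by [].
  - exact/ltW/(lt_le_trans ha a6).
  - by split.
case: a1 ha1 => [b [h1]|h1].
  rewrite ltr_norml => /andP[b1 b2]; apply: hardP.
    by rewrite ltr_norml; apply/andP; split; lra.
  (* The real answer exceeds [alpha / 3 - alpha / 6 > 0], so [a] is above [f(y)] and the update uses
     [1 - f]; in the case of [g2] the signs are opposite. *)
  rewrite ifF; last by apply/negbTE; rewrite -leNgt; lra.
  by rewrite !compl //; lra.
case: a2 ha2 => [b [h2]|h2].
  rewrite ltr_norml => /andP[b1 b2]; apply: hardP.
    by rewrite ltr_norml; apply/andP; split; lra.
  by rewrite ifT; lra.
exists (Defs.eval f y); eexists; split; first reflexivity.
- by rewrite ler_norml; apply/andP; split; lra.
- by split.
- by [].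
Qed.

(** Ranges over every pair of size and serial number that some answers could produce, so that it
    does not depend on the run itself. *)
Definition good_noise := forall t k, (n <= t)%N ->
  (exists2 h, size h = k & arrival F h = Some t) ->
  small_noise t k.*2 /\ small_noise t k.*2.+1.

Lemma pmwg_accurate_transcript : good_noise ->
  accurate_transcript F alpha X (pmwg eps delta alpha n w X F).
Proof.
move=> gn; have [lF nF monoF _ _] := streamF.
have runP h : mkseq (pmwg eps delta alpha n w X F) (size h) = map Some h ->
    exists s, [/\ pmwg_run eps delta alpha n w X F (size h) = Some (h, s), run_invariant s &
      forall t0 t, last_time s = Some t0 -> arrival F h = Some t -> (t0 <= t)%N].
  elim/last_ind: h => [|h a IH].
    by move=> _; exists (pmwg_init (N := N)).
  rewrite size_rcons map_rcons mkseqS => /rcons_inj[/IH[s [runE inv lt]] ta].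
  have := ta; rewrite /pmwg /= runE.
  case Fh : (arrival F h) => [t|//].
  have nt := nF _ _ Fh; have [sn1 sn2] := gn t (size h) nt (ex_intro2 _ _ h erefl Fh).
  have [|a' [s' [stepE _ inv' ls']]] := pmwg_step_accurate inv nt _ (lF h) sn1 sn2.
    by move=> t0 ls; exact: lt Fh.
  rewrite stepE /= last_rcons => -[<-]; exists s'; split => //.
  move=> t0 t'; rewrite ls' => -[<-] Fh'.
  by have [t1] := monoF _ _ _ Fh'; rewrite Fh => -[->].
move=> h t eqh Fh; have [s [runE inv lt]] := runP h eqh.
have nt := nF _ _ Fh; have [sn1 sn2] := gn t (size h) nt (ex_intro2 _ _ h erefl Fh).
have [|a' [s' [stepE acc _ _]]] := pmwg_step_accurate inv nt _ (lF h) sn1 sn2.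
  by move=> t0 ls; exact: lt Fh.
by exists a' => //; rewrite /pmwg /= runE Fh stepE /= last_rcons.
Qed.

End GoodNoise.

(** * The accuracy event as a countable intersection of cylinders *)

Section AccuracyEvent.
Context {R : realType} {N : nat}.
Variables (n : nat) (alpha : R) (F : query_stream R N) (X : nat -> 'I_N -> R).
Hypothesis streamF : is_query_stream n F.
Local Notation Z := (mpub R N).

Definition accurate_answer (k : nat) : set (transcript R) :=
  [set tau | forall h t, size h = k -> mkseq tau k = map Some h -> arrival F h = Some t ->
    exists2 a, tau k = Some a & `|Defs.eval (query F h) (X t) - a| <= alpha].

Lemma accurate_transcriptE :
  accurate_transcript F alpha X = \bigcap_k accurate_answer k.
Proof.
apply/seteqP; split => [tau acc k _ h t <-|tau acc h t mk Fh]; first exact: acc.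
exact: (acc (size h) I _ _ erefl).
Qed.

(** A state with truncated history and dummy other fields, so that the measurability lemmas on
    states apply to prefixes of the history. *)
Let prefix (k : nat) (z : Z) : Z := Pub false (take k (ph z)) None (fun=> 0) 0 0 0.

Let measurable_prefix k : measurable_fun setT (prefix k).
Proof.
have mid : measurable_fun setT (id : Z -> Z) by exact: measurable_id.
apply: measurable_into_pub => -[||j||i|||] //=.
- under eq_fun do rewrite size_take_min.
  exact: (measurable_natfun (fun m => (minn k m)%:R) (measurable_size mid)).
- have [jk|kj] := ltnP j k.
    under eq_fun do rewrite nth_take //.
    exact: (measurable_coord mid (CNth N j)).
  under eq_fun do rewrite nth_default ?size_take_min ?geq_min ?kj //.
  exact: measurable_cst.
Qed.

Lemma cylinder_accurate_answer k : cylinder (N := N) (accurate_answer k).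
Proof.
have [_ _ _ _ [marrival mquery]] := streamF.
split.
  exists k.+1 => tau tau' e acc h t hk mk Fh; rewrite -e //; apply: acc Fh => //.
  rewrite -mk; apply/eq_in_map => j; rewrite mem_iota /= add0n => jk.
  by rewrite e // ltnW.
have mid : measurable_fun setT (id : Z -> Z) by exact: measurable_id.
have mp := @measurable_prefix k.
pose ans z := `|Defs.eval (query F (ph (prefix k z))) (X (pub_time n F (prefix k z)))
  - nth 0 (ph z) k| <= alpha.
pose b (z : Z) := [|| (size (ph z) < k)%N, last_code (arrival F (ph (prefix k z))) == 0%N
  | (k < size (ph z))%N && ans z].
have mb : measurable_fun setT b.
  apply: measurable_or.
    exact: (measurableT_comp (measurable_nat_fun (fun m => (m < k)%N)) (measurable_size mid)).
  apply: measurable_or.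
    by apply: measurable_eqnat; exact: (measurable_arrival marrival mp).
  apply: measurable_and.
    exact: (measurableT_comp (measurable_nat_fun (fun m => (k < m)%N)) (measurable_size mid)).
  apply: measurable_fun_ler => //.
  apply: (measurableT_comp (@normr_measurable R setT)).
  apply: measurable_funB; last exact: (measurable_coord mid (CNth N k)).
  apply: measurable_sum => i; apply: measurable_funM.
    exact: (measurable_pub_f mquery mp).
  exact: (measurable_natfun (fun t => X t i) (measurable_pub_time n marrival mp)).
rewrite (_ : [set _ | _] = b @^-1` [set true]).
  by rewrite -[X in measurable X]setTI; exact: mb.
have mkE (s : seq R) : (k <= size s)%N -> mkseq (onth s) k = map Some (take k s).
  move=> ks; apply: (@eq_from_nth _ None) => [|j].
    by rewrite size_mkseq size_map size_takel.
  rewrite size_mkseq => jk; have js := leq_trans jk ks.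
  by rewrite nth_mkseq // (nth_map 0) ?size_takel // nth_take // onthE (nth_map 0).
apply/seteqP; split => [z acc|z].
  rewrite /preimage /= /b; case: (ltnP (size (ph z)) k) => //= ks.
  case Fh : (arrival F _) => [t|//] /=.
  have [|a za ha] := acc (take k (ph z)) t _ (mkE _ ks) Fh; first by rewrite size_takel.
  rewrite -onthTE za /= /ans /pub_time Fh /=.
  by rewrite -(odflt_onth 0) za.
rewrite /preimage /= /b => bz h t hk mk Fh.
have ks : (k <= size (ph z))%N.
  rewrite leqNgt; apply/negP => sk.
  have : nth None (mkseq (onth (ph z)) k) (size (ph z)) = nth None (map Some h) (size (ph z)) by rewrite mk.
  by rewrite nth_mkseq // (nth_map 0) ?hk // onthE nth_default // size_map.
have hE : h = take k (ph z).
  by apply: (inj_map (@Some_inj _)); rewrite -mk mkE.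
move: bz; rewrite ltnNge ks /= -hE Fh /= /ans => /andP[kz].
rewrite /pub_time /= -hE Fh /= => ha.
exists (nth 0 (ph z) k) => //.
by rewrite onthE (nth_map 0).
Qed.

End AccuracyEvent.

(** * Counting queries and summing failure probabilities *)

Lemma arrival_take (R : realType) N n (F : query_stream R N) h t j :
  is_query_stream n F -> arrival F h = Some t -> (j <= size h)%N ->
  exists2 t', arrival F (take j h) = Some t' & (n <= t' <= t)%N.
Proof.
move=> [_ nF monoF _ _].
elim/last_ind: h t => [|h a IH] t Fh; rewrite ?size_rcons leq_eqVlt => /orP[/eqP->|].
- by exists t; rewrite // leqnn (nF _ _ Fh).
- by [].
- by rewrite -(size_rcons h a) take_size; exists t => //; rewrite leqnn (nF _ _ Fh).
rewrite ltnS => jh; have [t1 Fh1 t1t] := monoF _ _ _ Fh.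
have [t' Ft' /andP[nt' t't1]] := IH t1 Fh1 jh.
exists t'; last by rewrite nt' (leq_trans t't1).
by rewrite -cats1 takel_cat.
Qed.

(** Arrivals are monotone, so each of the [(size h).+1] queries is counted at a size between [n] and
    [t]. This turns a bound on the number of queries into one on serial numbers. *)
Lemma size_lt_sum_ell (R : realType) N n (F : query_stream R N) h t :
  is_query_stream n F -> arrival F h = Some t ->
  (size h < \sum_(n <= tau < t.+1) ell F h tau)%N.
Proof.
move=> streamF Fh; rewrite /ell exchange_big /= -[leqLHS]muln1 -{1}[(size h).+1]card_ord -sum_nat_const.
apply: leq_sum => k _; have kh : (k <= size h)%N by rewrite -ltnS.
have [t' -> /andP[nt' t't]] := arrival_take streamF Fh kh.
by rewrite (big_rem t') /= ?eqxx // mem_index_iota nt'.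
Qed.

(* Three exponential margins absorb the polynomial [t ^ 3 <= n ^ 3 r ^ 6], the
   factor [kappa / beta] and the numerical constant. *)
Lemma failure_sum_bound (R : realType) (n t : nat) (kappa beta s : R) :
  (17 <= n)%N -> (n <= t)%N -> 1 <= kappa -> 0 < beta <= 1 ->
  11 * ln (kappa * n%:R / beta) * Num.sqrt (t%:R / n%:R) <= s ->
  12 * kappa * t%:R * expR (- s) <= beta / (t.+1%:R * t.+2%:R).
Proof.
move=> n17 nt k1 /andP[b0 b1] hs.
set r := Num.sqrt _ in hs; set q := kappa * n%:R / beta in hs.
have n0 : 0 < n%:R :> R by rewrite ltr0n (leq_trans _ n17).
have t0 : 0 < t%:R :> R by rewrite ltr0n (leq_trans _ nt) // (leq_trans _ n17).
have k0 : 0 < kappa by exact: lt_le_trans k1.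
have r1 : 1 <= r.
  rewrite /r -[X in X <= _]sqrtr1 ler_wsqrtr // ler_pdivlMr // mul1r.
  by rewrite ler_nat.
have r0 : 0 < r by exact: lt_le_trans r1.
have tE : t%:R = n%:R * r ^+ 2 :> R.
  by rewrite /r sqr_sqrtr ?divr_ge0 ?ltW // mulrC divfK ?gt_eqF.
have q17 : 17 <= q.
  rewrite /q ler_pdivlMr //; apply: (@le_trans _ _ (17 * 1)); first by rewrite ler_pM2l.
  rewrite mulr1; apply: (@le_trans _ _ (1 * n%:R)); last by rewrite ler_pM2r.
  by rewrite mul1r (ler_nat R 17).
have q0 : 0 < q by exact: lt_le_trans q17.
have [q_ge0 r_ge0 n_ge0 t_ge0] := And4 (ltW q0) (ltW r0) (ltW n0) (ltW t0).
set D := ln q in hs.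
have qE : q = expR D by rewrite /D lnK.
have D1 : 1 <= D.
  apply: (@le_trans _ _ 2); first by rewrite ler1n.
  by apply: (le_trans (ln_nat_ge2 (leqnn 17))); rewrite /D ler_ln ?posrE // ltr0n.
have Dr : D <= D * r by rewrite ler_peMr // (le_trans _ D1).
have rDr : r <= expR (D * r).
  apply: le_trans (_ : r <= expR r) _.
    by have := @expR_ge1Dx R r; apply: le_trans; rewrite lerDr.
  by rewrite ler_expR ler_peMl // ltW.
have qDr : q <= expR (D * r) by rewrite qE ler_expR.
have step : 12 * kappa * t%:R * (t.+1%:R * t.+2%:R) <= beta * expR s.
  (* 11 is 5 + 6: five powers of [q] and six of [r], each at most [expR (D * r)]. *)
  apply: (@le_trans _ _ (beta * expR (D * r) ^+ 11)); last first.
    by rewrite ler_pM2l // -expRM_natl ler_expR mulrA.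
  apply: (@le_trans _ _ (beta * (q ^+ 5 * r ^+ 6))); last first.
    rewrite ler_pM2l // (exprD _ 5 6).
    by apply: ler_pM; rewrite ?exprn_ge0 // lerXn2r ?nnegrE ?expR_ge0.
  have n1 : 1 <= n%:R :> R by rewrite ler1n (leq_trans _ n17).
  have t1 : 1 <= t%:R :> R by rewrite ler1n (leq_trans _ nt) // (leq_trans _ n17).
  apply: (@le_trans _ _ (72 * kappa * t%:R ^+ 3)).
    rewrite -[t.+2%:R]natr1 -[t.+1%:R]natr1.
    rewrite (_ : 72 * _ * _ = (12 * kappa * t%:R) * ((t%:R + t%:R) * (t%:R + t%:R + t%:R))); last by ring.
    rewrite ler_pM2l ?mulr_gt0 //; apply: ler_pM; rewrite ?addr_ge0 //; lra.
  rewrite tE (_ : 72 * kappa * _ = 72 * (kappa * n%:R ^+ 3) * r ^+ 6); last by ring.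
  rewrite [leRHS]mulrA ler_pM2r ?exprn_gt0 //.
  have bq : beta * q = kappa * n%:R by rewrite /q mulrC divfK ?gt_eqF.
  (* [beta * q] is [kappa * n]; two of the other factors [q] dominate [n ^ 2], and two dominate 72
     because [17 <= q]. *)
  rewrite (_ : beta * q ^+ 5 = (q ^+ 2) * ((beta * q) * q ^+ 2)); last by ring.
  have nq : n%:R <= q.
    rewrite /q ler_pdivlMr //; apply: (@le_trans _ _ (n%:R * 1)); first by rewrite ler_pM2l.
    by rewrite mulr1 ler_peMl // ltW.
  rewrite bq; apply: ler_pM; rewrite ?mulr_ge0 ?exprn_ge0 ?(ltW k0) //.
    apply: (@le_trans _ _ (17 ^+ 2)); first by rewrite -natrX ler_nat.
    by rewrite lerXn2r ?nnegrE.
  by rewrite exprS mulrA ler_pM2l ?mulr_gt0 // lerXn2r ?nnegrE.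
by rewrite ler_pdivlMr ?mulr_gt0 // expRN mulrAC ler_pdivrMr ?expR_gt0.
Qed.

Section UnionBound.
Context {R : realType} {d : measure_display} {Omega : measurableType d}.
Variables (P : probability Omega R) (beta : R) (E : nat -> set Omega).
Hypothesis beta_ge0 : 0 <= beta.
Hypothesis mE : forall t, measurable (E t).
Hypothesis PE : forall t, (P (E t) <= (beta / (t.+1%:R * t.+2%:R))%:E)%E.

Lemma telescoping_union_bound : (P (\bigcup_t E t) <= beta%:E)%E.
Proof.
have mU : measurable (\bigcup_t E t) by exact: bigcupT_measurable.
apply: le_trans (generalized_Boole_inequality P mE mU) _.
apply: lime_le; first by apply: is_cvg_nneseries => *; exact: measure_ge0.
(* [1 - 1 / k.+1] is the sum of the first [k] weights [1 / (t.+1 * t.+2)]. *)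
near=> k; apply: (@le_trans _ _ (beta * (1 - 1 / k.+1%:R))%:E).
  elim: (k) => [|m IH]; first by rewrite big_geq // divr1 subrr mulr0.
  rewrite big_nat_recr //=; apply: le_trans (leeD IH (PE m)) _.
  rewrite -EFinD lee_fin -mulrDr ler_wpM2l // -[m.+2%:R]natr1.
  have m0 : 0 < m.+1%:R :> R by rewrite ltr0n.
  have : m.+1%:R + 1 != 0 :> R by rewrite gt_eqF // addr_gt0.
  move: (m.+1%:R : R) (gt_eqF m0) => x /negbT x0 x1.
  by rewrite le_eqVlt; apply/orP; left; apply/eqP; field; rewrite x0 x1.
by rewrite lee_fin ler_piMr // lerBlDr lerDl divr_ge0.
Unshelve. all: by end_near. Qed.

End UnionBound.

Section NoiseTails.
Context {R : realType} {N : nat} {d : measure_display} {Omega : measurableType d}.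
Variables (P : probability Omega R) (W : noise_kind -> nat -> nat -> {RV P >-> R}).
Variables (alpha : R) (n : nat) (xi : nat -> R).
Hypothesis alpha_gt0 : 0 < alpha.
Hypothesis xi_gt0 : forall t, (n <= t)%N -> 0 < xi t.
Hypothesis noiseW : is_noise xi n W.

(* The same number of scales for the three kinds of draws, so that the tails are
   equal; the draw [Ans] is the one that needs the constant 48. *)
Definition large_draw (t m : nat) (c : noise_kind) : set Omega :=
  [set w | noise_scale xi c t * (alpha * xi t / 48) <= `|W c t m w|].

Definition large_noise (t m : nat) : set Omega :=
  large_draw t m Eta `|` large_draw t m Nu `|` large_draw t m Ans.

Lemma measurable_large_draw t m c : measurable (large_draw t m c).
Proof.
have mW : measurable_fun setT (fun w => `|W c t m w|).
  exact: (measurableT_comp (@normr_measurable R setT) (measurable_funPT (W c t m))).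
rewrite (_ : large_draw t m c = (fun w => `|W c t m w|) @^-1`
  `[noise_scale xi c t * (alpha * xi t / 48), +oo[).
  by rewrite -[X in measurable X]setTI; apply: mW.
by apply/seteqP; split => w; rewrite /large_draw /preimage /= in_itv /= andbT.
Qed.

Lemma measurable_large_noise t m : measurable (large_noise t m).
Proof.
by apply: measurableU; [apply: measurableU|]; exact: measurable_large_draw.
Qed.

Lemma large_noise_prob t m : (n <= t)%N ->
  (P (large_noise t m) <= (6 * expR (- (alpha * xi t / 48)))%:E)%E.
Proof.
move=> nt; have x0 := xi_gt0 nt.
have Pd c : (P (large_draw t m c) <= (2 * expR (- (alpha * xi t / 48)))%:E)%E.
  have b0 : 0 < noise_scale xi c t by case: c; rewrite /= ?divr_gt0.
  have := @laplace_tail R (distribution P (W c t m)) (noise_scale xi c t)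
    (noise_scale xi c t * (alpha * xi t / 48)) b0 _ (noiseW.1 c t m nt).
  have -> : noise_scale xi c t * (alpha * xi t / 48) / noise_scale xi c t = alpha * xi t / 48.
    by rewrite mulrAC divff ?gt_eqF // mul1r.
  apply.
  by rewrite mulr_ge0 ?divr_ge0 ?mulr_ge0 // ltW.
rewrite (_ : 6 * _ = 2 * expR (- (alpha * xi t / 48)) + 2 * expR (- (alpha * xi t / 48))
  + 2 * expR (- (alpha * xi t / 48))); last by ring.
rewrite !EFinD.
apply: le_trans (measureU2 _ (measurableU _ _ (measurable_large_draw t m Eta)
  (measurable_large_draw t m Nu)) (measurable_large_draw t m Ans)) _.
apply: leeD (Pd _); apply: le_trans (leeD (Pd Eta) (Pd Nu)).
by apply: measureU2; exact: measurable_large_draw.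
Qed.

(** In absolute terms the three cutoffs are [alpha * xi t / 24], [alpha / 12] and [alpha / 6]. *)
Lemma small_noiseP t m w : (n <= t)%N -> ~ large_noise t m w ->
  [/\ `|W Eta t m w| < alpha / 6 * xi t, `|W Nu t m w| < alpha / 6 & `|W Ans t m w| < alpha / 6].
Proof.
move=> nt h; have x0 := xi_gt0 nt.
have small c : `|W c t m w| < noise_scale xi c t * (alpha * xi t / 48).
  by rewrite ltNge; apply/negP => hc; apply: h; case: c hc => hc; rewrite /large_noise /=; tauto.
have ax : 0 < alpha * xi t by rewrite mulr_gt0.
split; apply: lt_le_trans (small _) _; rewrite /=.
- by move: ax; rewrite [leRHS]mulrAC; move: (alpha * xi t) => u; lra.
- rewrite (_ : _ * _ = alpha / 12); last by field; rewrite gt_eqF.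
  by rewrite ler_pM2l // lef_pV2 ?posrE // ler_nat.
- by rewrite (_ : _ * _ = alpha / 6) //; field; rewrite gt_eqF.
Qed.

End NoiseTails.

(** * Accuracy of the mechanism *)

Section PMWGAccuracy.
Context {R : realType} {N : nat} {d : measure_display} {Omega : measurableType d}.
Variables (P : probability Omega R) (W : noise_kind -> nat -> nat -> {RV P >-> R}).
Variables (eps delta alpha kappa beta : R) (n : nat) (F : query_stream R N).
Local Notation xi := (pmwg_xi (N := N) eps delta alpha n).
Local Notation C := (2 * 48 * 48 : R).
Local Notation sL := (Num.sqrt (ln (N * n)%:R) : R).
Local Notation sl := (Num.sqrt (ln (1 / delta)) : R).
Local Notation D := (ln (kappa * n%:R / beta)).
Local Notation exponent t := (alpha ^+ 2 * eps * Num.sqrt (n * t)%:R / (C * sL * sl)).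
Hypothesis N_ge3 : (3 <= N)%N.
Hypothesis n_ge17 : (17 <= n)%N.
Hypothesis eps01 : 0 < eps <= 1.
Hypothesis delta0e : 0 < delta < expR (-1).
Hypothesis noiseW : is_noise xi n W.
Hypothesis streamF : is_query_stream n F.
Hypothesis kappa_ge1 : 1 <= kappa.
Hypothesis beta01 : 0 < beta <= 1.
Hypothesis few_queries : forall h t, (n <= t)%N ->
  (\sum_(n <= tau < t.+1) ell F h tau)%:R
  <= kappa * \sum_(n <= tau < t.+1) expR (exponent tau).
Hypothesis alpha_large : C * Num.sqrt (sL * D * sl / (n%:R * eps)) <= alpha.

Let n_gt0 : 0 < n%:R :> R. Proof. by rewrite ltr0n (leq_trans _ n_ge17). Qed.
Let eps_gt0 : 0 < eps. Proof. by case/andP: eps01. Qed.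
Let sL_gt0 : 0 < sL. Proof. by rewrite sqrtr_gt0 lnNn_gt0. Qed.
Let sl_gt0 : 0 < sl.
Proof. by rewrite sqrtr_gt0 (lt_trans _ (ln_inv_delta_gt1 delta0e)). Qed.
Let kappa_gt0 : 0 < kappa. Proof. exact: lt_le_trans kappa_ge1. Qed.

Let D_gt0 : 0 < D.
Proof.
case/andP: beta01 => b0 b1; rewrite ln_gt0 // ltr_pdivlMr // mul1r.
apply: (le_lt_trans b1); apply: (@lt_le_trans _ _ n%:R).
  by rewrite ltr1n (leq_trans _ n_ge17).
by rewrite ler_peMl // ltW.
Qed.

Let rate_gt0 : 0 < sL * D * sl / (n%:R * eps).
Proof. by rewrite divr_gt0 ?mulr_gt0. Qed.

Let alpha_gt0 : 0 < alpha.
Proof. by apply: lt_le_trans alpha_large; rewrite !mulr_gt0 // sqrtr_gt0. Qed.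

Let xi_gt0 t : (n <= t)%N -> 0 < xi t.
Proof. exact: pmwg_xi_gt0. Qed.

Lemma pmwg_xi_le t t' : (n <= t)%N -> (t <= t')%N -> xi t <= xi t'.
Proof.
move=> nt tt'; have := xi_gt0 nt; rewrite /pmwg_xi; case: ifP => _.
  rewrite pmulr_lgt0 ?sqrtr_gt0 ?ltr0n; last by apply: leq_trans nt; exact: leq_trans n_ge17.
  by move=> h; rewrite ler_pM2l // ler_wsqrtr // ler_nat.
rewrite pmulr_lgt0 ?sqrtr_gt0 ?ltr0n; last by apply: leq_trans nt; exact: leq_trans n_ge17.
by move=> h; rewrite ler_pM2l // ler_wsqrtr // ler_nat.
Qed.

(** The origin of [2 * 48 * 48]: one 48 is in [pmwg_xi], one in the tails, and the 2 leaves half of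
    the tail exponent for the number of queries and half for the failure probability. *)
Let noise_exponent t : alpha * xi t / 48 = 2 * exponent t.
Proof.
rewrite /pmwg_xi gt_eqF; last by case/andP: delta0e.
rewrite [(n * t)%:R]natrM sqrtrM ?ler0n //.
have c0 : (48 : R) != 0 by rewrite pnatr_eq0.
move: (Num.sqrt _) (Num.sqrt _) (Num.sqrt _) (Num.sqrt _) (gt_eqF sL_gt0) (gt_eqF sl_gt0) c0.
move: (48 : R) => c a b L l L0 l0 c0; field.
by rewrite c0 L0 l0.
Qed.

(** Squaring the lower bound on [alpha] gives the inequality with [C] in place of 11, the constant
    that [failure_sum_bound] asks for. *)
Let exponent_ge t : (n <= t)%N -> 11 * D * Num.sqrt (t%:R / n%:R) <= exponent t.
Proof.
move=> nt.
have b0 : 0 <= Num.sqrt t%:R :> R by exact: sqrtr_ge0.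
have a0 : 0 < Num.sqrt n%:R :> R by rewrite sqrtr_gt0.
have C0 : 0 < C by rewrite !mulr_gt0.
have nE : n%:R = Num.sqrt n%:R ^+ 2 :> R by rewrite sqr_sqrtr // ltW.
have alpha2 : C ^+ 2 * (sL * D * sl / (n%:R * eps)) <= alpha ^+ 2.
  rewrite -[X in _ * X](sqr_sqrtr (ltW rate_gt0)) -exprMn.
  by rewrite lerXn2r ?nnegrE ?(ltW alpha_gt0) // mulr_ge0 ?(ltW C0) ?sqrtr_ge0.
apply: (@le_trans _ _ (C ^+ 2 * (sL * D * sl / (n%:R * eps)) *
    (eps * Num.sqrt (n * t)%:R / (C * sL * sl)))); last first.
  rewrite -[X in _ <= X / _]mulrA -[leRHS]mulrA; apply: ler_wpM2r alpha2.
  by rewrite divr_ge0 ?mulr_ge0 ?sqrtr_ge0 ?(ltW eps_gt0) ?(ltW C0).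
have C11 : 11 <= C by rewrite -!natrM ler_nat.
rewrite [(n * t)%:R]natrM sqrtrM ?ler0n // sqrtrM ?ler0n // sqrtrV ?ler0n //.
rewrite [X in _ / (X * eps)]nE.
have -> : C ^+ 2 * (sL * D * sl / (Num.sqrt n%:R ^+ 2 * eps)) *
    (eps * (Num.sqrt n%:R * Num.sqrt t%:R) / (C * sL * sl)) = C * (D * (Num.sqrt t%:R / Num.sqrt n%:R)).
  move: (gt_eqF C0) (gt_eqF sL_gt0) (gt_eqF sl_gt0) (gt_eqF a0) (gt_eqF eps_gt0).
  move: C sL sl (Num.sqrt n%:R) => c L l a h1 h2 h3 h4 h5; field.
  by rewrite h1 h2 h3 h4 h5.
rewrite -mulrA ler_wpM2r // mulr_ge0 ?divr_ge0 ?(ltW D_gt0) ?(ltW a0) //.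
Qed.

Let query_bound t := kappa * \sum_(n <= tau < t.+1) expR (exponent tau).

Let query_bound_le t : (n <= t)%N -> query_bound t <= kappa * (t%:R * expR (exponent t)).
Proof.
move=> nt; rewrite ler_pM2l //.
apply: (@le_trans _ _ (\sum_(n <= tau < t.+1) expR (exponent t))).
  apply: ler_sum_nat => tau /andP[_ taut]; rewrite ler_expR ler_pM2r ?invr_gt0 ?mulr_gt0 //.
  by rewrite ler_pM2l ?mulr_gt0 ?exprn_gt0 // ler_wsqrtr // ler_nat leq_mul2l -ltnS taut orbT.
rewrite sumr_const_nat -[leLHS]mulr_natl ler_pM2r ?expR_gt0 // ler_nat.
by rewrite leq_subLR -addn1 addnC leq_add2r (leq_trans _ n_ge17).
Qed.

Let query_noise t k := large_noise W alpha xi t k.*2 `|` large_noise W alpha xi t k.*2.+1.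

(** [query_bound t] is deterministic, so the union over all serial numbers possible at size [t] is a
    fixed finite one. *)
Let failure t := if (n <= t)%N
  then \big[setU/set0]_(k < Num.truncn (query_bound t)) query_noise t k else set0.

Let measurable_query_noise t k : measurable (query_noise t k).
Proof. by apply: measurableU; exact: measurable_large_noise. Qed.

Let measurable_failure t : measurable (failure t).
Proof.
rewrite /failure; case: ifP => // _.
by apply: bigsetU_measurable => k _; exact: measurable_query_noise.
Qed.

Let failure_prob t : (P (failure t) <= (beta / (t.+1%:R * t.+2%:R))%:E)%E.
Proof.
case/andP: beta01 => b0 b1.
rewrite /failure; case: ifP => [nt|_]; last by rewrite measure0 lee_fin divr_ge0 ?mulr_ge0 // ltW.
(* Six for each of the two submissions of a query. *)
have Pq k : (P (query_noise t k) <= (12 * expR (- (2 * exponent t)))%:E)%E.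
  rewrite -noise_exponent (_ : 12 * _ = 6 * expR (- (alpha * xi t / 48)) +
    6 * expR (- (alpha * xi t / 48))); last by ring.
  rewrite EFinD; apply: le_trans (measureU2 _ _ _) _; [exact: measurable_large_noise..|].
  by apply: leeD; exact: (large_noise_prob alpha_gt0 xi_gt0 noiseW _ nt).
apply: le_trans (Boole_inequality P (fun k _ => measurable_query_noise t k)) _.
apply: (@le_trans _ _ (\sum_(k < Num.truncn (query_bound t)) (12 * expR (- (2 * exponent t)))%:E)%E).
  by apply: lee_sum => k _; exact: Pq.
rewrite sumEFin lee_fin sumr_const card_ord -[leLHS]mulr_natl.
have sb := failure_sum_bound n_ge17 nt kappa_ge1 beta01 (exponent_ge nt).
apply: le_trans sb.
have qb0 : 0 <= query_bound t.
  by rewrite mulr_ge0 ?(ltW kappa_gt0) // sumr_ge0 // => tau _; exact: expR_ge0.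
have tr : (Num.truncn (query_bound t))%:R <= query_bound t by have /andP[] := truncn_itv qb0.
apply: (@le_trans _ _ (kappa * (t%:R * expR (exponent t)) * (12 * expR (- (2 * exponent t))))).
  apply: ler_wpM2r; first by rewrite mulr_ge0 // expR_ge0.
  exact: le_trans (query_bound_le nt).
rewrite le_eqVlt; apply/orP; left; apply/eqP.
have -> : expR (- exponent t) = expR (exponent t) * expR (- (2 * exponent t)).
  by rewrite -expRD; congr expR; ring.
by ring.
Qed.

Lemma pmwg_accurate : accurate P n F alpha beta
  (fun X w => pmwg eps delta alpha n (fun c t m => W c t m w) X F).
Proof.
move=> X dbX.
have mA : measurable [set w | accurate_transcript F alpha X
    (pmwg eps delta alpha n (fun c t m => W c t m w) X F)].
  rewrite (_ : [set _ | _] = \bigcap_k (fun w => pmwg eps delta alpha n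
      (fun c t m => W c t m w) X F) @^-1` accurate_answer alpha F X k).
    apply: bigcapT_measurable => k; apply: measurable_pmwg_cylinder => //.
    exact: cylinder_accurate_answer streamF k.
  rewrite -preimage_bigcap -accurate_transcriptE //.
have mU : measurable (\bigcup_t failure t) by exact: bigcupT_measurable.
apply: (@le_trans _ _ (P (~` \bigcup_t failure t))).
  rewrite probability_setC // EFinB; apply: leeB => //.
  case/andP: beta01 => /ltW b0 _.
  exact: (telescoping_union_bound b0 measurable_failure failure_prob).
apply: le_measure; rewrite ?inE //; first exact: measurableC.
move=> w /= nf; apply: pmwg_accurate_transcript => //; first exact: pmwg_xi_le.
move=> t k nt [h hk Fh].
(* Counting from 0, the query of index [k] is the [k.+1]-st asked, so [k.+1] is at most
   [query_bound t]. *)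
have kK : (k < Num.truncn (query_bound t))%N.
  rewrite ltnNge truncn_le_nat -leNgt; apply: le_trans (few_queries h nt).
  by rewrite ler_nat -hk; exact: size_lt_sum_ell Fh.
have nq : ~ query_noise t k w.
  move=> q; apply: nf; exists t => //; rewrite /failure nt -bigcup_mkord.
  by exists k.
by split; apply: (small_noiseP alpha_gt0 xi_gt0 nt) => l; apply: nq; [left|right].
Qed.

End PMWGAccuracy.

Theorem theorem22 (R : realType) :
  exists C : R, 0 < C /\
  forall (N n : nat) (eps delta alpha : R)
    (d : measure_display) (Omega : measurableType d) (P : probability Omega R)
    (W : noise_kind -> nat -> nat -> {RV P >-> R}) (F : query_stream R N),
  (3 <= N)%N -> (17 <= n)%N -> 0 < eps <= 1 -> 0 < delta < expR (- 1) ->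
  is_noise (pmwg_xi (N := N) eps delta alpha n) n W ->
  is_query_stream n F ->
  let PMWG X w := pmwg eps delta alpha n (fun c t m => W c t m w) X F in
  (0 < alpha <= 1 -> differentially_private P n eps delta PMWG) /\
  (forall kappa beta : R,
     1 <= kappa -> 0 < beta < 2 `^ (- (15 / 2)) ->
     (forall h t, (n <= t)%N ->
        (\sum_(n <= tau < t.+1) ell F h tau)%:R
        <= kappa * \sum_(n <= tau < t.+1)
             expR (alpha ^+ 2 * eps * Num.sqrt (n * tau)%:R
                   / (C * Num.sqrt (ln (N * n)%:R)
                        * Num.sqrt (ln (1 / delta))))) ->
     C * Num.sqrt (Num.sqrt (ln (N * n)%:R) * ln (kappa * n%:R / beta)
                     * Num.sqrt (ln (1 / delta)) / (n%:R * eps)) <= alpha ->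
     accurate P n F alpha beta PMWG).
Proof.
exists (2 * 48 * 48); split; first by rewrite !mulr_gt0.
move=> N n eps delta alpha d Omega P W F N_ge3 n_ge17 eps01 delta0e noiseW streamF PMWG.
split=> [/andP[alpha_gt0 alpha_le1]|kappa beta kappa_ge1 /andP[b0 b1] few large].
  exact: pmwg_differentially_private.
apply: (pmwg_accurate _ _ _ _ _ _ kappa_ge1 _ few large) => //; rewrite b0 /=.
apply: le_trans (ltW b1) _; rewrite -[leRHS](powRr0 2).
by apply: ler_powR; rewrite ?ler1n // oppr_le0 divr_ge0.
Qed.
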